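(* Let $n\ge1$ and $b>0$. Let $X$ be a random $2n\times2n$ antisymmetric complex matrix ($X^T=-X$) whose entries $X_{jk}$, $j<k$, are independent complex Gaussians with real and imaginary parts independent of mean $0$ and variance $1/2$, and let $\vec x$ be an independent $2n\times1$ vector of independent complex Gaussians of the same type. Then the eigenvalues $x_1>x_2>\dots>x_{2n}\ge0$ of $M=X^\dagger X+b\,\vec x\vec x^{\,\dagger}$ have joint probability density $$\frac1C\prod_{j=1}^{2n}e^{-x_j/2}\prod_{j=1}^ne^{A(x_{2j-1}-x_{2j})/2}\prod_{1\le j<k\le2n}(x_j-x_k),\qquad A=1-\frac2b,$$ where $C$ is the normalization constant. *)

(* Defs.v *)
From HB Require Import structures.
From mathcomp Require Import all_boot all_order all_algebra.
From mathcomp Require Import all_classical all_reals all_analysis.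
From mathcomp Require Import complex.

Set Implicit Arguments.
Unset Strict Implicit.
Unset Printing Implicit Defensive.

Import Order.TTheory GRing.Theory Num.Theory.
Local Open Scope classical_set_scope.
Local Open Scope ring_scope.

(* Integral of f : n.-tuple R -> \bar R against the n-fold product measure
   mu^{(x) n}, written as an iterated integral (Tonelli; used only for
   nonnegative integrands). *)
Fixpoint iter_int (d : measure_display) (T : measurableType d) (R : realType)
  (mu : {measure set T -> \bar R}) (n : nat)
  : (n.-tuple T -> \bar R) -> \bar R :=
  match n return (n.-tuple T -> \bar R) -> \bar R with
  | 0 => fun f => f [tuple]
  | n'.+1 => fun f =>
      (\int[mu]_x iter_int mu (fun t : n'.-tuple T => f [tuple of x :: t]))%E
  end.
Arguments iter_int {d T R} mu n f.

(* Index set of the independent real Gaussian coordinates: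
   inl (b, (j, k)) : real (b = false) / imaginary (b = true) part of an
                     auxiliary i.i.d. array Y_{jk}; X_{jk} := Y_{jk} for j<k;
   inr (b, j)      : real / imaginary part of x_j. *)
Definition Ipar (n : nat) : finType :=
  ((bool * ('I_(2 * n) * 'I_(2 * n))) + (bool * 'I_(2 * n)))%type.

Definition coord (n : nat) (R : Type) (w : #|Ipar n|.-tuple R) (i : Ipar n) : R :=
  tnth w (enum_rank i).

Definition Ymat (R : realType) (n : nat) (w : #|Ipar n|.-tuple R)
  : 'M[R[i]]_(2 * n) :=
  \matrix_(j, k) Complex (coord w (inl (false, (j, k))))
                         (coord w (inl (true, (j, k)))).

Definition Xmat (R : realType) (n : nat) (w : #|Ipar n|.-tuple R)
  : 'M[R[i]]_(2 * n) :=
  \matrix_(j, k) if (j < k)%N then Ymat w j k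
                 else if (k < j)%N then - Ymat w k j else 0.

Definition xvec (R : realType) (n : nat) (w : #|Ipar n|.-tuple R)
  : 'cV[R[i]]_(2 * n) :=
  \col_j Complex (coord w (inr (false, j))) (coord w (inr (true, j))).

Definition adjmx (R : realType) (m p : nat) (A : 'M[R[i]]_(m, p))
  : 'M[R[i]]_(p, m) := map_mx (@conjc R) A^T.

Definition Mmat (R : realType) (n : nat) (b : R) (w : #|Ipar n|.-tuple R)
  : 'M[R[i]]_(2 * n) :=
  adjmx (Xmat w) *m Xmat w + (b%:C)%C *: (xvec w *m adjmx (xvec w)).

Definition sorted_spectrum (R : realType) (m : nat) (M : 'M[R[i]]_m)
  (x : m.-tuple R) : Prop :=
  (forall i j : 'I_m, (i <= j)%N -> tnth x j <= tnth x i) /\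
  char_poly M = \prod_(i < m) ('X - ((tnth x i)%:C)%C%:P).

Definition region (R : realType) (n : nat) : set ((2 * n).-tuple R) :=
  [set x | (forall j : nat, (j.+1 < 2 * n)%N -> nth 0 x j.+1 < nth 0 x j)
           /\ 0 <= nth 0 x (2 * n).-1].

(* unnormalized density, 0-based: x_{2j-1} - x_{2j} becomes x_(2j) - x_(2j+1) *)
Definition dens (R : realType) (n : nat) (b : R) (x : (2 * n).-tuple R) : R :=
  let A := 1 - 2 / b in
  (\prod_(j < 2 * n) expR (- nth 0 x j / 2)) *
  (\prod_(j < n) expR (A * (nth 0 x (2 * j) - nth 0 x (2 * j).+1) / 2)) *
  (\prod_(j < 2 * n) \prod_(k < 2 * n | (j < k)%N) (nth 0 x j - nth 0 x k)).

(* Main.v *)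
Require Import Defs.
From HB Require Import structures.
From mathcomp Require Import all_boot all_order all_algebra.
From mathcomp Require Import all_classical all_reals all_analysis.
From mathcomp Require Import measurable_realfun polyorder polyrcf.
From mathcomp Require Import complex ring lra zify.

Set Implicit Arguments.
Unset Strict Implicit.
Unset Printing Implicit Defensive.

Import Order.TTheory GRing.Theory Num.Theory.
Import numFieldNormedType.Exports.
Local Open Scope classical_set_scope.
Local Open Scope ring_scope.

(** Border [X] by the conjugated vector as a row 0, and by the matching column, to get an
    antisymmetric matrix A of order 2n+1 with indices 0, ..., 2n. If r denotes its row 0 and B its
    block of indices at least 1, then M = adj(B) B + b adj(r) r. A congruence A -> G A G^T, with G
    unitary and fixing index 0, preserves the Gaussian weight ([sum_rho]) and conjugates M by a
    unitary matrix ([char_poly_rho]). Phases and plane rotations of this kind bring A to a real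
    tridiagonal form with squared off-diagonal entries h_0, ..., h_{2n-1}. Row p holds 2n-p complex
    Gaussians, so h_p acquires a density proportional to h^(2n-1-p) e^(-h) ([Int_radial],
    [tri_reduction]).

    In tridiagonal form M is T^T T + b h_0 e_0 e_0^T with T real antisymmetric. The characteristic
    polynomial of T^T T is a square up to a factor X, and that of M factors as P Q, where (P, Q) are
    the last two terms of a recurrence p_{m+1} = X^e p_m - k p_{m-1} started at 1, 1, with e
    alternating between 1 and 0 and with coefficients k running through h_{2n-1}, ..., h_1, b h_0
    ([QQ_pp], [char_poly_tri]). When all k are positive the roots are positive and strictly
    interlace: P gets x_1, x_3, ... and Q gets x_2, x_4, .... If s1 and s2 are the sums of the roots
    of P and Q, then s1 - s2 = b h_0 and s2 = h_1 + ... + h_{2n-1}, so the Gaussian weight exp(-sum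
    h_p) is exp(-s2 - (s1 - s2)/b), the exponential part of the density.

    The rest of the density is a Jacobian. The map from the k to the coefficients of (P, Q) is
    triangular and turns the powers of the h_p into the resultant of P and Q ([LS_recurrence],
    [Rw_res], [Rw_neq0]). The map from ordered roots to coefficients has the Vandermonde product as
    its Jacobian ([LS_eig]). Two Vandermonde products and the resultant combine into the Vandermonde
    product of all x_j ([vdm_alt], [LS_interlaced]).

    Each change of variables is an iteration of one-variable substitutions joined by Tonelli.
    Multiplicative constants are kept unevaluated in the extended reals; total mass 1 shows at the
    end that they are finite and positive. *)

(** * One-variable substitution for Lebesgue measure *)

Section transfer.
Local Open Scope ereal_scope.
Context d1 d2 (X : measurableType d1) (Y : measurableType d2) (R : realType).
Variables (mu : {measure set X -> \bar R}) (nu : {measure set Y -> \bar R}).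
Variables (psi : X -> Y) (w : X -> R).
Hypotheses (mpsi : measurable_fun setT psi) (mw : measurable_fun setT w).
Hypothesis w0 : forall x, (0 <= w x)%R.
Hypothesis nuE : forall A, measurable A ->
  nu A = \int[mu]_x (w x * \1_A (psi x))%:E.

Import HBNNSimple.

(** The hypothesis on [nu] is the case of indicators; simple functions follow by linearity and the
    general case by monotone convergence. *)
Lemma ge0_integral_transfer (f : Y -> \bar R) :
  measurable_fun setT f -> (forall y, 0 <= f y) ->
  \int[nu]_y f y = \int[mu]_x ((w x)%:E * f (psi x)).
Proof.
move=> mf f0; pose f_ := nnsfun_approx measurableT mf.
have cf y : (EFin \o f_ ^~ y) n @[n --> \oo] --> f y by exact: cvg_nnsfun_approx.
transitivity (limn (fun n => \int[nu]_x (f_ n x)%:E)).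
  rewrite -monotone_convergence//.
  - by apply: eq_integral => y _; apply/esym/cvg_lim => //; exact: cf.
  - by move=> n; exact/measurable_EFinP/measurable_funP.
  - by move=> n y _; rewrite lee_fin.
  - by move=> y _ m n mn; rewrite lee_fin; exact/lefP/nd_nnsfun_approx.
transitivity (limn (fun n => \int[mu]_x ((w x)%:E * (f_ n (psi x))%:E))).
  congr (limn _); apply/funext => n.
  have msub r : measurable (f_ n @^-1` [set r]) by [].
  have mi r : measurable_fun setT (fun x => \1_(f_ n @^-1` [set r]) (psi x) : R).
    by apply: (@measurableT_comp _ _ _ _ _ _ (\1_(f_ n @^-1` [set r]) : Y -> R)).
  under eq_integral do rewrite fimfunE -fsumEFin//.
  rewrite ge0_integral_fsum//; last 2 first.
  - by move=> y; exact/measurable_EFinP/measurable_funM.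
  - by move=> y x _; rewrite nnfun_muleindic_ge0.
  under [in RHS]eq_integral => x _.
    rewrite fimfunE -EFinM mulr_fsumr -fsumEFin//.
    over.
  rewrite /= ge0_integral_fsum//.
  - apply: eq_fsbigr => r _.
    rewrite integralZl_indic_nnsfun// integral_indic// setIT nuE//.
    have [r0|r0] := leP 0%R r; last first.
      rewrite preimage_nnfun0// !integral0_eq ?mule0// => x _.
      + by rewrite indic0 !mulr0.
      + by rewrite indic0 mulr0.
    rewrite -ge0_integralZl//.
    + by apply: eq_integral => x _; rewrite -EFinM mulrCA.
    + by apply/measurable_EFinP/measurable_funM.
    + by move=> x _; rewrite lee_fin mulr_ge0// indicE.
  - move=> r; apply/measurable_EFinP; apply: measurable_funM => //.
    by apply: measurable_funM.
  - by move=> r x _; rewrite EFinM mule_ge0// ?lee_fin// -lee_fin EFinM nnfun_muleindic_ge0.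
rewrite -monotone_convergence//.
- apply: eq_integral => x _; apply/cvg_lim => //.
  by apply: cvgeZl => //; exact: cf.
- move=> n; apply/measurable_EFinP; apply: measurable_funM => //.
  by apply: measurableT_comp => //; exact: measurable_funP.
- by move=> n x _; rewrite -EFinM lee_fin mulr_ge0.
- move=> x _ m n mn; rewrite -!EFinM lee_fin ler_wpM2l//.
  by apply/lefP; apply: nd_nnsfun_approx.
Qed.

End transfer.

Section lebesgue_subst.
Local Open Scope ereal_scope.
Context (R : realType).
Notation mu := (@lebesgue_measure R).

(* A weighted push-forward of Lebesgue measure that gives every interval its
   length is Lebesgue measure. *)
Lemma lebesgue_transfer (psi w : R -> R) :
  measurable_fun setT psi -> measurable_fun setT w ->
  (forall x, (0 <= w x)%R) ->
  (forall a b : R, (a < b)%R ->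
     \int[mu]_x (w x * \1_(`]a, b]) (psi x))%:E = (b - a)%:E) ->
  forall f : R -> \bar R, measurable_fun setT f -> (forall y, 0 <= f y) ->
  \int[mu]_x ((w x)%:E * f (psi x)) = \int[mu]_y f y.
Proof.
move=> mpsi mw w0 wab f mf f0; apply/esym.
apply: (@ge0_integral_transfer _ _ (measurableTypeR R) (measurableTypeR R) R mu mu psi w) => //.
pose nu (A : set (measurableTypeR R)) : \bar R :=
  \int[mu]_x (w x * \1_A (psi x))%:E.
have mi (A : set R) : measurable A ->
    measurable_fun setT (fun x => (w x * \1_A (psi x))%:E).
  move=> mA; apply/measurable_EFinP/measurable_funM => //.
  by apply: (@measurableT_comp _ _ _ _ _ _ (\1_A : R -> R)).
have i0 (A : set R) x : 0 <= (w x * \1_A (psi x))%:E.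
  by rewrite lee_fin mulr_ge0// indicE.
have nu0 : nu set0 = 0.
  by apply: integral0_eq => x _; rewrite indic0 mulr0.
have nu_ge0 A : 0 <= nu A by apply: integral_ge0 => x _; exact: i0.
have nu_sigma : semi_sigma_additive nu.
  move=> F mF tF mUF.
  have -> : nu (\bigcup_n F n) = \sum_(0 <= n <oo) nu (F n).
    rewrite /nu -integral_nneseries//; last by move=> n; exact: (mi _ (mF n)).
    apply: eq_integral => x _.
    under eq_eseriesr do rewrite EFinM.
    rewrite nneseriesZl; last by move=> n _; rewrite lee_fin indicE.
    by rewrite EFinM indic_bigcup.
  by apply: is_cvg_ereal_nneg_natsum_cond.
pose mnu : {measure set (measurableTypeR R) -> \bar R} :=
  HB.pack nu (isMeasure.Build _ _ _ nu nu0 nu_ge0 nu_sigma).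
move=> A mA.
apply: (@lebesgue_measure_unique R mnu) => //.
move=> X [[a b] _ <-] /=.
rewrite lebesgue_measure_itv/= lte_fin; case: ltP => ab.
  by rewrite [RHS]wab.
by apply/esym; rewrite set_itv_ge -?leNgt ?bnd_simp//= ?nu0//; rewrite /= -leNgt.
Qed.
End lebesgue_subst.

Section lebesgue_subst2.
Local Open Scope ereal_scope.
Context (R : realType).
Notation mu := (@lebesgue_measure R).
Implicit Types f : R -> \bar R.

(** A strictly increasing surjection pulls []psi x, psi y]] back to []x, y]], so the interval test
    of [lebesgue_transfer] becomes the integral hypothesis on [w]; [psi] may have kinks. *)
Lemma lebesgue_increasing (psi w : R -> R) :
  {homo psi : x y / (x < y)%R} -> (forall u, exists x, psi x = u) ->
  measurable_fun setT w -> (forall x, (0 <= w x)%R) ->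
  (forall a b : R, (a < b)%R ->
     \int[mu]_(x in `]a, b]) (w x)%:E = (psi b - psi a)%:E) ->
  forall f, measurable_fun setT f -> (forall y, 0 <= f y) ->
  \int[mu]_x ((w x)%:E * f (psi x)) = \int[mu]_y f y.
Proof.
move=> psiI psiS mw w0 wab; apply: lebesgue_transfer => //.
  apply: (@nondecreasing_measurable R setT psi (@measurableT _ _)) => x y.
  by rewrite le_eqVlt => /predU1P[->//|/psiI /ltW].
move=> a b ab; have [x xa] := psiS a; have [y yb] := psiS b.
have mono : {mono psi : x y / (x < y)%R} by apply: leW_mono; exact: le_mono.
have mono' : {mono psi : x y / (x <= y)%R} by exact: le_mono.
have xy : (x < y)%R by rewrite -mono xa yb.
rewrite -xa -yb -wab// [RHS]integral_mkcond.
apply: eq_integral => z _; rewrite /patch indicE.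
have -> : (psi z \in `]psi x, psi y]%classic) = (z \in `]x, y]%classic).
  by rewrite !mem_setE !in_itv/= mono mono'.
by case: ifP => _; rewrite ?mulr1 ?mulr0.
Qed.

(** For a negative slope the preimage of []u, v]] is closed on the left instead, which does not
    affect its length. *)
Lemma lebesgue_affine (a b : R) f : (a != 0)%R ->
  measurable_fun setT f -> (forall y, 0 <= f y) ->
  \int[mu]_x f (a * x + b)%R = `|a^-1|%:E * \int[mu]_y f y.
Proof.
move=> a0 mf f0.
have maff : measurable_fun setT (fun x : R => (a * x + b)%R).
  by apply: measurable_funD => //; apply: measurable_funM.
have step g : measurable_fun setT g -> (forall y, 0 <= g y) ->
    \int[mu]_x (`|a|%:E * g (a * x + b)%R) = \int[mu]_y g y.
  move=> mg g0.
  apply: (@lebesgue_transfer R (fun x => a * x + b)%R (fun=> `|a|)%R) => //.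
  move=> u v uv.
  under eq_integral do rewrite EFinM.
  rewrite ge0_integralZl//; last first.
    apply/measurable_EFinP.
    by apply: (@measurableT_comp _ _ _ _ _ _ (\1_(`]u, v]) : R -> R)).
  have [ag0|al0|ae0] := ltgtP a 0%R; last by rewrite ae0 eqxx in a0.
  - rewrite (_ : (fun x => _) = (fun x => (\1_(`[((v - b) / a)%R, ((u - b) / a)%R[) x)%:E)); last first.
      apply/funext => x; rewrite !indicE !mem_setE !in_itv/=.
      by rewrite ler_ndivrMr// ltr_ndivlMr// [(x * a)%R]mulrC lerBrDr ltrBlDr andbC.
    rewrite integral_indic// setIT /= lebesgue_measure_itv/= lte_fin.
    rewrite ltr_nM2r ?invr_lt0// ltrD2r uv -EFinB -EFinM ltr0_norm//.
    by congr (_%:E); field.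
  - rewrite (_ : (fun x => _) = (fun x => (\1_(`]((u - b) / a)%R, ((v - b) / a)%R]) x)%:E)); last first.
      apply/funext => x; rewrite !indicE !mem_setE !in_itv/=.
      by rewrite ler_pdivlMr// ltr_pdivrMr// [(x * a)%R]mulrC lerBrDr ltrBlDr.
    rewrite integral_indic// setIT /= lebesgue_measure_itv/= lte_fin.
    rewrite ltr_pM2r ?invr_gt0// ltrD2r uv -EFinB -EFinM gtr0_norm//.
    by congr (_%:E); field.
rewrite -[in RHS]step// ge0_integralZl//; last exact: measurableT_comp.
rewrite muleA -EFinM normfV mulVf ?mul1e// normr_eq0//.
Qed.

Lemma lebesgue_shift (b : R) f :
  measurable_fun setT f -> (forall y, 0 <= f y) ->
  \int[mu]_x f (x + b)%R = \int[mu]_y f y.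
Proof.
move=> mf f0; have := @lebesgue_affine 1%R b f (oner_neq0 _) mf f0.
rewrite invr1 normr1 mul1e => <-.
by apply: eq_integral => x _; rewrite mul1r.
Qed.

(** To the left of [rho] the polynomial is replaced by a line of slope 1. This gives an increasing
    bijection of the real line to which [lebesgue_increasing] applies, and the two indicators remove
    the added half-line again. *)
Lemma lebesgue_poly_subst (p : {poly R}) (rho : R) f :
  (forall x, rho <= x -> 0 <= p^`().[x])%R ->
  (forall x y, rho <= x -> x < y -> p.[x] < p.[y])%R ->
  (forall u, (p.[rho] <= u)%R -> exists2 x, (rho <= x)%R & p.[x] = u) ->
  measurable_fun setT f -> (forall y, 0 <= f y) ->
  \int[mu]_x (((rho <= x)%R%:R * p^`().[x])%:E * f p.[x]) =
  \int[mu]_u ((p.[rho] <= u)%R%:R%:E * f u).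
Proof.
move=> p'0 pI pS mf f0.
pose psi x := (if rho <= x then p.[x] else x - rho + p.[rho])%R.
pose w x := (if rho <= x then p^`().[x] else 1)%R.
have mlt (c : R) : measurable_fun setT (fun x : R => (c <= x)%R).
  by apply: measurable_fun_ler.
have mp (q : {poly R}) : measurable_fun setT (horner q).
  by apply: continuous_measurable_fun; exact: continuous_horner.
have mw : measurable_fun setT w.
  by apply: measurable_fun_ifT => //; exact: mp.
have w0 x : (0 <= w x)%R by rewrite /w; case: ifP => // /p'0.
have psiI : {homo psi : x y / (x < y)%R}.
  move=> x y xy; rewrite /psi; case: ifPn => rx; case: ifPn => ry.
  - exact: pI.
  - by move: ry; rewrite (le_trans rx (ltW xy)).
  - move: rx; rewrite -ltNge => rx.
    have : (p.[rho] <= p.[y])%R.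
      by move: ry; rewrite le_eqVlt => /predU1P[->//|ry]; exact/ltW/pI.
    lra.
  - lra.
have psiS u : exists x, psi x = u.
  have [/pS[x rx <-]|up] := leP p.[rho] u; first by exists x; rewrite /psi rx.
  exists (u + rho - p.[rho])%R; rewrite /psi ifF; first by ring.
  by apply/negbTE; rewrite -ltNge; lra.
have mwE (D : set R) : measurable_fun D (fun x => (w x)%:E).
  by apply/measurable_EFinP/measurable_funTS.
have hi a b : (rho <= a)%R -> (a < b)%R ->
    \int[mu]_(x in `]a, b]) (w x)%:E = (psi b - psi a)%:E.
  move=> ra ab; rewrite /psi ra (le_trans ra (ltW ab)).
  transitivity (\int[mu]_(x in `]a, b]) (p^`().[x])%:E).
    apply: eq_integral => x; rewrite mem_setE in_itv/= => /andP[ax _].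
    by rewrite /w (le_trans ra (ltW ax)).
  rewrite integral_itv_obnd_cbnd; last first.
    by apply/measurable_EFinP/measurable_funTS; exact: mp.
  rewrite (@continuous_FTC2 _ _ (horner p)) ?EFinB//.
  - by apply: continuous_subspaceT; exact: continuous_horner.
  - split => [x _||]; first exact: derivable_horner.
    + by apply: cvg_at_right_filter; exact: continuous_horner.
    + by apply: cvg_at_left_filter; exact: continuous_horner.
  - by move=> x _; rewrite derivE.
have lo a b : (b <= rho)%R -> (a < b)%R ->
    \int[mu]_(x in `]a, b]) (w x)%:E = (psi b - psi a)%:E.
  move=> br ab.
  have -> : psi b = (b - rho + p.[rho])%R.
    rewrite /psi; case: ifPn => // rb; have -> : b = rho by apply/le_anti/andP.
    by rewrite subrr add0r.
  rewrite /psi ifF; last by apply/negbTE; rewrite -ltNge (lt_le_trans ab).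
  rewrite -(@integral_itv_bndo_bndc _ (BRight a)); last exact: mwE.
  rewrite (eq_integral (cst 1)); last first.
    move=> x; rewrite mem_setE in_itv/= => /andP[_ xb].
    by rewrite /w ifF//; apply/negbTE; rewrite -ltNge (lt_le_trans xb).
  rewrite integral_cst// mul1e /= lebesgue_measure_itv/= lte_fin ab -EFinB.
  by congr (_%:E); ring.
transitivity (\int[mu]_x ((w x)%:E *
    ((fun u => (p.[rho] <= u)%R%:R%:E * f u) (psi x)))).
  apply: eq_integral => x _ /=; rewrite /psi /w.
  case: ifPn => rx; last first.
    by rewrite mul0r mul0e leNgt (_ : (_ < _)%R) ?mul0e ?mule0//; move: rx; rewrite -ltNge; lra.
  rewrite mul1r (_ : (_ <= _)%R) ?mul1e//.
  by move: rx; rewrite le_eqVlt => /predU1P[->//|rx]; exact/ltW/pI.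
apply: lebesgue_increasing => //.
- move=> a b ab; have [ra|ar] := leP rho a; first exact: hi.
  have [br|rb] := leP b rho; first exact: lo.
  rewrite (@itv_bndbnd_setU _ _ _ (BRight rho)) ?bnd_simp ?ltW//.
  rewrite ge0_integral_setU//=.
  + by rewrite lo// hi// -EFinD; congr (_%:E); ring.
  + exact: mwE.
  + by move=> x _; rewrite lee_fin.
  + apply/disj_setPS => x [] /=; rewrite !in_itv/= => /andP[_ xr] /andP[rx _].
    by move: rx; rewrite ltNge xr.
- apply: emeasurable_funM => //; apply/measurable_EFinP.
  by apply: (@measurableT_comp _ _ _ _ _ _ (fun b : bool => b%:R : R)).
- by move=> y; rewrite mule_ge0// lee_fin.
Qed.

End lebesgue_subst2.

(** * Iterated integrals over named coordinates and over lists *)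

Section iterated_integral.
Local Open Scope ereal_scope.
Context (R : realType) (I : eqType).
Variable mu : {sigma_finite_measure set (measurableTypeR R) -> \bar R}.
Implicit Types (v : I -> R) (s : seq I) (f g : (I -> R) -> \bar R).

Definition upd v i (x : R) : I -> R := fun j => if j == i then x else v j.

Fixpoint Int s f v : \bar R :=
  if s is i :: s' then \int[mu]_x Int s' f (upd v i x) else f v.

(* Measurability of a function of a (possibly infinite) family of coordinates,
   tested on all measurable families: it is stable under composition for free. *)
Definition mfun d' (U : measurableType d') (f : (I -> R) -> U) : Prop :=
  forall d (T : measurableType d) (phi : I -> T -> R),
    (forall i, measurable_fun setT (phi i)) ->
    measurable_fun setT (fun t => f (fun i => phi i t)).

Lemma upd_eq v i x : upd v i x i = x.
Proof. by rewrite /upd eqxx. Qed.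

Lemma upd_neq v i x j : j != i -> upd v i x j = v j.
Proof. by rewrite /upd => /negbTE ->. Qed.

Lemma updC v i j x y : i != j -> upd (upd v i x) j y = upd (upd v j y) i x.
Proof.
move=> ij; apply/funext => k; rewrite /upd.
by have [->|//] := eqVneq k j; rewrite eq_sym (negbTE ij).
Qed.

Lemma Int_ge0 s f v : (forall v, 0 <= f v) -> 0 <= Int s f v.
Proof.
move=> f0; elim: s v => [//|i s IH] v /=.
by apply: integral_ge0 => x _; exact: IH.
Qed.

Lemma Int_cat s t f v : Int (s ++ t) f v = Int s (Int t f) v.
Proof.
by elim: s v => [//|i s IH] v /=; apply: eq_integral => x _; rewrite IH.
Qed.

Lemma eq_Int s f g v :
  (forall v', (forall i, i \notin s -> v' i = v i) -> f v' = g v') ->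
  Int s f v = Int s g v.
Proof.
elim: s v => [|i s IH] v fg /=; first exact: fg.
apply: eq_integral => x _; apply: IH => v' v'E; apply: fg => j.
by rewrite inE negb_or => /andP[ji js]; rewrite v'E// upd_neq.
Qed.

Lemma mfun_upd_meas d (T : measurableType d) (phi : I -> T -> R) i :
  (forall j, measurable_fun setT (phi j)) ->
  forall j, measurable_fun setT (fun z : T * measurableTypeR R =>
     upd (fun k => phi k z.1) i z.2 j).
Proof.
move=> mphi j; rewrite /upd; case: (j == i); first exact: measurable_snd.
exact: (measurableT_comp (mphi j) measurable_fst).
Qed.

Lemma mfun_Int s f : mfun f -> (forall v, 0 <= f v) -> mfun (Int s f).
Proof.
move=> mf f0; elim: s => [//|i s IH] d T phi mphi /=.
apply: (@measurable_fun_fubini_tonelli_F _ _ T (measurableTypeR R) R mu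
  (fun z => Int s f (upd (fun k => phi k z.1) i z.2))).
- by apply: IH; exact: mfun_upd_meas.
- by move=> z; exact: Int_ge0.
Qed.

Lemma mfun_upd2 f v i j : mfun f -> measurable_fun setT
  (fun z : measurableTypeR R * measurableTypeR R => f (upd (upd v i z.1) j z.2)).
Proof.
move=> mf; apply: mf => k; rewrite /upd.
case: (k == j); first exact: measurable_snd.
by case: (k == i); [exact: measurable_fst|exact: measurable_cst].
Qed.

Lemma mfun_upd1 f v i : mfun f ->
  measurable_fun setT (fun x : measurableTypeR R => f (upd v i x)).
Proof.
move=> mf; apply: mf => k; rewrite /upd.
by case: (k == i); [exact: measurable_id|exact: measurable_cst].
Qed.

Lemma Int_swap i j s f v : i != j -> mfun f -> (forall v, 0 <= f v) ->
  Int [:: i, j & s] f v = Int [:: j, i & s] f v.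
Proof.
move=> ij mf f0 /=.
rewrite (@fubini_tonelli _ _ _ _ R mu mu
  (fun z => Int s f (upd (upd v i z.1) j z.2))).
- apply: eq_integral => y _; apply: eq_integral => x _.
  by rewrite /= updC.
- by apply: mfun_upd2; exact: mfun_Int.
- by move=> z; exact: Int_ge0.
Qed.

(** Adjacent names are exchanged by Tonelli ([Int_swap]), which moves the head of [s] through the
    part of [t] that precedes it. *)
Lemma Int_perm s t f v : uniq s -> perm_eq s t -> mfun f ->
  (forall v, 0 <= f v) -> Int s f v = Int t f v.
Proof.
move=> us st mf f0; elim: s t us st v => [|i s IH] t us st v.
  by move: st; rewrite perm_sym => /perm_nilP ->.
have it : i \in t by rewrite -(perm_mem st) mem_head.
move: us => /andP[nis us].
have ut : uniq t by rewrite -(perm_uniq st)/= nis.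
case/splitPr: it st ut => t1 t2 st ut.
have -> : Int (t1 ++ i :: t2) f v = Int (i :: t1 ++ t2) f v.
  move: ut; clear st; elim: t1 v => [//|k t1 IHt] v.
  rewrite cat_cons cons_uniq mem_cat inE => /andP[].
  rewrite !negb_or => /and3P[_ ki _] ut.
  transitivity (Int [:: k, i & t1 ++ t2] f v).
    by apply: eq_integral => x _; exact: IHt.
  exact: Int_swap.
have sp : perm_eq s (t1 ++ t2).
  rewrite -(perm_cons i) (perm_trans st)//.
  by rewrite perm_sym -cat1s perm_catCA.
by apply: eq_integral => x _; exact: IH.
Qed.

Lemma Int_Zl s f v (c : \bar R) : 0 <= c -> mfun f -> (forall v, 0 <= f v) ->
  Int s (fun v => c * f v) v = c * Int s f v.
Proof.
move=> c0 mf f0; elim: s v => [//|i s IH] v /=.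
rewrite -ge0_integralZl//.
- by apply: eq_integral => x _; rewrite IH.
- by apply: mfun_upd1; exact: mfun_Int.
- by move=> x _; exact: Int_ge0.
Qed.

End iterated_integral.

Section seq_integral.
Local Open Scope ereal_scope.
Context (R : realType).
Variable mu : {sigma_finite_measure set (measurableTypeR R) -> \bar R}.

(** The positional counterpart of [Int], for arguments that are lists of roots or coefficients and
    whose length varies along an induction. *)
Fixpoint LS n (f : seq R -> \bar R) : \bar R :=
  if n is n'.+1 then \int[mu]_x LS n' (fun t => f (x :: t)) else f [::].

Definition mseq n d (T : measurableType d) (phi : T -> seq R) : Prop :=
  (forall t, size (phi t) = n) /\
  forall i, measurable_fun setT (fun t => nth 0%R (phi t) i).

(** As for [mfun], measurability is tested along all measurable families; the parameter can be
    pulled back along [pi], so that an integration variable can be moved into it. *)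
Definition mfam n d (T : measurableType d) (F : T -> seq R -> \bar R) : Prop :=
  forall d' (T' : measurableType d') (pi : T' -> T) (phi : T' -> seq R),
    measurable_fun setT pi -> mseq n phi ->
    measurable_fun setT (fun t => F (pi t) (phi t)).

Definition mfun1 n (f : seq R -> \bar R) : Prop :=
  forall d (T : measurableType d) (phi : T -> seq R), mseq n phi ->
    measurable_fun setT (fun t => f (phi t)).

Definition mfun2 m n (f : seq R -> seq R -> \bar R) : Prop :=
  forall d (T : measurableType d) (phi psi : T -> seq R),
    mseq m phi -> mseq n psi -> measurable_fun setT (fun t => f (phi t) (psi t)).

Lemma mseq_comp n d d' (T : measurableType d) (T' : measurableType d')
    (pi : T' -> T) (phi : T -> seq R) :
  measurable_fun setT pi -> mseq n phi -> mseq n (fun t => phi (pi t)).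
Proof.
move=> mpi [sphi mphi]; split=> [t|i]; first exact: sphi.
exact: (measurableT_comp (mphi i) mpi).
Qed.

Lemma mseq_cons n d (T : measurableType d) (x : T -> R) (phi : T -> seq R) :
  measurable_fun setT x -> mseq n phi -> mseq n.+1 (fun t => x t :: phi t).
Proof.
move=> mx [sphi mphi]; split=> [t /=|[|i] /=]; first by rewrite sphi.
- exact: mx.
- exact: mphi.
Qed.

Lemma mseq_nil d (T : measurableType d) : mseq 0 (fun _ : T => [::]).
Proof. by split=> // i; exact: measurable_cst. Qed.

Lemma mseq_cst d (T : measurableType d) (s : seq R) :
  mseq (size s) (fun _ : T => s).
Proof. by split=> // i; exact: measurable_cst. Qed.

Lemma mfun1_cons n f d (T : measurableType d) (x : T -> R) :
  mfun1 n.+1 f -> measurable_fun setT x -> mfam n (fun t s => f (x t :: s)).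
Proof.
move=> mf mx d' T' pi phi mpi mphi; apply: mf.
by apply: mseq_cons => //; exact: measurableT_comp mpi.
Qed.

Lemma mfun1_cst_cons n f x : mfun1 n.+1 f -> mfun1 n (fun s => f (x :: s)).
Proof.
by move=> mf d T phi mphi; apply: mf; apply: mseq_cons => //; exact: measurable_cst.
Qed.

Lemma LS_ge0 n f : (forall s, size s = n -> 0 <= f s) -> 0 <= LS n f.
Proof.
elim: n f => [|n IH] f f0 /=; first exact: f0.
by apply: integral_ge0 => x _; apply: IH => s sn; apply: f0; rewrite /= sn.
Qed.

Lemma eq_LS n f g : (forall s, size s = n -> f s = g s) -> LS n f = LS n g.
Proof.
elim: n f g => [|n IH] f g fg /=; first exact: fg.
by apply: eq_integral => x _; apply: IH => s sn; apply: fg; rewrite /= sn.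
Qed.

Lemma measurable_LS n d (T : measurableType d) (F : T -> seq R -> \bar R) :
  mfam n F -> (forall t s, 0 <= F t s) ->
  measurable_fun setT (fun t => LS n (F t)).
Proof.
elim: n d T F => [|n IH] d T F mF F0 /=.
  by apply: mF (mseq_nil _); exact: measurable_id.
apply: (@measurable_fun_fubini_tonelli_F _ _ T (measurableTypeR R) R mu
  (fun z => LS n (fun t => F z.1 (z.2 :: t)))).
- apply: IH => [d' T' pi phi mpi mphi|//].
  apply: mF; first exact: (measurableT_comp measurable_fst mpi).
  by apply: mseq_cons => //; exact: (measurableT_comp measurable_snd mpi).
- by move=> z; apply: LS_ge0.
Qed.

Lemma measurable_LS_cons n f : mfun1 n.+1 f -> (forall s, 0 <= f s) ->
  measurable_fun setT (fun x => LS n (fun s => f (x :: s))).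
Proof.
move=> mf f0; apply: measurable_LS => // d' T' pi phi mpi mphi.
by apply: mf; exact: mseq_cons.
Qed.

Lemma LS_Zl n f (c : \bar R) : 0 <= c -> mfun1 n f -> (forall s, 0 <= f s) ->
  LS n (fun s => c * f s) = c * LS n f.
Proof.
move=> c0; elim: n f => [//|n IH] f mf f0 /=.
rewrite -ge0_integralZl//.
- by apply: eq_integral => x _; rewrite IH//; exact: mfun1_cst_cons.
- exact: measurable_LS_cons.
- by move=> x _; exact: LS_ge0.
Qed.

Lemma LS_swap1 n (F : R -> seq R -> \bar R) :
  mfam n (F : measurableTypeR R -> _) -> (forall x s, 0 <= F x s) ->
  \int[mu]_x LS n (F x) = LS n (fun s => \int[mu]_x F x s).
Proof.
elim: n F => [//|n IH] F mF F0 /=.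
rewrite (@fubini_tonelli _ _ _ _ R mu mu
  (fun z => LS n (fun t => F z.1 (z.2 :: t)))).
- apply: eq_integral => y _ /=; rewrite IH// => d' T' pi phi mpi mphi.
  by apply: mF => //; apply: mseq_cons => //; exact: measurable_cst.
- apply: measurable_LS => // d' T' pi phi mpi mphi.
  apply: mF; first exact: (measurableT_comp measurable_fst mpi).
  by apply: mseq_cons => //; exact: (measurableT_comp measurable_snd mpi).
- by move=> z; exact: LS_ge0.
Qed.

Lemma LS_swap m n (f : seq R -> seq R -> \bar R) :
  mfun2 m n f -> (forall s t, 0 <= f s t) ->
  LS m (fun s => LS n (f s)) = LS n (fun t => LS m (f^~ t)).
Proof.
elim: m f => [//|m IH] f mf f0 /=.
under eq_integral => x _.
  rewrite IH//; last first.
    move=> d T phi psi mphi mpsi; apply: mf => //.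
    by apply: mseq_cons => //; exact: measurable_cst.
  over.
rewrite /= LS_swap1//; last by move=> x s; exact: LS_ge0.
move=> d T pi phi mpi mphi; apply: measurable_LS => // d' T' rho psi mrho mpsi.
apply: mf; last exact: mseq_comp mphi.
by apply: mseq_cons => //; exact: (measurableT_comp mpi mrho).
Qed.

Lemma LS_cat m n f : LS (m + n) f = LS m (fun s => LS n (fun t => f (s ++ t))).
Proof.
by elim: m f => [//|m IH] f /=; apply: eq_integral => x _; rewrite IH.
Qed.

Lemma iter_intE n (f : n.-tuple (measurableTypeR R) -> \bar R) g :
  (forall t, f t = g (tval t)) -> iter_int mu n f = LS n g.
Proof.
elim: n f g => [|n IH] f g fg /=; first by rewrite fg.
by apply: eq_integral => x _; apply: IH => t; rewrite fg.
Qed.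

End seq_integral.

(** * The largest root of a real-rooted polynomial *)

Section top_root.
Context (R : realType).
Implicit Types (p q : {poly R}) (s t x y r : R).

(* All the Taylor coefficients of p at t are nonnegative. For a real-rooted
   monic p this says that t is at least the largest root. *)
Definition nnT p t : Prop := p \Po ('X + t%:P) \is a polyOver Num.nneg.

Lemma coef_taylor p t i : (p \Po ('X + t%:P))`_i = (p^`N(i)).[t].
Proof.
elim/poly_ind: p i => [|p c IH] i; first by rewrite comp_poly0 coef0 linear0 horner0.
rewrite comp_polyD comp_polyM comp_polyX comp_polyC mulrDr.
case: i => [|i].
  by rewrite nderivn0 !coefD coefMX coefMC coefC /= IH nderivn0 !hornerE; ring.
by rewrite nderivnMXaddC !coefD coefMX coefMC coefC /= !IH !hornerE; ring.
Qed.

Lemma nnTP p t : nnT p t <-> forall i, 0 <= (p^`N(i)).[t].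
Proof.
split=> [/polyOverP h i|h]; first by have := h i; rewrite coef_taylor nnegrE.
by apply/polyOverP => i; rewrite coef_taylor nnegrE.
Qed.

Lemma comp_taylor p t x : (p \Po ('X + t%:P)).[x] = p.[x + t].
Proof. by rewrite horner_comp !hornerE. Qed.

Lemma polyOver_nneg_XaddC c : 0 <= c -> ('X + c%:P : {poly R}) \is a polyOver Num.nneg.
Proof.
move=> c0; apply/polyOverP => i; rewrite nnegrE coefD coefX coefC.
by rewrite addr_ge0// ?ler0n//; case: ifP.
Qed.

Lemma nnT_le p t s : nnT p t -> t <= s -> nnT p s.
Proof.
move=> h ts; rewrite /nnT.
have -> : 'X + s%:P = ('X + t%:P) \Po ('X + (s - t)%:P).
  by rewrite comp_polyD comp_polyX comp_polyC -addrA -polyCD subrK.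
by rewrite comp_polyA polyOver_comp// polyOver_nneg_XaddC// subr_ge0.
Qed.

Lemma nnTM p q t : nnT p t -> nnT q t -> nnT (p * q) t.
Proof. move=> hp hq; rewrite /nnT comp_polyM. exact: polyOver_mulr_2closed. Qed.

Lemma nnT_XsubC y t : nnT ('X - y%:P) t <-> y <= t.
Proof.
rewrite /nnT comp_polyB comp_polyX comp_polyC -addrA -polyCB.
split=> [/polyOverP/(_ 0)|yt].
  by rewrite coefD coefX coefC/= add0r nnegrE subr_ge0.
by rewrite polyOver_nneg_XaddC// subr_ge0.
Qed.

Lemma nnT_deriv p t : nnT p t -> nnT p^`() t.
Proof.
rewrite /nnT => h; have := polyOver_deriv h.
by rewrite deriv_comp derivD derivX derivC addr0 mulr1.
Qed.

Lemma nnT_ge0 p t x : nnT p t -> t <= x -> 0 <= p.[x].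
Proof.
by move=> /nnT_le h /h /nnTP/(_ 0); rewrite nderivn0.
Qed.

(** Expanded at x, the polynomial has nonnegative coefficients and leading coefficient 1, so p(y) -
    p(x) is at least the positive term (y - x)^(deg p). *)
Lemma nnT_lt p t x y : p \is monic -> (1 < size p)%N -> nnT p t ->
  t <= x -> x < y -> p.[x] < p.[y].
Proof.
move=> pm sp h tx xy; have {}h := nnT_le h tx.
set q := p \Po ('X + x%:P) in h.
have sq : size q = size p by rewrite size_comp_poly2// size_XaddC.
have pE z : p.[z] = q.[z - x] by rewrite comp_taylor subrK.
have qm : lead_coef q = 1.
  by rewrite /q lead_coef_comp ?size_XaddC// lead_coefXaddC expr1n mulr1; apply/eqP.
rewrite !pE subrr horner_coef0 horner_coef sq.
case: (size p) sp sq => [//|[//|n]] _ sq.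
rewrite big_ord_recl expr0 mulr1 ltrDl big_ord_recr /=.
have -> : q`_(bump 0 n) = 1 by rewrite -qm /lead_coef sq /bump add1n.
rewrite mul1r ltr_wpDl ?exprn_gt0 ?subr_gt0//.
apply: sumr_ge0 => i _; apply: mulr_ge0; last by rewrite exprn_ge0// subr_ge0 ltW.
by have /polyOverP/(_ (bump 0 i)) := h; rewrite nnegrE.
Qed.

Lemma nnT_closed p t : (forall e, 0 < e -> nnT p (t + e)) -> nnT p t.
Proof.
move=> h; apply/nnTP => i; rewrite leNgt; apply/negP => neg.
have /cvgr_lt/(_ _ neg) : (p^`N(i)).[x] @[x --> t] --> (p^`N(i)).[t].
  exact: continuous_horner.
move=> /nbhs_ballP[e /= e0 be].
have := be (t + e / 2); rewrite /ball/= opprD addNKr normrN gtr0_norm; last lra.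
have /h/nnTP/(_ i) : 0 < e / 2 by lra.
by rewrite leNgt => /negP g /(_ _)/g; apply; lra.
Qed.

Lemma nnT_nonempty p : 0 < lead_coef p -> exists t, nnT p t.
Proof.
move=> lp.
suff [t ht] : exists t, forall i, (i < size p)%N -> 0 <= (p^`N(i)).[t].
  exists t; apply/nnTP => i; have [ip|pi] := ltnP i (size p); first exact: ht.
  by rewrite nderivn_poly0// horner0.
suff H k : (k <= size p)%N ->
    exists t, forall s, t <= s -> forall i, (i < k)%N -> 0 <= (p^`N(i)).[s].
  have [t ht] := H _ (leqnn _); exists t => i; exact: ht.
elim: k => [|k IH] kp; first by exists 0.
have [t ht] := IH (ltnW kp).
have lq : 0 < lead_coef (p^`N(k)).
  have -> : lead_coef (p^`N(k)) = lead_coef p *+ 'C((size p).-1, k).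
    have e : (k + (size p - k).-1 = (size p).-1)%N by lia.
    rewrite /nderivn lead_coef_poly ?subn_gt0 ?e// mulrn_eq0 negb_or -lt0n bin_gt0 gt_eqF// andbT.
    lia.
  by rewrite mulrn_wgt0// bin_gt0; lia.
have [n hn] := poly_pinfty_gt_lc lq.
exists (Num.max t n) => s; rewrite ge_max => /andP[ts ns] i.
rewrite ltnS leq_eqVlt => /predU1P[->|ik]; last exact: ht.
by apply: le_trans (hn _ ns); exact: ltW.
Qed.


(** The Taylor coefficient next to the top one is affine in [t] and vanishes at the mean of the
    complex roots, which is the bound. *)
Lemma nnT_lbound p t n : size p = n.+2 -> 0 < lead_coef p -> nnT p t ->
  - (p`_n / (p`_n.+1 *+ n.+1)) <= t.
Proof.
move=> sp lp /nnTP/(_ n).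
have l0 : 0 < p`_n.+1 by move: lp; rewrite /lead_coef sp.
rewrite /nderivn sp (_ : n.+2 - n = 2)%N; last lia.
rewrite poly_def !big_ord_recr big_ord0/= add0r expr0 addn0 binn mulr1n expr1 addn1 binSn.
rewrite !hornerE => h; rewrite lerNl ler_pdivlMr ?mulrn_wgt0//.
rewrite -mulr_natr in h *; nra.
Qed.

(** An infimum instead of a choice among roots: [topr p <= t] then amounts to polynomial
    inequalities in the coefficients of [p], which gives [measurable_topr]. *)
Definition topr p : R := inf [set t | nnT p t].

(** The set defining [topr] is nonempty, bounded below, stable under increase and topologically
    closed, hence a closed half-line. *)
Lemma topr_le p t : 0 < lead_coef p -> (1 < size p)%N ->
  topr p <= t <-> nnT p t.
Proof.
move=> lp; case sp : (size p) => [//|[//|n]] _.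
have lb : has_lbound [set t | nnT p t].
  by exists (- (p`_n / (p`_n.+1 *+ n.+1))) => s /= /(nnT_lbound sp lp).
split=> [h|h]; last exact: ge_inf.
apply: nnT_closed => e e0.
have [t0 ht0] := nnT_nonempty lp.
have [s hs] := @inf_adherent _ [set t | nnT p t] _ e0 (conj (ex_intro _ t0 ht0) lb).
by move=> /ltW se; apply: nnT_le hs _; rewrite (le_trans se)// lerD2r.
Qed.

(** If a root [a] exceeded [t], the polynomial would be nonnegative at [t] and strictly increasing
    after it, hence positive at [a]. *)
Lemma nnT_prod (s : seq R) t :
  nnT (\prod_(a <- s) ('X - a%:P)) t <-> all (<= t) s.
Proof.
split; last first.
  elim: s => [|a s IH] /=; rewrite ?big_nil ?big_cons.
    by move=> _; rewrite /nnT comp_polyC polyOverC nnegrE.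
  by move=> /andP[at_ /IH]; apply: nnTM; exact/nnT_XsubC.
move=> h; apply/allP => a sa /=; rewrite leNgt; apply/negP => ta.
have pm : \prod_(a <- s) ('X - a%:P) \is monic by rewrite monic_prod_XsubC.
have sp : (1 < size (\prod_(a <- s) ('X - a%:P))%R)%N.
  by rewrite size_prod_XsubC ltnS; case: (s) sa.
have := nnT_lt pm sp h (lexx t) ta.
suff -> : (\prod_(a <- s) ('X - a%:P)).[a] = 0.
  by rewrite ltNge (nnT_ge0 h).
by apply/rootP; rewrite root_prod_XsubC.
Qed.

Lemma topr_prod (a : R) (s : seq R) : all (<= a) s ->
  topr (\prod_(b <- a :: s) ('X - b%:P)) = a.
Proof.
move=> sa.
have pm : \prod_(b <- a :: s) ('X - b%:P) \is monic by rewrite monic_prod_XsubC.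
have sp : (1 < size (\prod_(b <- a :: s) ('X - b%:P))%R)%N by rewrite size_prod_XsubC.
have lp : 0 < lead_coef (\prod_(b <- a :: s) ('X - b%:P)) by rewrite (monicP pm).
apply/le_anti/andP; split; first by apply/(topr_le _ lp sp)/nnT_prod; rewrite /= lexx.
have /(topr_le _ lp sp)/nnT_prod := lexx (topr (\prod_(b <- a :: s) ('X - b%:P))).
by case/andP.
Qed.

End top_root.

(** * Coefficients, roots and Horner deflation *)

Section coefficients.
Context (R : realType).
Implicit Types (p : {poly R}) (c y : seq R) (r q : R).

(* Monic polynomials are encoded by their nonleading coefficients, listed from
   the top degree downwards. *)
Definition pol c : {poly R} := Poly (rev (1 :: c)).

Definition cof p : seq R := behead (rev p).

Lemma pol_rcons c a : pol (rcons c a) = pol c * 'X + a%:P.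
Proof. by rewrite /pol -rcons_cons rev_rcons /= cons_poly_def. Qed.

Lemma pol_nil : pol [::] = 1.
Proof. by rewrite /pol /= cons_poly_def mul0r add0r. Qed.

Lemma polyseq_pol c : pol c = rev (1 :: c) :> seq R.
Proof. by rewrite /pol (@PolyK _ 0)// rev_cons last_rcons oner_neq0. Qed.

Lemma size_pol c : size (pol c) = (size c).+1.
Proof. by rewrite polyseq_pol size_rev. Qed.

Lemma pol_monic c : pol c \is monic.
Proof.
by rewrite monicE /lead_coef size_pol polyseq_pol nth_rev//= subnn.
Qed.

Lemma polK : cancel pol cof.
Proof. by move=> c; rewrite /cof polyseq_pol revK. Qed.

Lemma cofK p : p \is monic -> pol (cof p) = p.
Proof.
move=> /monicP lp; rewrite /pol /cof.
have : rev p = 1 :: behead (rev p).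
  have : last 0 p = 1 by rewrite -lp /lead_coef nth_last.
  have : size p != 0%N.
    by rewrite size_poly_eq0 -lead_coef_eq0 lp oner_neq0.
  case: (lastP (p : seq R)) => [//|s x] _.
  by rewrite last_rcons rev_rcons => ->.
by move=> <-; rewrite revK polyseqK.
Qed.

Lemma size_cof p : size (cof p) = (size p).-1.
Proof. by rewrite /cof size_behead size_rev. Qed.

Definition ecoef y : seq R := cof (\prod_(a <- y) ('X - a%:P)).

Lemma size_ecoef y : size (ecoef y) = size y.
Proof. by rewrite size_cof size_prod_XsubC. Qed.

Lemma pol_ecoef y : pol (ecoef y) = \prod_(a <- y) ('X - a%:P).
Proof. by rewrite cofK// monic_prod_XsubC. Qed.

Fixpoint horn r q c : seq R :=
  if c is a :: c' then let b := a + r * q in b :: horn r b c' else [::].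

Lemma size_horn r q c : size (horn r q c) = size c.
Proof. by elim: c q => //= a c IH q; rewrite IH. Qed.

Lemma horn_rcons r q c a :
  horn r q (rcons c a) = rcons (horn r q c) (a + r * last q (horn r q c)).
Proof. by elim: c q => //= b c IH q; rewrite IH. Qed.

(* Horner's scheme is synthetic division by X - r. *)
Lemma pol_horn r c :
  pol c * 'X = ('X - r%:P) * pol (horn r 1 c) + (r * last 1 (horn r 1 c))%:P.
Proof.
elim/last_ind: c => [|c a IH].
  by rewrite /= pol_nil !mulr1 !mul1r subrK.
rewrite pol_rcons horn_rcons pol_rcons last_rcons IH.
by rewrite !polyCM !polyCD !polyCM; ring.
Qed.

Lemma horn_ecoef r c a y : rcons c a = ecoef (r :: y) -> horn r 1 c = ecoef y.
Proof.
move=> e; apply: (can_inj polK).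
have : pol (rcons c a) = ('X - r%:P) * pol (ecoef y).
  by rewrite e !pol_ecoef big_cons.
rewrite pol_rcons (pol_horn r) => E.
have z : r * last 1 (horn r 1 c) + a = 0.
  have /= := congr1 (horner^~ r) E; rewrite 2!hornerD !hornerM !hornerC hornerXsubC.
  by rewrite subrr !mul0r add0r.
move: E; rewrite -addrA -polyCD z polyC0 addr0; apply: mulfI.
by rewrite polyXsubC_eq0.
Qed.

Lemma ecoef_horn r c :
  rcons c (- (r * last 1 (horn r 1 c))) = cof (('X - r%:P) * pol (horn r 1 c)).
Proof.
apply: (can_inj polK); rewrite cofK ?monicMl ?pol_monic ?monicXsubC//.
by rewrite pol_rcons (pol_horn r) polyCN addrK.
Qed.

Lemma last_horn r c : r * last 1 (horn r 1 c) = (pol c * 'X).[r].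
Proof. by rewrite (pol_horn r) hornerD hornerM hornerC hornerXsubC subrr mul0r add0r. Qed.

(** Obtained by differentiating the division identity [pol_horn] at [r]. This value is the
    one-variable Jacobian in [vdm_lebesgue_step]. *)
Lemma horner_horn r c : (pol (horn r 1 c)).[r] = ((pol c * 'X)^`()).[r].
Proof.
rewrite (pol_horn r) derivD derivM derivXsubC derivC addr0 mul1r.
by rewrite hornerD hornerM hornerXsubC subrr mul0r addr0.
Qed.

(** Deflation: the top root is divided out and the search goes on in the quotient. [take n' c] drops
    the constant term, which only enters the remainder. Without real-rootedness the output has no
    meaning, but it stays measurable. *)
Fixpoint eigf n c : seq R :=
  if n is n'.+1 then
    topr (pol c) :: eigf n' (horn (topr (pol c)) 1 (take n' c))
  else [::].

Definition eig c := eigf (size c) c.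

Lemma size_eig c : size (eig c) = size c.
Proof.
by rewrite /eig; move: (size c) => n; elim: n c => [|n IH] c /=; rewrite ?IH.
Qed.

Lemma eig_ecoef y : sorted >=%R y -> eig (ecoef y) = y.
Proof.
rewrite /eig size_ecoef; elim: y => [//|a y IH] /=.
rewrite path_sortedE; last by move=> ? ? ? h1 h2; exact: le_trans h2 h1.
move=> /andP[ay sy]; rewrite pol_ecoef topr_prod//; congr (_ :: _).
have : size (ecoef (a :: y)) = (size y).+1 by rewrite size_ecoef.
move ec : (ecoef (a :: y)) => d; case/lastP: d ec => [//|c e] ec.
rewrite size_rcons => -[sc]; rewrite -cats1 take_size_cat//.
by rewrite (horn_ecoef (esym ec)) IH.
Qed.

Lemma measurable_coef_pol n d (T : measurableType d) (phi : T -> seq R) i :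
  mseq n phi -> measurable_fun setT (fun t => (pol (phi t))`_i).
Proof.
move=> [sphi mphi]; have [ni|ni] := ltnP n i.
  rewrite (_ : (fun _ => _) = cst 0); first exact: measurable_cst.
  by apply/funext => t; rewrite nth_default// size_pol sphi.
rewrite (_ : (fun _ => _) = (fun t => nth 0 (1 :: phi t) (n - i))).
  by case: (n - i)%N => [|k] /=; [exact: measurable_cst|exact: mphi].
by apply/funext => t; rewrite polyseq_pol nth_rev/= sphi ?subSS.
Qed.

Lemma measurable_topr n d (T : measurableType d) (phi : T -> seq R) :
  mseq n.+1 phi -> measurable_fun setT (fun t => topr (pol (phi t))).
Proof.
move=> mphi; have [sphi _] := mphi.
apply: (measurability (@RGenOInfty.G R)); first exact: RGenOInfty.measurableE.
move=> _ [_ [r ->] <-]; rewrite setTI.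
rewrite (_ : _ @^-1` _ =
  ~` \bigcap_(i in setT) [set t | 0 <= ((pol (phi t))^`N(i)).[r]]).
  apply: measurableC; apply: bigcapT_measurable => i.
  have -> : [set t | 0 <= (pol (phi t))^`N(i).[r]] =
      (fun t => 0 <= (pol (phi t))^`N(i).[r]) @^-1` [set true] by [].
  rewrite -[X in measurable X]setTI.
  suff : measurable_fun setT (fun t => 0 <= (pol (phi t))^`N(i).[r]) by exact.
  apply: measurable_fun_ler; first exact: measurable_cst.
  rewrite (_ : (fun _ => _) = (fun t => \sum_(j < n.+2 - i)
      ((pol (phi t))`_(i + j) *+ 'C(i + j, i) * r ^+ j))).
    apply: measurable_sum => j; apply: measurable_funM => //.
    under eq_fun do rewrite -mulr_natr.
    by apply: measurable_funM => //; exact: measurable_coef_pol mphi.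
  by apply/funext => t; rewrite /nderivn size_pol sphi horner_poly.
apply/seteqP; split=> t /=; rewrite in_itv/= andbT ltNge.
- move=> /negP + h; apply; apply/topr_le; rewrite ?(monicP (pol_monic _))//.
    by rewrite size_pol sphi.
  by apply/nnTP => i; exact: h.
- move=> h; apply/negP => /topr_le; rewrite (monicP (pol_monic _)) size_pol sphi.
  by move=> /(_ ltr01 isT)/nnTP hi; apply: h => i _; exact: hi.
Qed.

Lemma mseq_horn n d (T : measurableType d) (r q : T -> R) (phi : T -> seq R) :
  measurable_fun setT r -> measurable_fun setT q -> mseq n phi ->
  mseq n (fun t => horn (r t) (q t) (phi t)).
Proof.
move=> mr; elim: n q phi => [|n IH] q phi mq [sphi mphi].
  rewrite (_ : (fun _ => _) = (fun=> [::])); first exact: mseq_nil.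
  by apply/funext => t; have /size0nil -> := sphi t.
pose b t := nth 0 (phi t) 0 + r t * q t.
have mb : measurable_fun setT b.
  by apply: measurable_funD => //; exact: measurable_funM.
rewrite (_ : (fun _ => _) = (fun t => b t :: horn (r t) (b t) (behead (phi t)))).
  apply: mseq_cons => //; apply: IH => //; split=> [t|i].
    by rewrite size_behead sphi.
  by under eq_fun do rewrite nth_behead; exact: mphi.
by apply/funext => t; rewrite /b; case: (phi t) (sphi t).
Qed.

Lemma mseq_take n m d (T : measurableType d) (phi : T -> seq R) : (m <= n)%N ->
  mseq n phi -> mseq m (fun t => take m (phi t)).
Proof.
move=> mn [sphi mphi]; split=> [t|i]; first by rewrite size_take_min sphi; exact/minn_idPl.
have [im|mi] := ltnP i m.
  by under eq_fun do rewrite nth_take//; exact: mphi.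
rewrite (_ : (fun _ => _) = cst 0); first exact: measurable_cst.
by apply/funext => t; rewrite nth_default// size_take_min sphi geq_min mi.
Qed.

Lemma mseq_eig n d (T : measurableType d) (phi : T -> seq R) :
  mseq n phi -> mseq n (fun t => eig (phi t)).
Proof.
move=> mphi; rewrite (_ : (fun _ => _) = (fun t => eigf n (phi t))); last first.
  by apply/funext => t; rewrite /eig mphi.1.
elim: n phi mphi => [|n IH] phi mphi /=; first exact: mseq_nil.
have mt := measurable_topr mphi.
apply: mseq_cons => //; apply: IH; apply: mseq_horn => //.
by apply: mseq_take mphi.
Qed.

Lemma ecoef_cons (r : R) y : ecoef (r :: y) = cof (('X - r%:P) * pol (ecoef y)).
Proof. by rewrite /ecoef big_cons cofK// monic_prod_XsubC. Qed.

Lemma mseq_mulX n d (T : measurableType d) (r : T -> R) (phi : T -> seq R) :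
  measurable_fun setT r -> mseq n phi ->
  mseq n.+1 (fun t => cof (('X - (r t)%:P) * pol (phi t))).
Proof.
move=> mr [sphi mphi].
have sP t : size (('X - (r t)%:P) * pol (phi t)) = n.+2.
  rewrite size_monicM ?monicXsubC// ?monic_neq0 ?pol_monic//.
  by rewrite size_XsubC size_pol sphi.
split=> [t|i]; first by rewrite size_cof sP.
have [ni|ni] := ltnP n i.
  rewrite (_ : (fun _ => _) = cst 0); first exact: measurable_cst.
  by apply/funext => t; rewrite nth_default// size_cof sP.
rewrite (_ : (fun _ => _) = (fun t =>
    (if (n - i)%N is k.+1 then (pol (phi t))`_k else 0)
    - r t * (pol (phi t))`_(n - i))).
  apply: measurable_funB.
    case: (n - i)%N => [|k]; first exact: measurable_cst.
    exact: (@measurable_coef_pol n).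
  by apply: measurable_funM => //; exact: (@measurable_coef_pol n).
apply/funext => t; rewrite /cof nth_behead nth_rev sP ?ltnS// !subSS.
by rewrite mulrBl coefB coefXM coefCM; case: (n - i)%N.
Qed.

Lemma mseq_ecoef n d (T : measurableType d) (phi : T -> seq R) :
  mseq n phi -> mseq n (fun t => ecoef (phi t)).
Proof.
elim: n phi => [|n IH] phi [sphi mphi].
  rewrite (_ : (fun _ => _) = (fun=> ecoef [::])); last first.
    by apply/funext => t; have /size0nil -> := sphi t.
  by have := @mseq_cst R _ T (ecoef [::]); rewrite size_ecoef.
rewrite (_ : (fun _ => _) = (fun t =>
   cof (('X - (nth 0 (phi t) 0)%:P) * pol (ecoef (behead (phi t)))))).
  apply: mseq_mulX => //; apply: IH; split=> [t|i].
    by rewrite size_behead sphi.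
  by under eq_fun do rewrite nth_behead; exact: mphi.
by apply/funext => t; case: (phi t) (sphi t) => [//|a y] _; rewrite ecoef_cons.
Qed.

End coefficients.

(** * Affine maps and Horner's scheme under iterated Lebesgue measure *)

Section lebesgue_seq.
Local Open Scope ereal_scope.
Context (R : realType).
Notation mu := (@lebesgue_measure R).
Notation LSL := (LS mu).

Definition affs (b : R) (al s : seq R) : seq R :=
  [seq (b * z.2 + z.1)%R | z <- zip al s].

Lemma LS_affine n (b : R) (al : seq R) f : size al = n -> (b != 0)%R ->
  mfun1 n f -> (forall s, 0 <= f s) ->
  LSL n (fun s => f (affs b al s)) = (`|b^-1| ^+ n)%:E * LSL n f.
Proof.
move=> + b0; elim: n al f => [|n IH] [|a al] //= f; first by rewrite mul1e.
move=> [sal] mf f0.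
under eq_integral => x _.
  rewrite (IH al (fun s => f ((b * x + a)%R :: s)))//; last exact: mfun1_cst_cons.
  over.
rewrite /= ge0_integralZl//; last 2 first.
- apply: (measurableT_comp (measurable_LS_cons _ mf f0)).
  by apply: measurable_funD => //; apply: measurable_funM.
- by move=> x _; exact: LS_ge0.
rewrite (@lebesgue_affine _ b a (fun x => LSL n (fun s => f (x :: s))))//.
- by rewrite muleA exprSr EFinM.
- exact: measurable_LS_cons.
- by move=> x; exact: LS_ge0.
Qed.

(** Each output of Horner's scheme is the input coefficient shifted by a function of the earlier
    ones: a triangular map of unit Jacobian. *)
Lemma LS_horn n (r q : R) f : mfun1 n f -> (forall s, 0 <= f s) ->
  LSL n (fun s => f (horn r q s)) = LSL n f.
Proof.
elim: n q f => [//|n IH] q f mf f0 /=.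
under eq_integral => x _.
  rewrite (IH _ (fun s => f ((x + r * q)%R :: s)))//; last exact: mfun1_cst_cons.
  over.
rewrite /= (@lebesgue_shift _ (r * q)%R (fun x => LSL n (fun s => f (x :: s))))//.
- exact: measurable_LS_cons.
- by move=> x; exact: LS_ge0.
Qed.

Lemma LS_rcons n f :
  LSL n.+1 f = LSL n (fun s => \int[mu]_x f (rcons s x)).
Proof.
by rewrite -addn1 LS_cat; apply: eq_LS => s _; apply: eq_integral => x _; rewrite cats1.
Qed.

End lebesgue_seq.

(** * The Vandermonde Jacobian between roots and coefficients *)

Section vandermonde.
Local Open Scope ereal_scope.
Context (R : realType).
Notation mu := (@lebesgue_measure R).
Notation LSL := (LS mu).
Implicit Types (c y : seq R).

Fixpoint vdm y : R :=
  if y is a :: y' then ((\prod_(b <- y') (a - b)) * vdm y')%R else 1%R.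

(** Simple real roots. As [eig] returns numbers for every [c], its output has to be checked against
    [c]. *)
Definition rrooted c : bool := sorted >%R (eig c) && (ecoef (eig c) == c).

Lemma sorted_gt_cons (a : R) y : sorted >%R (a :: y) = all (< a)%R y && sorted >%R y.
Proof.
by rewrite /= path_sortedE// => x z t h1 h2; exact: lt_trans h2 h1.
Qed.

Lemma sorted_gt_ge y : sorted >%R y -> sorted >=%R y.
Proof. by apply: sub_sorted => x z /ltW. Qed.

Lemma prod_gt0 (a : R) y : all (< a)%R y -> (0 < \prod_(b <- y) (a - b))%R.
Proof.
move=> /allP h; rewrite big_seq; apply: prodr_gt0 => b /h; rewrite subr_gt0; exact.
Qed.

Lemma vdm_gt0 y : sorted >%R y -> (0 < vdm y)%R.
Proof.
elim: y => [_|a y IH]; first exact: ltr01.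
by rewrite sorted_gt_cons => /andP[ay sy] /=; rewrite mulr_gt0 ?prod_gt0 ?IH.
Qed.

Lemma nnT_sub_const (p : {poly R}) (r : R) :
  nnT p^`() r -> nnT (p - (p.[r])%:P) r.
Proof.
rewrite {1}/nnT => /polyOverP h; apply/polyOverP => i; rewrite nnegrE.
case: i => [|i].
  by rewrite coef_taylor nderivn0 hornerD hornerN hornerC subrr.
have := h i; rewrite nnegrE.
have -> : (p^`() \Po ('X + r%:P) = (p \Po ('X + r%:P))^`())%R.
  by rewrite deriv_comp derivD derivX derivC addr0 mulr1.
rewrite coef_deriv pmulrn_lge0// comp_polyB coefB comp_polyC coefC /= subr0//.
Qed.

(** The difference vanishes at r, and its higher Taylor coefficients there come from those of p', so
    the top root is at most r. It is not smaller, since beyond its top root a monic polynomial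
    increases strictly. *)
Lemma topr_level (p : {poly R}) (r : R) : p \is monic -> (1 < size p)%N ->
  nnT p^`() r -> topr (p - (p.[r])%:P) = r.
Proof.
move=> pm sp h; have h' := nnT_sub_const h; set q := (p - _)%R in h' *.
have sq : size q = size p.
  by rewrite /q size_polyDl// size_polyN (leq_ltn_trans (size_polyC_leq1 _)).
have qm : q \is monic.
  rewrite monicE /q lead_coefDl -?monicE// size_polyN.
  by rewrite (leq_ltn_trans (size_polyC_leq1 _)).
have lq : (0 < lead_coef q)%R by rewrite (monicP qm).
have sq1 : (1 < size q)%N by rewrite sq.
apply/le_anti/andP; split; first exact/topr_le.
have /(topr_le _ lq sq1) h2 := lexx (topr q).
rewrite leNgt; apply/negP => tr.
have := nnT_lt qm sq1 h2 (lexx _) tr.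
rewrite ltNge {1}/q hornerD hornerN hornerC subrr.
by rewrite (nnT_ge0 h2).
Qed.

Lemma mseq_behead n d (T : measurableType d) (phi : T -> seq R) :
  mseq n.+1 phi -> mseq n (fun t => behead (phi t)).
Proof.
move=> mphi; split=> [t|i]; first by rewrite size_behead mphi.1.
by under eq_fun do rewrite nth_behead; exact: mphi.2.
Qed.

Lemma measurable_sorted n d (T : measurableType d) (phi : T -> seq R) :
  mseq n phi -> measurable_fun setT (fun t => sorted >%R (phi t)).
Proof.
elim: n phi => [|n IH] phi mphi.
  rewrite (_ : (fun _ => _) = cst true); first exact: measurable_cst.
  by apply/funext => t; have /size0nil -> := mphi.1 t.
case: n IH mphi => [|n] IH mphi.
  rewrite (_ : (fun _ => _) = cst true); first exact: measurable_cst.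
  by apply/funext => t; case: (phi t) (mphi.1 t) => [|x []].
rewrite (_ : (fun _ => _) = (fun t => (nth 0 (phi t) 1 < nth 0 (phi t) 0)%R &&
   sorted >%R (behead (phi t)))).
  apply: measurable_and.
    by apply: measurable_fun_ltr; exact: mphi.2.
  by apply: IH; exact: mseq_behead.
by apply/funext => t; case: (phi t) (mphi.1 t) => [|x [|y s]].
Qed.

Lemma measurable_eqseq n d (T : measurableType d) (phi psi : T -> seq R) :
  mseq n phi -> mseq n psi -> measurable_fun setT (fun t => phi t == psi t).
Proof.
elim: n phi psi => [|n IH] phi psi mphi mpsi.
  rewrite (_ : (fun _ => _) = cst true); first exact: measurable_cst.
  by apply/funext => t; have /size0nil -> := mphi.1 t; have /size0nil -> := mpsi.1 t.
rewrite (_ : (fun _ => _) = (fun t => (nth 0 (phi t) 0 == nth 0 (psi t) 0)%R &&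
   (behead (phi t) == behead (psi t)))).
  apply: measurable_and.
    by apply: measurable_fun_eqr; [exact: mphi.2|exact: mpsi.2].
  by apply: IH; exact: mseq_behead.
by apply/funext => t; case: (phi t) (mphi.1 t) => [//|x s]; case: (psi t) (mpsi.1 t).
Qed.

Lemma measurable_rrooted n d (T : measurableType d) (phi : T -> seq R) :
  mseq n phi -> measurable_fun setT (fun t => rrooted (phi t)).
Proof.
move=> mphi; have me := mseq_eig mphi; apply: measurable_and.
  exact: measurable_sorted me.
by apply: measurable_eqseq mphi; exact: mseq_ecoef.
Qed.

Lemma measurable_natbool d (T : measurableType d) (f : T -> bool) :
  measurable_fun setT f -> measurable_fun setT (fun t => (f t)%:R : R).
Proof.
by move=> mf; apply: (@measurableT_comp _ _ _ _ _ _ (fun b : bool => b%:R : R)).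
Qed.

Lemma measurable_vdm n d (T : measurableType d) (phi : T -> seq R) :
  mseq n phi -> measurable_fun setT (fun t => vdm (phi t)).
Proof.
elim: n phi => [|n IH] phi mphi.
  rewrite (_ : (fun _ => _) = cst 1%R); first exact: measurable_cst.
  by apply/funext => t; have /size0nil -> := mphi.1 t.
rewrite (_ : (fun _ => _) = (fun t => (\prod_(i < n) (nth 0 (phi t) 0 -
   nth 0 (phi t) i.+1)) * vdm (behead (phi t)))%R).
  apply: measurable_funM.
    apply: measurable_prod => i _.
    by apply: measurable_funB; exact: mphi.2.
  by apply: IH; exact: mseq_behead.
apply/funext => t; case: (phi t) (mphi.1 t) => [//|x s] /= [sn].
by rewrite (big_nth 0%R) sn big_mkord.
Qed.


(** With all coefficients but the constant one fixed, put p = [pol c * 'X]. The polynomial p + t is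
    parametrised by its top root r through t = -p(r), with Jacobian p'(r). The values of r fill the
    half-line that starts at the top root of p', on which p increases. *)
Lemma vdm_lebesgue_step n c (g : seq R -> \bar R) : size c = n ->
  mfun1 n.+1 g -> (forall y, 0 <= g y) ->
  \int[mu]_r (((rrooted (rcons c (- (pol c * 'X).[r])) &&
      (head 0 (eig (rcons c (- (pol c * 'X).[r]))) == r))%R%:R *
      ((pol c * 'X)^`()).[r])%R%:E * g (eig (rcons c (- (pol c * 'X).[r])%R))) =
  \int[mu]_t ((rrooted (rcons c t))%:R%:E * g (eig (rcons c t))).
Proof.
move=> sc mg g0; set p := (pol c * 'X)%R.
pose psi t := (rrooted (rcons c t))%:R%:E * g (eig (rcons c t)).
have mc : mseq n.+1 (fun t : measurableTypeR R => rcons c t).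
  split=> [t|i]; first by rewrite size_rcons sc.
  case h1 : (i < size c)%N.
    by under eq_fun do rewrite nth_rcons h1; exact: measurable_cst.
  case h2 : (i == size c).
    by under eq_fun do rewrite nth_rcons h1 h2; exact: measurable_id.
  by under eq_fun do rewrite nth_rcons h1 h2; exact: measurable_cst.
have mpsi : measurable_fun setT psi.
  apply: emeasurable_funM; last by apply: mg; exact: mseq_eig.
  by apply/measurable_EFinP/measurable_natbool; exact: measurable_rrooted mc.
have psi0 t : 0 <= psi t by rewrite mule_ge0// lee_fin.
have polE t : pol (rcons c t) = (p + t%:P)%R by rewrite pol_rcons.
have headE t : head 0%R (eig (rcons c t)) = topr (pol (rcons c t)).
  by rewrite /eig size_rcons.
have pm : p \is monic by rewrite monicMl ?pol_monic ?monicX.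
have sp : size p = n.+2 by rewrite size_mulX ?size_pol ?sc// -size_poly_eq0 size_pol.
(* In degree 1 the derivative is the constant 1, which has no top root; there p = X and the
   substitution is t = -r. *)
case: n => [|n] in sc mg mc sp *.
  have c0 : c = [::] by exact: size0nil.
  have pX : p = 'X by rewrite /p c0 pol_nil mul1r.
  have e1 (t : R) : eig [:: t] = [:: (- t)%R].
    have -> : [:: t] = ecoef [:: (- t)%R].
      apply: (can_inj (@polK R)); rewrite pol_ecoef big_seq1.
      by rewrite -[[:: t]]/(rcons [::] t) pol_rcons pol_nil mul1r polyCN opprK.
    by rewrite eig_ecoef.
  have e2 (t : R) : topr (pol [:: t]) = (- t)%R by case: (e1 t).
  have rr (t : R) : rrooted [:: t].
    rewrite /rrooted e1 /=; apply/eqP; apply: (can_inj (@polK R)).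
    rewrite pol_ecoef big_seq1.
    by rewrite -[[:: t]]/(rcons [::] t) pol_rcons pol_nil mul1r polyCN opprK.
  transitivity (\int[mu]_r g [:: r]).
    apply: eq_integral => r _.
    by rewrite pX derivX c0 /= rr e1 /= !hornerE e2 !opprK eqxx mul1e.
  transitivity (\int[mu]_t g [:: (- t)%R]); last first.
    by apply: eq_integral => r _; rewrite c0 /= rr e1 mul1e.
  have := @lebesgue_affine R (-1)%R 0%R (fun t => g [:: t]).
  rewrite oppr_eq0 oner_neq0 invrN1 normrN1 mul1e => <-//.
    by apply: eq_integral => t _; rewrite addr0 mulN1r.
  apply: mg; apply: (@mseq_cons _ 0 _ _ (fun t : measurableTypeR R => t)).
    exact: measurable_id.
  exact: mseq_nil.
have sp' : size p^`() = n.+2 by rewrite size_deriv sp.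
have lp' : (0 < lead_coef p^`())%R.
  rewrite /lead_coef sp' coef_deriv /=.
  have := monicP pm; rewrite /lead_coef sp /= => ->.
  by rewrite mulrn_wgt0.
pose rho := topr p^`().
have rhoP r : (rho <= r)%R <-> nnT p^`() r by apply: topr_le; rewrite ?sp'.
have sp1 : (1 < size p)%N by rewrite sp.
have pI x z : (rho <= x -> x < z -> p.[x] < p.[z])%R.
  move=> rx xz.
  have h : nnT (p - (p.[rho])%:P)%R rho by apply/nnT_sub_const/rhoP.
  have := @nnT_lt _ (p - (p.[rho])%:P)%R rho x z.
  rewrite !hornerD !hornerN !hornerC ltrD2r; apply => //.
    rewrite monicE lead_coefDl -?monicE// size_polyN.
    by rewrite (leq_ltn_trans (size_polyC_leq1 _)).
  by rewrite size_polyDl// size_polyN (leq_ltn_trans (size_polyC_leq1 _)).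
transitivity (\int[mu]_r (((rho <= r)%R%:R * p^`().[r])%:E *
    (fun u => psi (- u)%R) p.[r])).
  apply: eq_integral => r _; rewrite /psi headE polE polyCN.
  have [rr|rr] := leP rho r.
    rewrite topr_level ?eqxx ?andbT//; last exact/rhoP.
    by rewrite mul1r mulrC EFinM muleA.
  rewrite (_ : rrooted _ && _ = false) ?mul0r ?mul0e//.
  apply/negbTE/negP => /andP[_ /eqP tr].
  have : nnT (p - (p.[r])%:P)%R r.
    apply/topr_le; rewrite ?tr//.
      rewrite lead_coefDl ?(monicP pm)// size_polyN.
      by rewrite (leq_ltn_trans (size_polyC_leq1 _)).
    by rewrite size_polyDl// size_polyN (leq_ltn_trans (size_polyC_leq1 _)).
  move=> /nnT_deriv; rewrite derivB derivC subr0 => /rhoP.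
  by rewrite leNgt rr.
have mpsiN : measurable_fun setT (fun u : R => psi (- u)%R).
  by apply: (measurableT_comp mpsi).
rewrite (@lebesgue_poly_subst _ p rho (fun u => psi (- u)%R))//; last 2 first.
- by move=> x rx; apply: nnT_ge0 rx; apply/rhoP.
- move=> u pu.
  have lp : (0 < lead_coef (p - u%:P))%R.
    rewrite lead_coefDl ?(monicP pm)// size_polyN.
    by rewrite (leq_ltn_trans (size_polyC_leq1 _)).
  have [x0 hx0] := poly_pinfty_gt_lc lp.
  have := @poly_ivt _ (p - u%:P)%R rho (Num.max x0 rho).
  rewrite le_max lexx orbT => /(_ isT).
  rewrite hornerD hornerN hornerC => /(_ _)[|x /andP[rx _] /rootP].
    apply/andP; split; first by rewrite subr_le0.
    have := hx0 (Num.max x0 rho); rewrite le_max lexx => /(_ isT).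
    by rewrite hornerD hornerN hornerC; apply: le_trans; exact: ltW.
  by rewrite hornerD hornerN hornerC => /subr0_eq xu; exists x.
transitivity (\int[mu]_u (fun t => (p.[rho] <= - t)%R%:R%:E * psi t) (-1 * u + 0)%R).
  by apply: eq_integral => u _; rewrite addr0 mulN1r opprK.
rewrite (@lebesgue_affine R (-1)%R 0%R (fun t => (p.[rho] <= - t)%R%:R%:E * psi t)).
- rewrite invrN1 normrN1 mul1e; apply: eq_integral => t _.
  (* Levels with -t < p(rho) contribute nothing: the top root of a real-rooted p + t is also at
     least the top root of p', and from there on p is at least p(rho). *)
  have [|h] := leP p.[rho] (- t)%R; first by rewrite mul1e.
  rewrite mul0e /psi; case rt : (rrooted (rcons c t)); last by rewrite mul0e.
  move: rt => /andP[st /eqP et]; exfalso.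
  have r0 : root (pol (rcons c t)) (topr (pol (rcons c t))).
    rewrite -headE -{1}et pol_ecoef root_prod_XsubC.
    by rewrite /eig size_rcons mem_head.
  have : (rho <= topr (pol (rcons c t)))%R.
    apply/rhoP; have -> : p^`() = (pol (rcons c t))^`().
      by rewrite polE derivD derivC addr0.
    apply: nnT_deriv; apply/topr_le; rewrite ?(monicP (pol_monic _))//.
    by rewrite size_pol size_rcons.
  rewrite le_eqVlt => /predU1P[e|/(pI _ _ (lexx _))].
    by move: r0 h; rewrite -e polE rootE hornerD hornerC => /eqP; lra.
  by move: r0 h; rewrite polE rootE hornerD hornerC => /eqP; lra.
- by rewrite oppr_eq0 oner_neq0.
- apply: emeasurable_funM => //; apply/measurable_EFinP/measurable_natbool.
  by apply: measurable_fun_ler => //; exact: measurable_oppr.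
- by move=> t; rewrite mule_ge0// lee_fin.
Qed.

End vandermonde.

Section vandermonde_thm.
Local Open Scope ereal_scope.
Context (R : realType).
Notation mu := (@lebesgue_measure R).
Notation LSL := (LS mu).
Implicit Types (c y : seq R).

Lemma rrooted_ecoef y : sorted >%R y -> rrooted (ecoef y).
Proof.
by move=> sy; rewrite /rrooted eig_ecoef ?sorted_gt_ge// sy eqxx.
Qed.

Lemma rrooted_cons (r : R) c :
  let c' := cof (('X - r%:P) * pol c) in
  rrooted c' && (head 0%R (eig c') == r) = rrooted c && all (< r)%R (eig c).
Proof.
move=> c'.
have pc' : pol c' = (('X - r%:P) * pol c)%R.
  by rewrite cofK// monicMl ?pol_monic ?monicXsubC.
apply/idP/idP.
- move=> /andP[/andP[s' /eqP e'] /eqP h].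
  have sz : size (eig c') = (size c).+1.
    rewrite size_eig size_cof size_monicM ?monicXsubC// ?monic_neq0 ?pol_monic//.
    by rewrite size_XsubC size_pol.
  case E : (eig c') sz h s' e' => [//|a y] [sy] /= -> s' e'.
  move: s'; rewrite -[path _ _ _]/(sorted >%R (r :: y)) sorted_gt_cons => /andP[al sy'].
  have cy : c = ecoef y.
    apply: (can_inj (@polK R)); rewrite pol_ecoef.
    apply: (@mulfI _ ('X - r%:P)); first by rewrite polyXsubC_eq0.
    by rewrite -pc' -e' pol_ecoef big_cons.
  by rewrite cy rrooted_ecoef//= eig_ecoef// sorted_gt_ge.
- move=> /andP[/andP[sc /eqP ec] al].
  have e' : c' = ecoef (r :: eig c) by rewrite ecoef_cons ec.
  have ss : sorted >%R (r :: eig c) by rewrite sorted_gt_cons al.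
  by rewrite e' rrooted_ecoef// eig_ecoef ?sorted_gt_ge//= eqxx.
Qed.

(** Induction on the degree, splitting off the largest root r. The other roots are exchanged for the
    coefficients of the quotient by induction. For fixed r, Horner's scheme exchanges these for the
    coefficients of the whole polynomial except the constant one, without change of volume. With
    those fixed, r is exchanged for the constant term, and the Jacobian is the product of r minus
    each other root. *)
Theorem LS_eig n (g : seq R -> \bar R) : mfun1 n g -> (forall y, 0 <= g y) ->
  LSL n (fun y => ((sorted >%R y)%:R * vdm y)%:E * g y) =
  LSL n (fun c => (rrooted c)%:R%:E * g (eig c)).
Proof.
elim: n g => [|n IH] g mg g0 /=.
  rewrite mulr1 (_ : rrooted [::] = true)//.
  have -> : [::] = ecoef [::] :> seq R by apply/esym/size0nil; rewrite size_ecoef.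
  by rewrite rrooted_ecoef.
pose G r y := ((all (< r)%R y)%:R * \prod_(b <- y) (r - b))%:E * g (r :: y).
have G0 r y : 0 <= G r y.
  rewrite mule_ge0// lee_fin; case al : (all _ _); last by rewrite mul0r.
  by rewrite mul1r ltW// prod_gt0.
have mall d (T : measurableType d) (rho : T -> R) (phi : T -> seq R) m :
    measurable_fun setT rho -> mseq m phi ->
    measurable_fun setT (fun t => (all (< rho t)%R (phi t))%:R *
      \prod_(b <- phi t) (rho t - b))%R.
  move=> mrho; elim: m phi => [|m IHm] phi mphi.
    rewrite (_ : (fun _ => _) = cst 1%R); first exact: measurable_cst.
    by apply/funext => t; have /size0nil -> := mphi.1 t; rewrite big_nil mulr1.
  rewrite (_ : (fun _ => _) = (fun t => ((nth 0 (phi t) 0 < rho t)%R%:R *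
     (rho t - nth 0 (phi t) 0)) * ((all (< rho t)%R (behead (phi t)))%:R *
      \prod_(b <- behead (phi t)) (rho t - b)))%R).
    apply: measurable_funM; last by apply: IHm; exact: mseq_behead.
    apply: measurable_funM; last by apply: measurable_funB => //; exact: mphi.2.
    by apply: measurable_natbool; apply: measurable_fun_ltr => //; exact: mphi.2.
  apply/funext => t; case: (phi t) (mphi.1 t) => [//|x s] _ /=.
  by rewrite big_cons -mulnb natrM; ring.
have mG r : mfun1 n (G r).
  move=> d T phi mphi; apply: emeasurable_funM.
    by apply/measurable_EFinP; apply: (mall _ _ (fun=> r) phi n (measurable_cst _) mphi).
  by apply: mg; apply: mseq_cons => //; exact: measurable_cst.
pose c' r c := cof (('X - r%:P) * pol c)%R.
pose K r c := ((rrooted (c' r c) && (head 0 (eig (c' r c)) == r))%R%:R *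
   (pol c).[r])%R%:E * g (eig (c' r c)).
have KE r c : (rrooted c)%:R%:E * G r (eig c) = K r c.
  rewrite /K rrooted_cons /G; case rc : (rrooted c); last by rewrite !mul0r !mul0e.
  case al : (all _ _); last by rewrite !mul0r !mul0e mule0.
  move: rc => /andP[sc /eqP ec].
  rewrite !mul1r mul1e; congr ((_)%:E * g _).
    by rewrite -{2}ec pol_ecoef horner_prod; apply: eq_bigr => b _; rewrite hornerXsubC.
  rewrite /c' -{2}ec -ecoef_cons eig_ecoef// sorted_gt_ge// sorted_gt_cons al.
  exact: sc.
have cK r c : c' r (horn r 1%R c) = rcons c (- (pol c * 'X).[r])%R.
  by rewrite /c' -ecoef_horn last_horn.
pose H r c := ((rrooted (rcons c (- (pol c * 'X).[r])) &&
      (head 0 (eig (rcons c (- (pol c * 'X).[r]))) == r))%R%:R *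
      ((pol c * 'X)^`()).[r])%R%:E * g (eig (rcons c (- (pol c * 'X).[r])%R)).
have KH r c : K r (horn r 1%R c) = H r c.
  by rewrite /K /H cK horner_horn.
have K0 r c : 0 <= K r c by rewrite -KE mule_ge0// lee_fin.
have H0 r c : 0 <= H r c.
  by rewrite -KH.
have mc' d (T : measurableType d) (r : T -> R) (phi : T -> seq R) :
    measurable_fun setT r -> mseq n phi -> mseq n.+1 (fun t => c' (r t) (phi t)).
  exact: mseq_mulX.
have mK d (T : measurableType d) (r : T -> R) (phi : T -> seq R) :
    measurable_fun setT r -> mseq n phi ->
    measurable_fun setT (fun t => K (r t) (phi t)).
  move=> mr mphi; apply: emeasurable_funM; last first.
    by apply: mg; apply: mseq_eig; exact: mc'.
  have mh : measurable_fun setT (fun t => (pol (phi t)).[r t]).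
    rewrite (_ : (fun _ => _) = (fun t => \sum_(i < n.+1) (pol (phi t))`_i * r t ^+ i)%R).
      apply: measurable_sum => i; apply: measurable_funM.
        exact: measurable_coef_pol mphi.
      exact: measurable_funX.
    by apply/funext => t; rewrite horner_coef size_pol mphi.1.
  apply/measurable_EFinP/measurable_funM => //; apply: measurable_natbool.
  apply: measurable_and; first by apply: measurable_rrooted; exact: mc'.
  apply: measurable_fun_eqr => //.
  by under eq_fun do rewrite -nth0; exact: (mseq_eig (mc' _ _ _ _ mr mphi)).2.
transitivity (\int[mu]_r LSL n (H r)).
  apply: eq_integral => r _.
  transitivity (LSL n (fun y => ((sorted >%R y)%:R * vdm y)%:E * G r y)).
    apply: eq_LS => y _; rewrite /G -[path _ _ _]/(sorted >%R (r :: y)).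
    rewrite sorted_gt_cons muleA -EFinM -mulnb natrM; congr (_%:E * _); ring.
  rewrite IH//; under eq_LS do rewrite KE.
  have := @LS_horn R n r 1%R (K r).
  move=> <-//; first by under eq_LS do rewrite KH.
  by move=> d T phi mphi; apply: mK => //; exact: measurable_cst.
have mH d (T : measurableType d) (r : T -> R) (phi : T -> seq R) :
    measurable_fun setT r -> mseq n phi ->
    measurable_fun setT (fun t => H (r t) (phi t)).
  move=> mr mphi; under eq_fun do rewrite -KH.
  by apply: mK => //; apply: mseq_horn => //; exact: measurable_cst.
rewrite LS_swap1//.
  have := @LS_rcons R n (fun c => (rrooted c)%:R%:E * g (eig c)); rewrite /= => ->.
  by apply: eq_LS => c sc; exact: vdm_lebesgue_step sc _ _.
Qed.

End vandermonde_thm.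

(** * Interlacing lists and alternation of signs *)

Section interlacing.
Context (R : realType).
Implicit Types (x y s t w al : seq R) (p : {poly R}).

(** For a decreasing list, [alt x] is x_1, x_3, ... and [alt (behead x)] is x_2, x_4, ..., in the
    numbering of the statement; [il] undoes the splitting. *)
Fixpoint alt x : seq R :=
  if x is a :: x' then (if x' is b :: x'' then a :: alt x'' else [:: a]) else [::].

Fixpoint il t w : seq R :=
  if t is a :: t' then
    (if w is b :: w' then [:: a, b & il t' w'] else [:: a])
  else [::].

Lemma seq_ind2 (P : seq R -> Prop) : P [::] -> (forall a, P [:: a]) ->
  (forall a b x, P x -> P [:: a, b & x]) -> forall x, P x.
Proof.
move=> P0 P1 P2; suff H n x : (size x < n)%N -> P x by move=> x; exact: H (ltnSn _).
elim: n x => [//|n IH] [|a [|b x]] //= sx; apply: P2; apply: IH; lia.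
Qed.

Lemma alt_cons a x : alt (a :: x) = a :: alt (behead x).
Proof. by case: x. Qed.

Lemma subseq_alt x : subseq (alt x) x.
Proof.
elim/seq_ind2: x => [//|a|a b x IH] /=; rewrite eqxx//.
exact: subseq_trans IH (subseq_cons _ _).
Qed.

Lemma subseq_alt_behead x : subseq (alt (behead x)) x.
Proof.
case: x => [//|a x]; exact: subseq_trans (subseq_alt _) (subseq_cons _ _).
Qed.

Lemma gt_transitive : transitive (>%R : rel R).
Proof. by move=> ? ? ? h1 h2; exact: lt_trans h2 h1. Qed.

Lemma size_alt x : size (alt x) = uphalf (size x).
Proof. by elim/seq_ind2: x => //= a b x ->. Qed.

Lemma il_alt x : il (alt x) (alt (behead x)) = x.
Proof.
elim/seq_ind2: x => // a b x IH; rewrite alt_cons /= -/(alt (b :: x)) alt_cons.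
by rewrite IH.
Qed.

Lemma size_il t w : (size w <= size t <= (size w).+1)%N ->
  size (il t w) = (size t + size w)%N.
Proof.
elim: t w => [[]//|a t IH] [|b w] /=; first by case: t {IH}.
by rewrite !ltnS => /IH ->; rewrite addnS addSn.
Qed.

Lemma alt_il t w : (size w <= size t <= (size w).+1)%N -> alt (il t w) = t.
Proof.
elim: t w => [[]//|a t IH] [|b w] /=; first by case: t {IH}.
by rewrite !ltnS => /IH ->.
Qed.

Lemma alt_behead_il t w : (size w <= size t <= (size w).+1)%N ->
  alt (behead (il t w)) = w.
Proof.
elim: t w => [[]//|a t IH] [|b w] //.
rewrite !ltnS => h; rewrite [il _ _]/= [behead _]/= alt_cons.
by rewrite IH//.
Qed.

Lemma mem_il t w z : (size w <= size t <= (size w).+1)%N ->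
  (z \in il t w) = (z \in t) || (z \in w).
Proof.
elim: t w => [[]//|a t IH] [|b w] /=; first by case: t {IH}; rewrite // orbF.
rewrite !ltnS => h; rewrite !inE IH//.
by case: (z == a); case: (z == b); rewrite ?orbT.
Qed.

Lemma il_rcons t w a : size w = size t -> il (rcons t a) w = rcons (il t w) a.
Proof. by elim: t w => [|b t IH] [|c w] //= [/IH ->]. Qed.

Lemma il_rcons2 t w a : size t = (size w).+1 ->
  il t (rcons w a) = rcons (il t w) a.
Proof.
elim: t w => [|b t IH] [|c w] //=; first by case: t {IH}.
by move=> [/IH ->].
Qed.

Lemma il_cons a t w : (size t <= size w <= (size t).+1)%N ->
  il (a :: t) w = a :: il w t.
Proof.
elim: t w a => [|b t IH] [|c w] a //=.
by rewrite !ltnS => h; have /= -> := IH w b h.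
Qed.

Fixpoint altsgn (e : R) p t : bool :=
  if t is a :: t' then (0 < e * p.[a]) && altsgn (- e) p t' else true.

Lemma altsgnZ (e c : R) p q t : 0 < c ->
  (forall a, a \in t -> q.[a] = c * p.[a]) -> altsgn e p t = altsgn e q t.
Proof.
move=> c0; elim: t e => [//|a t IH] e /= h.
rewrite IH; last by move=> b bt; apply: h; rewrite inE bt orbT.
by rewrite h ?mem_head// mulrCA (pmulr_rgt0 _ c0).
Qed.

Lemma altsgnN (e : R) p t : altsgn e (- p) t = altsgn (- e) p t.
Proof. by elim: t e => [//|a t IH] e /=; rewrite IH hornerN mulrN mulNr. Qed.

Lemma altsgn_XsubC (e a : R) p t : all (< a) t ->
  altsgn e p t -> altsgn (- e) (('X - a%:P) * p) t.
Proof.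
elim: t e => [//|b t IH] e /= /andP[ba al] /andP[h1 h2].
rewrite IH// andbT hornerM hornerXsubC.
have -> : - e * ((b - a) * p.[b]) = (a - b) * (e * p.[b]) by ring.
by rewrite mulr_gt0// subr_gt0.
Qed.

Lemma sorted_rcons_gt x (a : R) : sorted >%R (rcons x a) -> all (> a) x /\ sorted >%R x.
Proof.
rewrite -rev_sorted rev_rcons /= path_sortedE; last by move=> ? ? ? /= h1 h2; exact: lt_trans h1 h2.
by rewrite all_rev => /andP[h1 h2]; split=> //; rewrite -rev_sorted.
Qed.

Lemma altsgn_prod y t : size t = size y -> sorted >%R (il y t) ->
  altsgn (-1) (\prod_(a <- y) ('X - a%:P)) t.
Proof.
elim: y t => [|a y IH] [|b t] //= [st].
move=> /andP[ab]; rewrite -[path _ _ _]/(sorted >%R (b :: il y t)) sorted_gt_cons => /andP[al so].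
have sub z : z \in y \/ z \in t -> z < b.
  by move=> h; apply: (allP al); rewrite mem_il ?st ?leqnn ?leqnSn//; apply/orP.
rewrite big_cons hornerM hornerXsubC; apply/andP; split.
  rewrite mulrA mulN1r opprB mulr_gt0 ?subr_gt0// horner_prod big_seq.
  by apply: prodr_gt0 => z zy; rewrite hornerXsubC subr_gt0 sub//; left.
apply: altsgn_XsubC; last exact: IH.
by apply/allP => z zt /=; rewrite (lt_trans (sub _ (or_intror zt))).
Qed.


Lemma altsgn_prod1 w t : size t = (size w).+1 -> sorted >%R (il t w) ->
  altsgn 1 (\prod_(a <- w) ('X - a%:P)) t.
Proof.
case: t => [//|a t] [st]; rewrite il_cons ?st ?leqnn ?leqnSn//.
rewrite sorted_gt_cons => /andP[al so] /=; rewrite altsgn_prod// andbT mul1r.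
rewrite horner_prod big_seq; apply: prodr_gt0 => z zw.
by rewrite hornerXsubC subr_gt0; apply: (allP al); rewrite mem_il ?st ?leqnn ?leqnSn// zw.
Qed.

(** The intermediate value theorem yields one root in each gap between consecutive points. *)
Lemma altsgn_roots (e : R) p a t : altsgn e p (a :: t) -> sorted >%R (a :: t) ->
  exists w, [/\ size w = size t, all (root p) w & sorted >%R (il (a :: t) w)].
Proof.
elim: t a e => [|b t IH] a e; first by move=> _ _; exists [::].
rewrite [sorted _ _]/= -[path _ _ _]/(sorted >%R (b :: t)).
move=> /= /andP[h1 h2] /andP[ba so].
have [w [sw rw iw]] := IH b (- e) h2 so.
move: h2 => /= /andP[h2 _].
have pba : p.[b] * p.[a] < 0.
  have : 0 < (e * p.[a]) * (- e * p.[b]) by rewrite mulr_gt0.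
  have -> : (e * p.[a]) * (- e * p.[b]) = e ^+ 2 * - (p.[b] * p.[a]) by ring.
  rewrite pmulr_rgt0 ?oppr_gt0// exprn_even_gt0//=.
  by apply: contraTneq h1 => ->; rewrite mul0r ltxx.
have [z zab rz] := polyrcf.poly_ivtoo (ltW ba) pba.
move: zab; rewrite in_itv/= => /andP[bz za].
exists (z :: w); split; first by rewrite /= sw.
  by rewrite /= rz.
by move: iw; case: (w) => [|c w'] /= iw; rewrite za bz.
Qed.

(** The number of gaps in [t] equals the degree of [p], so the roots found in the gaps are all the
    roots. *)
Lemma interlace_below p t : p \is monic -> size p = size t ->
  sorted >%R t -> altsgn 1 p t ->
  exists w, [/\ (size w).+1 = size t, p = \prod_(a <- w) ('X - a%:P) &
    sorted >%R (il t w)].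
Proof.
move=> pm; case: t => [/eqP|a t sp so sg].
  by rewrite size_poly_eq0 => /eqP p0; move: (monic_neq0 pm); rewrite p0 eqxx.
have [w [sw rw iw]] := altsgn_roots sg so; exists w; split=> //.
  by rewrite sw.
have sow : sorted >%R w.
  rewrite -(@alt_behead_il (a :: t) w) /= ?sw ?leqnn ?leqnSn//.
  exact: (@subseq_sorted _ _ gt_transitive _ _ (subseq_alt_behead _) iw).
rewrite (all_roots_prod_XsubC _ rw) ?(monicP pm) ?scale1r//.
  by rewrite sp sw.
rewrite uniq_rootsE; apply: sorted_uniq sow; first exact: gt_transitive.
by move=> z; exact: ltxx.
Qed.

(** Here one gap is missing. The polynomial is negative at the largest point of [t] and positive far
    to the right, so adding a point there reduces to [interlace_below]. *)
Lemma interlace_above p t : p \is monic -> size p = (size t).+1 ->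
  sorted >%R t -> altsgn (-1) p t ->
  exists y, [/\ size y = size t, p = \prod_(a <- y) ('X - a%:P) &
    sorted >%R (il y t)].
Proof.
move=> pm sp so sg.
have lp : 0 < lead_coef p by rewrite (monicP pm).
have [m hm] := poly_pinfty_gt_lc lp.
pose a := Num.max m (head 0 t + 1).
have pa : 0 < p.[a] by rewrite (lt_le_trans lp)// hm// le_max lexx.
have soa : sorted >%R (a :: t).
  case: t so @a {sp sg pa} => [//|b t] /= -> /=.
  by rewrite andbT lt_max ltrDl ltr01 orbT.
have sga : altsgn 1 p (a :: t) by rewrite /= mul1r pa.
have [y [[sy] pE so']] := @interlace_below p (a :: t) pm sp soa sga; exists y; split => //.
by move: so'; rewrite il_cons ?sy ?leqnn ?leqnSn// sorted_gt_cons => /andP[].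
Qed.

End interlacing.

(** * The three-term recurrence and its resultant *)

Section recurrence.
Context (R : realType).
Implicit Types (x y s t w al P Q : seq R) (p : {poly R}).

Lemma size_affs b al s : size al = size s -> size (affs b al s) = size s.
Proof. by move=> e; rewrite size_map size_zip e minnn. Qed.

Definition ext (e : bool) Q : seq R := if e then rcons Q 0 else Q.

Lemma size_ext e Q : size (ext e Q) = (size Q + e)%N.
Proof. by case: e; rewrite /= ?size_rcons ?addn1 ?addn0. Qed.

Lemma pol_ext e Q : pol (ext e Q) = pol Q * 'X^e.
Proof. by case: e; rewrite /= ?expr0 ?mulr1// pol_rcons addr0 expr1. Qed.

(** The polynomial T - k Q in coefficients. As Q is monic of degree one less, the head entry drops
    by exactly [k], which is how [Rw] recovers [k] from the pair. *)
Definition stepT (k : R) (T Q : seq R) : seq R :=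
  (head 0 T - k) :: affs (- k) (behead T) Q.

Lemma pol_stepT k T Q : size T = (size Q).+1 ->
  pol (stepT k T Q) = pol T - k *: pol Q.
Proof.
case: T => [//|h al] [] /=; rewrite /stepT /=.
elim/last_ind: Q al => [|Q q IH] al.
  move=> /size0nil ->; rewrite /affs /=.
  rewrite -[[:: h - k]]/(rcons [::] (h - k)) -[[:: h]]/(rcons [::] h).
  by rewrite !pol_rcons pol_nil polyCB alg_polyC; ring.
case/lastP: al => [|al a]; first by rewrite size_rcons.
rewrite !size_rcons => -[sz]; rewrite /affs zip_rcons// map_rcons /=.
rewrite -!rcons_cons !pol_rcons IH// polyCD polyCM polyCN -!mul_polyC; ring.
Qed.

Definition invT (k : R) (T P : seq R) : seq R :=
  affs (- k^-1) [seq k^-1 * z | z <- behead T] (behead P).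

Lemma stepK k T P : k = head 0 T - head 0 P -> k != 0 -> size P = size T ->
  (0 < size T)%N -> stepT k T (invT k T P) = P.
Proof.
case: T => [//|h T]; case: P => [//|a P] /= kE k0 [sz] _.
rewrite /stepT /invT /=; congr (_ :: _); first by rewrite kE; ring.
elim: T P sz {kE} => [|b T IH] [|c P] //= [sz]; congr (_ :: _); last exact: IH.
by rewrite /=; field.
Qed.

Lemma size_invT k T P : size P = size T -> size (invT k T P) = (size T).-1.
Proof. by move=> e; rewrite size_affs ?size_map ?size_behead ?e. Qed.

(* The weight of a pair of coefficient vectors: a power product of the
   coefficients k of the three-term recurrence p_{m+1} = X^e p_m - k p_{m-1}
   that leads to the pair when all of them are positive, and 0 otherwise. *)
Fixpoint Rw N P Q : R :=
  if N is N'.+1 then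
    let T := ext (~~ odd N') Q in
    let k := head 0 T - head 0 P in
    (0 < k)%R%:R * k ^+ (N./2) * Rw N' Q (invT k T P)
  else 1.

Lemma Rw_ge0 N P Q : 0 <= Rw N P Q.
Proof.
elim: N P Q => [|N IH] P Q; first exact: ler01.
rewrite [Rw _ _ _]/=; case: ltP => k0; last by rewrite !mul0r.
by rewrite mul1r mulr_ge0 ?IH// exprn_ge0// ltW.
Qed.

(** Absolute value of the resultant of the monic polynomials with roots [y] and [s]. *)
Definition res y s : R := \prod_(b <- s) \prod_(a <- y) `|b - a|.

Lemma head_ecoef y : head 0 (ecoef y) = - \sum_(a <- y) a.
Proof.
case: (posnP (size y)) => [/size0nil ->|y0].
  by rewrite big_nil oppr0; have /size0nil -> := size_ecoef ([::] : seq R).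
rewrite -(coefPn_prod_XsubC (lt0n_neq0 y0)) -nth0 /ecoef /cof nth_behead.
by rewrite nth_rev size_prod_XsubC // subSS subn1.
Qed.

Lemma ecoef_rcons0 y : ecoef (rcons y 0) = rcons (ecoef y) 0.
Proof.
apply: (can_inj (@polK R)); rewrite pol_rcons !pol_ecoef.
by rewrite -cats1 big_cat big_seq1 subr0 addr0.
Qed.

Lemma alt_rcons x (a : R) :
  alt (rcons x a) = if odd (size x) then alt x else rcons (alt x) a.
Proof.
elim/seq_ind2: x => [//|//|b c x IH] /=; rewrite IH negbK.
by case: ifP.
Qed.

Lemma behead_rcons x (a : R) : (0 < size x)%N -> behead (rcons x a) = rcons (behead x) a.
Proof. by case: x. Qed.

Lemma ext_alt x : ext (~~ odd (size x)) (ecoef (alt x)) = ecoef (alt (rcons x 0)).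
Proof. by rewrite alt_rcons; case: odd => //=; rewrite ecoef_rcons0. Qed.

Lemma sum_il_gt y t : size y = size t -> (0 < size y)%N -> sorted >%R (il y t) ->
  \sum_(a <- t) a < \sum_(a <- y) a.
Proof.
elim: y t => [//|a y IH] [//|b t] [sz] _.
rewrite [il _ _]/= sorted_gt_cons /= => /andP[/andP[ba _]].
rewrite -[path _ _ _]/(sorted >%R (b :: _)) sorted_gt_cons => /andP[_ so].
rewrite !big_cons; case: (posnP (size y)) => [y0|y0]; last by rewrite ltrD ?IH.
move: (y0) (y0); rewrite {2}sz => /size0nil -> /size0nil ->.
by rewrite !big_nil !addr0.
Qed.


Lemma sorted_rcons_last x : sorted >%R x -> 0 < last 1 x -> sorted >%R (rcons x 0).
Proof. by case: x => [//|a x] /= so h; rewrite rcons_path so. Qed.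

Lemma last_all_gt0 x : all (> 0) x -> 0 < last 1 x.
Proof.
by move=> /allP h; have := mem_last 1 x; rewrite inE => /predU1P[->|/h].
Qed.

Lemma last_il t w (d : R) : size t = (size w).+1 -> last d (il t w) = last d t.
Proof.
elim: t w d => [|a t IH] [|b w] d //=; first by case: (t).
by move=> [st]; rewrite (IH w)//; case: (t) st.
Qed.

Lemma last_il_eq t w (d : R) : size t = size w -> last d (il t w) = last d w.
Proof. by elim: t w d => [|a t IH] [|b w] d //= [/IH ->]. Qed.

(** Solves P = T - k Q' for Q'. At the roots of T the values of -P and k Q' agree, which transports
    sign patterns between P and Q'. *)
Lemma pol_levels k t P Q' : size P = size t -> (0 < size t)%N ->
  k = head 0 (ecoef t) - head 0 P -> 0 < k -> Q' = invT k (ecoef t) P ->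
  [/\ size Q' = (size t).-1, forall z, z \in t -> (- pol P).[z] = k * (pol Q').[z]
    & pol P = \prod_(b <- t) ('X - b%:P) - k *: pol Q'].
Proof.
move=> sP t0 kE k0 QE.
have sQ : size Q' = (size t).-1 by rewrite QE size_invT ?size_ecoef.
have e : pol P = \prod_(b <- t) ('X - b%:P) - k *: pol Q'.
  rewrite -pol_ecoef -pol_stepT; last by rewrite size_ecoef sQ prednK.
  by rewrite QE stepK ?size_ecoef// gt_eqF.
split=> // z zt; rewrite e opprB hornerD hornerN hornerZ.
suff -> : (\prod_(b <- t) ('X - b%:P)).[z] = 0 by rewrite subr0.
by apply/rootP; rewrite root_prod_XsubC.
Qed.

Lemma resE y s : res y s = \prod_(b <- s) `|(\prod_(a <- y) ('X - a%:P)).[b]|.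
Proof.
apply: eq_bigr => b _; rewrite horner_prod normr_prod.
by apply: eq_bigr => a _; rewrite hornerXsubC.
Qed.

Lemma res_sym y s : res y s = res s y.
Proof.
rewrite /res exchange_big; apply: eq_bigr => a _; apply: eq_bigr => b _.
exact: distrC.
Qed.

Lemma prod_const_seq (k : R) s (f : R -> R) :
  \prod_(b <- s) (k * f b) = k ^+ size s * \prod_(b <- s) f b.
Proof.
elim: s => [|a s IH]; first by rewrite !big_nil expr0 mulr1.
by rewrite !big_cons IH exprS; ring.
Qed.

(** One step of the recurrence reads P = T - k Q', and T vanishes at the roots of Q. Hence the
    product of |P(b)| over the roots b of Q is k^(deg Q) times that of |Q'(b)|: passing from (Q, Q')
    to (P, Q) multiplies the resultant by the very factor collected in [Rw]. The 0 appended to [x]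
    encodes positivity of the roots. *)
Lemma Rw_res N x : size x = N -> sorted >%R (rcons x 0) ->
  Rw N (ecoef (alt x)) (ecoef (alt (behead x))) = res (alt x) (alt (behead x)).
Proof.
elim: N x => [|N IH] x sx so.
  by have -> := size0nil sx; rewrite /res /= big_nil.
have sbx : size (behead x) = N by rewrite size_behead sx.
have x0 : (0 < size x)%N by rewrite sx.
set y := alt x; set s := alt (behead x).
pose t := alt (behead (rcons x 0)).
have TE : ext (~~ odd N) (ecoef s) = ecoef t.
  by rewrite /t behead_rcons// -ext_alt sbx.
have sy : size y = (N./2).+1 by rewrite size_alt sx.
have ss : size s = uphalf N by rewrite size_alt sbx.
have st : size t = (N./2).+1 by rewrite size_alt size_behead size_rcons sx.
have [xp so'] := sorted_rcons_gt so.
have tE : t = if odd N then s else rcons s 0.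
  by rewrite /t behead_rcons// alt_rcons sbx.
have soyt : sorted >%R (il y t).
  have [oN|eN] := boolP (odd N).
    by rewrite tE oN il_alt.
  have -> : il y t = rcons x 0; last exact: so.
  rewrite -[RHS]il_alt -/t; congr il.
  by rewrite alt_rcons sx /= eN.
rewrite [Rw _ _ _]/= TE; set k := head 0 _ - _.
have k0 : 0 < k.
  by rewrite /k !head_ecoef opprK addrC subr_gt0 sum_il_gt// ?sy ?st.
rewrite k0 mul1r; set Q' := invT _ _ _.
have [sQ' hz pP] := @pol_levels k t (ecoef y) Q' (etrans (size_ecoef y) (etrans sy (esym st)))
  (etrans (congr1 (leq 1) st) isT) erefl k0 erefl.
(* P alternates in sign on the roots of T by interlacing, hence so does Q', and its roots are forced
   into the gaps. *)
have sg : altsgn 1 (pol Q') t.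
  rewrite (altsgnZ _ k0 hz) altsgnN pol_ecoef.
  by apply: altsgn_prod => //; rewrite sy st.
have sot : sorted >%R t.
  exact: (@subseq_sorted _ _ (@gt_transitive R) _ _ (subseq_alt_behead _) so).
have sp : size (pol Q') = size t by rewrite size_pol sQ' st.
have [w [sw QE sow]] := interlace_below (pol_monic _) sp sot sg.
have Qw : Q' = ecoef w by apply: (can_inj (@polK R)); rewrite pol_ecoef.
move: sw; rewrite st => -[sw].
have c1 : (size w <= size s <= (size w).+1)%N.
  by rewrite ss sw uphalf_half; case: odd; rewrite ?add0n ?add1n leqnn ?leqnSn.
have := IH (il s w); rewrite alt_il// alt_behead_il// => {}IH.
rewrite Qw IH.
- rewrite [in RHS]resE -pol_ecoef.
  rewrite (_ : (uphalf N) = size s)//.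
  rewrite res_sym resE -prod_const_seq big_seq [RHS]big_seq.
  apply: eq_bigr => b bs; have bt : b \in t by rewrite tE; case: odd; rewrite ?mem_rcons ?inE bs ?orbT.
  rewrite -[in LHS](gtr0_norm k0) -normrM -QE -hz// hornerN normrN//.
- by rewrite size_il// ss sw uphalf_half -addnA addnn odd_double_half.
(* For even [N] the root 0 of T = X Q is in [t], so the interleaving already ends with 0. For odd
   [N] its last entry is a root of Q, positive by hypothesis. *)
- move: sow; rewrite tE; have [oN|eN] := boolP (odd N); last first.
    by rewrite il_rcons// ss sw uphalf_half (negbTE eN) add0n.
  move=> h; apply: sorted_rcons_last => //.
  rewrite last_il; last by rewrite ss sw uphalf_half oN.
  apply: last_all_gt0; apply/allP => z zs; apply: (allP xp).
  exact: (mem_subseq (subseq_alt_behead x)).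
Qed.

(** The support of [Rw]: when the coefficients k are all positive, the signs of P on the roots of T
    are opposite to those of Q', so interlacing and positivity of the roots pass from (Q, Q') to (P,
    Q). *)
Lemma Rw_neq0 N P Q : size P = uphalf N -> size Q = N./2 -> Rw N P Q != 0 ->
  exists x, [/\ size x = N, sorted >%R (rcons x 0), P = ecoef (alt x) &
    Q = ecoef (alt (behead x))].
Proof.
elim: N P Q => [|N IH] P Q sP sQ.
  move=> _; exists [::]; have e := size0nil (size_ecoef ([::] : seq R)).
  by rewrite /= e (size0nil sP) (size0nil sQ).
rewrite [Rw _ _ _]/=; set T := ext _ _; set k := head 0 T - _.
case: ltP => k0; last by rewrite !mul0r eqxx.
rewrite mul1r mulf_eq0 negb_or => /andP[_ RN].
have sT : size T = (N./2).+1.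
  by rewrite /T size_ext sQ /= uphalf_half; case: odd; rewrite ?add1n ?addn0 ?add0n ?addn1.
have sQ' : size (invT k T P) = N./2 by rewrite size_invT ?sT// sP.
have [x' [sx' so' QE Q'E]] := IH _ _ (sQ : size Q = uphalf N) sQ' RN.
pose s := alt x'; pose w := alt (behead x'); pose t := alt (rcons x' 0).
have TE : T = ecoef t by rewrite /T QE -sx' ext_alt.
have ss : size s = uphalf N by rewrite size_alt sx'.
have sw : size w = N./2.
  by rewrite size_alt size_behead sx'; case: (N).
have tE : t = if odd N then s else rcons s 0 by rewrite /t alt_rcons sx'.
have st : size t = (N./2).+1 by rewrite -sT TE size_ecoef.
have [xp so] := sorted_rcons_gt so'.
have sotw : sorted >%R (il t w).
  rewrite tE; case oN : (odd N); first by rewrite il_alt.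
  by rewrite il_rcons ?il_alt// sw ss uphalf_half oN.
have sot : sorted >%R t.
  exact: (@subseq_sorted _ _ (@gt_transitive R) _ _ (subseq_alt _) so').
have kE : k = head 0 (ecoef t) - head 0 P by rewrite /k TE.
have [_ hz pP] := @pol_levels k t P _ (etrans sP (esym st))
  (etrans (congr1 (leq 1) st) isT) kE k0 erefl.
rewrite -TE Q'E pol_ecoef in hz.
have sg : altsgn (-1) (pol P) t.
  rewrite -altsgnN -(altsgnZ _ k0 hz).
  by apply: altsgn_prod1 => //; rewrite st sw.
have sp : size (pol P) = (size t).+1 by rewrite size_pol sP st.
have [y [sy PE soy]] := interlace_above (pol_monic _) sp sot sg.
have Py : P = ecoef y by apply: (can_inj (@polK R)); rewrite pol_ecoef.
rewrite st in sy.
have c1 : (size s <= size y <= (size s).+1)%N.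
  by rewrite ss sy uphalf_half; case: odd; rewrite ?add0n ?add1n leqnn ?leqnSn.
exists (il y s); rewrite alt_il// alt_behead_il//; split=> //.
  by rewrite size_il// sy ss addSn addnC uphalf_half -addnA addnn odd_double_half.
move: soy; rewrite tE; have [oN|eN] := boolP (odd N); last first.
  by rewrite il_rcons2// ss sy uphalf_half (negbTE eN) add0n.
move=> h; apply: sorted_rcons_last => //.
rewrite last_il_eq; last by rewrite ss sy uphalf_half oN.
apply: last_all_gt0; apply/allP => z zs; apply: (allP xp).
exact: (mem_subseq (subseq_alt x')).
Qed.

End recurrence.

(** * From the recurrence coefficients to the pair of polynomials *)

Section recurrence_integral.
Local Open Scope ereal_scope.
Context (R : realType).
Notation mu := (@lebesgue_measure R).
Notation LSL := (LS mu).
Implicit Types (P Q : seq R).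

Lemma measurable_invr : measurable_fun setT (fun x : R => x^-1%R).
Proof.
(* For x nonzero this is x / x^2; at 0 both sides vanish because the inverse of 0 is 0. *)
rewrite (_ : (fun _ => _) = (fun x : R => x * expR (- ln (x ^+ 2)))%R).
  apply: measurable_funM => //; apply: measurableT_comp => //.
  apply: measurableT_comp => //; apply: measurableT_comp; first exact: measurable_ln.
  exact: measurable_funX.
apply/funext => x; have [->|x0] := eqVneq x 0%R; first by rewrite invr0 mul0r.
rewrite expRN lnK ?posrE ?exprn_even_gt0//.
by field.
Qed.

Lemma mseq_affs n d (T : measurableType d) (b : T -> R) (phi psi : T -> seq R) :
  measurable_fun setT b -> mseq n phi -> mseq n psi ->
  mseq n (fun t => affs (b t) (phi t) (psi t)).
Proof.
move=> mb mphi mpsi; split=> [t|i].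
  by rewrite size_affs ?mphi.1 ?mpsi.1.
have [ni|ni] := leqP n i.
  rewrite (_ : (fun _ => _) = cst 0%R); first exact: measurable_cst.
  by apply/funext => t; rewrite nth_default// size_affs ?mphi.1 ?mpsi.1.
rewrite (_ : (fun _ => _) = (fun t => b t * nth 0 (psi t) i + nth 0 (phi t) i)%R).
  apply: measurable_funD; last exact: mphi.2.
  by apply: measurable_funM => //; exact: mpsi.2.
apply/funext => t; rewrite (nth_map (0%R, 0%R)); last first.
  by rewrite size_zip mphi.1 mpsi.1 minnn.
by rewrite nth_zip ?mphi.1 ?mpsi.1.
Qed.

Lemma mseq_scale n d (T : measurableType d) (b : T -> R) (phi : T -> seq R) :
  measurable_fun setT b -> mseq n phi ->
  mseq n (fun t => [seq b t * z | z <- phi t]%R).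
Proof.
move=> mb mphi; split=> [t|i]; first by rewrite size_map mphi.1.
have [ni|ni] := leqP n i.
  rewrite (_ : (fun _ => _) = cst 0%R); first exact: measurable_cst.
  by apply/funext => t; rewrite nth_default// size_map mphi.1.
rewrite (_ : (fun _ => _) = (fun t => b t * nth 0 (phi t) i)%R).
  by apply: measurable_funM => //; exact: mphi.2.
by apply/funext => t; rewrite (nth_map 0%R) ?mphi.1.
Qed.

Lemma mseq_ext n (e : bool) d (T : measurableType d) (phi : T -> seq R) :
  mseq n phi -> mseq (n + e) (fun t => ext e (phi t)).
Proof.
move=> mphi; case: e; rewrite ?addn0//= addn1; split=> [t|i].
  by rewrite size_rcons mphi.1.
rewrite (_ : (fun _ => _) = (fun t => nth 0 (phi t) i)%R); first exact: mphi.2.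
apply/funext => t; rewrite nth_rcons; case: ltnP => // h.
by rewrite [RHS]nth_default//; case: ifP.
Qed.

Lemma measurable_head n d (T : measurableType d) (phi : T -> seq R) :
  mseq n phi -> measurable_fun setT (fun t => head 0%R (phi t)).
Proof. by move=> mphi; under eq_fun do rewrite -nth0; exact: mphi.2. Qed.

Lemma mseq_stepT n d (T : measurableType d) (k : T -> R) (phi psi : T -> seq R) :
  measurable_fun setT k -> mseq n.+1 phi -> mseq n psi ->
  mseq n.+1 (fun t => stepT (k t) (phi t) (psi t)).
Proof.
move=> mk mphi mpsi; apply: mseq_cons.
  by apply: measurable_funB => //; exact: measurable_head mphi.
by apply: mseq_affs => //; [exact: measurableT_comp|exact: mseq_behead].
Qed.

Lemma mseq_invT n d (T : measurableType d) (k : T -> R) (phi psi : T -> seq R) :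
  measurable_fun setT k -> mseq n.+1 phi -> mseq n.+1 psi ->
  mseq n (fun t => invT (k t) (phi t) (psi t)).
Proof.
move=> mk mphi mpsi.
have mV : measurable_fun setT (fun t => (k t)^-1%R).
  exact: (measurableT_comp measurable_invr mk).
apply: mseq_affs; first exact: measurableT_comp.
  by apply: mseq_scale => //; exact: mseq_behead.
exact: mseq_behead.
Qed.

Lemma uphalf_ext N : (uphalf N + ~~ odd N = N./2.+1)%N.
Proof. by rewrite uphalf_half; case: odd; rewrite /= ?addn0 ?addn1 ?add0n ?add1n. Qed.

Lemma measurable_Rw N d (T : measurableType d) (phi psi : T -> seq R) :
  mseq (uphalf N) phi -> mseq N./2 psi ->
  measurable_fun setT (fun t => Rw N (phi t) (psi t)).
Proof.
elim: N phi psi => [|N IH] phi psi mphi mpsi /=; first exact: measurable_cst.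
have mT := mseq_ext (~~ odd N) mpsi; rewrite uphalf_ext in mT.
have mk : measurable_fun setT (fun t =>
    head 0 (ext (~~ odd N) (psi t)) - head 0 (phi t))%R.
  by apply: measurable_funB; [exact: measurable_head mT|exact: measurable_head mphi].
apply: measurable_funM; last by apply: IH => //; exact: mseq_invT.
apply: measurable_funM; last exact: measurable_funX.
by apply: measurable_natbool; exact: measurable_fun_ltr.
Qed.

(** The last two terms of the recurrence, whose coefficients are consumed from the right end of
    [ks]. The factor X is applied at every other step. *)
Fixpoint pp (ks : seq R) : seq R * seq R :=
  if ks is k :: ks' then
    (stepT k (ext (~~ odd (size ks')) (pp ks').1) (pp ks').2, (pp ks').1)
  else ([::], [::]).

(** The powers produced by the radial integration of the rows in [tri_reduction]: the gamma
    densities of their squared norms without the exponentials. *)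
Fixpoint wt (ks : seq R) : R :=
  if ks is k :: ks' then ((0 < k)%R%:R * k ^+ size ks' * wt ks')%R else 1%R.

Lemma mseq_pp N d (T : measurableType d) (phi : T -> seq R) : mseq N phi ->
  mseq (uphalf N) (fun t => (pp (phi t)).1) /\
  mseq N./2 (fun t => (pp (phi t)).2).
Proof.
elim: N phi => [|N IH] phi mphi.
  have -> : phi = fun=> [::] by apply/funext => t; exact: size0nil (mphi.1 t).
  by split; exact: mseq_nil.
have [m1 m2] := IH _ (mseq_behead mphi).
have E t : phi t = head 0%R (phi t) :: behead (phi t).
  by case: (phi t) (mphi.1 t).
split; last first.
  by rewrite (_ : (fun _ => _) = (fun t => (pp (behead (phi t))).1))//;
    apply/funext => t; rewrite {1}E.
rewrite (_ : (fun _ => _) = (fun t => stepT (head 0%R (phi t))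
  (ext (~~ odd N) (pp (behead (phi t))).1) (pp (behead (phi t))).2)).
  apply: mseq_stepT => //; first exact: measurable_head mphi.
  by rewrite -uphalf_ext; exact: mseq_ext.
by apply/funext => t; rewrite {1}E /= size_behead mphi.1.
Qed.

Lemma stepTK (k : R) T Q : k != 0%R -> size T = (size Q).+1 ->
  invT k T (stepT k T Q) = Q.
Proof.
case: T => [//|h T] k0 [sz]; rewrite /stepT /invT /=.
elim: T Q sz => [|b T IH] [|c Q] //= [sz]; congr (_ :: _); last exact: IH.
by rewrite /=; field.
Qed.

(** From [N] to [N.+1], with Q fixed: the first coefficient of P = T - k Q' is h - k, where h is the
    first coefficient of T, and the others are those of Q' scaled by -k and shifted. The Jacobian
    k^(N./2) consumes part of the weight k^N; what is left is the power recorded in [Rw]. *)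
Theorem LS_recurrence N G : mfun2 (uphalf N) N./2 G -> (forall P Q, 0 <= G P Q) ->
  LSL N (fun ks => (wt ks)%:E * G (pp ks).1 (pp ks).2) =
  LSL (uphalf N) (fun P => LSL N./2 (fun Q => (Rw N P Q)%:E * G P Q)).
Proof.
elim: N G => [//|N IH] G mG G0; rewrite [LHS]/= [RHS]/= -/(uphalf N).
set e := ~~ odd N.
pose w (k : R) := ((0 < k)%R%:R * k ^+ N)%R.
have w0 k : (0 <= w k)%R.
  rewrite /w; case: ltP => k0; last by rewrite mul0r.
  by rewrite mul1r exprn_ge0// ltW.
have mw : measurable_fun setT w.
  apply: measurable_funM; last exact: measurable_funX.
  by apply: measurable_natbool; exact: measurable_fun_ltr.
pose Gk k Q Q' := (w k)%:E * G (stepT k (ext e Q) Q') Q.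
have Gk0 k Q Q' : 0 <= Gk k Q Q' by rewrite mule_ge0// lee_fin.
have mGk d (T : measurableType d) (k : T -> R) (phi psi : T -> seq R) :
    measurable_fun setT k -> mseq (uphalf N) phi -> mseq N./2 psi ->
    measurable_fun setT (fun t => Gk (k t) (phi t) (psi t)).
  move=> mk mphi mpsi; apply: emeasurable_funM.
    by apply/measurable_EFinP; exact: (measurableT_comp mw mk).
  apply: mG => //; apply: mseq_stepT => //.
  by rewrite -uphalf_ext; exact: mseq_ext.
have mRG d (T : measurableType d) (k : T -> R) (phi psi : T -> seq R) :
    measurable_fun setT k -> mseq (uphalf N) phi -> mseq N./2 psi ->
    measurable_fun setT (fun t => (Rw N (phi t) (psi t))%:E * Gk (k t) (phi t) (psi t)).
  move=> mk mphi mpsi; apply: emeasurable_funM; last exact: mGk.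
  by apply/measurable_EFinP; exact: measurable_Rw.
have mRG' d (T : measurableType d) (phi psi : T -> seq R) :
    mseq N./2.+1 phi -> mseq (uphalf N) psi ->
    measurable_fun setT (fun t => (Rw N.+1 (phi t) (psi t))%:E * G (phi t) (psi t)).
  move=> mphi mpsi; apply: emeasurable_funM; last exact: mG.
  by apply/measurable_EFinP; exact: measurable_Rw.
transitivity (\int[mu]_k LSL (uphalf N) (fun Q => LSL N./2 (fun Q' =>
    (Rw N Q Q')%:E * Gk k Q Q'))).
  apply: eq_integral => k _; rewrite -IH//; last first.
    by move=> d T phi psi mphi mpsi; apply: mGk => //; exact: measurable_cst.
  apply: eq_LS => ks sks; rewrite sks /Gk muleA -EFinM mulrC.
  by congr (_%:E * _).
rewrite LS_swap1; last 2 first.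
- move=> d T k phi mk mphi; apply: measurable_LS; last first.
    by move=> t Q'; rewrite mule_ge0// lee_fin Rw_ge0.
  move=> d' T' pi psi mpi mpsi; apply: mRG => //; first exact: measurableT_comp.
  exact: mseq_comp mphi.
- by move=> k Q; apply: LS_ge0 => Q' _; rewrite mule_ge0// lee_fin Rw_ge0.
transitivity (\int[mu]_p0 LSL (uphalf N) (fun Q => LSL N./2 (fun P' =>
    (Rw N.+1 (p0 :: P') Q)%:E * G (p0 :: P') Q))); last first.
  apply: eq_integral => p0 _; rewrite LS_swap//; last first.
    by move=> P Q; rewrite mule_ge0// lee_fin (Rw_ge0 N.+1).
  move=> d T phi psi mphi mpsi; apply: mRG' => //.
  by apply: mseq_cons => //; exact: measurable_cst.
rewrite LS_swap1; last 2 first.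
- move=> d T k phi mk mphi; apply: measurable_LS; last first.
    by move=> t Q'; rewrite mule_ge0// lee_fin (Rw_ge0 N.+1).
  move=> d' T' pi psi mpi mpsi; apply: mRG'; last exact: mseq_comp mphi.
  by apply: mseq_cons => //; exact: measurableT_comp.
- by move=> k Q; apply: LS_ge0 => Q' _; rewrite mule_ge0// lee_fin (Rw_ge0 N.+1).
apply: eq_LS => Q sQ.
have : size (ext e Q) = N./2.+1 by rewrite size_ext sQ uphalf_ext.
case TE : (ext e Q) => [//|h al] [sal].
pose Psi p0 := LSL N./2 (fun P' => (Rw N.+1 (p0 :: P') Q)%:E * G (p0 :: P') Q).
have mf p0 : mfun1 N./2 (fun P' => (Rw N.+1 (p0 :: P') Q)%:E * G (p0 :: P') Q).
  move=> d T phi mphi; apply: mRG'.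
    by apply: mseq_cons => //; exact: measurable_cst.
  by rewrite -sQ; exact: mseq_cst.
have Psi0 p0 : 0 <= Psi p0.
  by apply: LS_ge0 => P' _; rewrite mule_ge0// lee_fin (Rw_ge0 N.+1).
have mPsi : measurable_fun setT Psi.
  apply: measurable_LS; last by move=> t P'; rewrite mule_ge0// lee_fin (Rw_ge0 N.+1).
  move=> d T pi phi mpi mphi; apply: mRG'; first exact: mseq_cons.
  by rewrite -sQ; exact: mseq_cst.
transitivity (\int[mu]_k Psi (-1 * k + h)%R); last first.
  by rewrite (@lebesgue_affine R (-1)%R h Psi)// ?invrN1 ?normrN1 ?mul1e// oppr_eq0 oner_neq0.
apply: eq_integral => k _; rewrite mulN1r addrC /Psi.
have [k0|k0] := ltP 0%R k; last first.
  transitivity (LSL N./2 (fun=> 0 : \bar R)); [apply: eq_LS => Q' _|apply/esym/eq_LS => P' _].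
    by rewrite /Gk /w ltNge k0 mul0r mul0e mule0.
  by rewrite [Rw _ _ _]/= -/e TE /= subKr ltNge k0 !mul0r mul0e.
have k0' : k != 0%R by rewrite gt_eqF.
pose F P' := (Rw N.+1 ((h - k)%R :: P') Q)%:E * G ((h - k)%R :: P') Q.
transitivity ((k ^+ N./2)%:E * LSL N./2 (fun Q' => F (affs (- k) al Q'))).
  rewrite -LS_Zl; last 3 first.
  - by rewrite lee_fin exprn_ge0// ltW.
  - move=> d T phi mphi; apply: mf; apply: mseq_affs mphi; first exact: measurable_cst.
    by rewrite -sal; exact: mseq_cst.
  - by move=> Q'; rewrite mule_ge0// lee_fin (Rw_ge0 N.+1).
  apply: eq_LS => Q' sQ'; rewrite /F.
  rewrite [Rw N.+1 _ _]/= -/e TE [head _ _]/= subKr k0 mul1r.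
  have -> : (h - k)%R :: affs (- k)%R al Q' = stepT k (h :: al) Q' by [].
  rewrite stepTK//=; last by rewrite sQ' sal.
  rewrite /Gk TE /w k0 mul1r !muleA -!EFinM; congr (_%:E * _).
  (* N = N./2 + uphalf N splits the exponent between the Jacobian and the weight [Rw]. *)
  rewrite mulrA -exprD -/(uphalf N) addnC uphalf_half -addnA addnn odd_double_half.
  by rewrite mulrC.
rewrite (@LS_affine R _ _ _ F sal)//; last 3 first.
- by rewrite oppr_eq0.
- exact: mf.
- by move=> P'; rewrite mule_ge0// lee_fin (Rw_ge0 N.+1).
rewrite muleA -EFinM invrN normrN normfV gtr0_norm// -exprMn mulfV// expr1n mul1e.
by [].
Qed.

End recurrence_integral.

(** * The joint law of the interlacing roots *)

Section eigen_integral.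
Local Open Scope ereal_scope.
Context (R : realType).
Notation mu := (@lebesgue_measure R).
Notation LSL := (LS mu).
Implicit Types (P Q x y s : seq R).

Lemma perm_alt x : perm_eq (alt x ++ alt (behead x)) x.
Proof.
elim: x => [//|a x IH]; rewrite alt_cons /= perm_cons.
by rewrite perm_catC.
Qed.

(** Differences of entries of equal rank parity form two Vandermonde products, the mixed ones form
    the resultant. *)
Lemma vdm_alt x : sorted >%R x ->
  vdm x = (vdm (alt x) * vdm (alt (behead x)) * res (alt x) (alt (behead x)))%R.
Proof.
elim: x => [_|a x IH]; first by rewrite /res big_nil /= !mulr1.
rewrite sorted_gt_cons => /andP[al so].
rewrite alt_cons [behead _]/= [vdm (a :: x)]/= [vdm (a :: _)]/= IH//.
rewrite -(perm_big _ (perm_alt x)) big_cat /=.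
rewrite [res (a :: _) _](_ : _ = (\prod_(b <- alt x) (a - b)) *
    res (alt (behead x)) (alt x))%R; last first.
  rewrite /res -big_split /= big_seq [RHS]big_seq; apply: eq_bigr => b bx.
  rewrite big_cons distrC gtr0_norm// subr_gt0.
  exact: (allP al _ (mem_subseq (subseq_alt x) bx)).
by rewrite (res_sym (alt (behead x))); ring.
Qed.

Lemma mseq_alt n d (T : measurableType d) (phi : T -> seq R) :
  mseq (n + n) phi ->
  mseq n (fun t => alt (phi t)) /\ mseq n (fun t => alt (behead (phi t))).
Proof.
elim: n phi => [|n IH] phi mphi.
  have -> : phi = fun=> [::] by apply/funext => t; exact: size0nil (mphi.1 t).
  by split; exact: mseq_nil.
move: mphi; rewrite addSn addnS => mphi.
have [m1 m2] := IH _ (mseq_behead (mseq_behead mphi)).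
have h1 := measurable_head mphi; have h2 := measurable_head (mseq_behead mphi).
have E t : phi t = [:: head 0%R (phi t), head 0%R (behead (phi t)) &
    behead (behead (phi t))].
  by case: (phi t) (mphi.1 t) => [//|a [|b x]].
split.
- rewrite (_ : (fun _ => _) = (fun t => head 0%R (phi t) ::
      alt (behead (behead (phi t))))); first exact: mseq_cons.
  by apply/funext => t; rewrite {1}E.
- rewrite (_ : (fun _ => _) = (fun t => head 0%R (behead (phi t)) ::
      alt (behead (behead (behead (phi t)))))); first exact: mseq_cons.
  by apply/funext => t; rewrite {1}E [behead _]/= alt_cons.
Qed.

Lemma LS_il n f : mfun1 (n + n) f -> (forall x, 0 <= f x) ->
  LSL n (fun y => LSL n (fun s => f (il y s))) = LSL (n + n) f.
Proof.
elim: n f => [//|n IH] f; rewrite addSn addnS => mf f0 /=.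
apply: eq_integral => a _.
have mfa : mfun1 (n + n).+1 (fun x => f (a :: x)) by exact: mfun1_cst_cons.
have mil d (T : measurableType d) (phi psi : T -> seq R) :
    mseq n phi -> mseq n psi -> mseq (n + n) (fun t => il (phi t) (psi t)).
  elim: (n) phi psi => [|m IHm] phi psi mphi mpsi.
    rewrite (_ : (fun _ => _) = fun=> [::]); first exact: mseq_nil.
    by apply/funext => t; rewrite (size0nil (mphi.1 t)).
  rewrite (_ : (fun _ => _) = (fun t => [:: head 0%R (phi t), head 0%R (psi t) &
     il (behead (phi t)) (behead (psi t))])).
    rewrite addSn addnS; apply: mseq_cons; first exact: measurable_head mphi.
    apply: mseq_cons; first exact: measurable_head mpsi.
    by apply: IHm; exact: mseq_behead.
  apply/funext => t; case: (phi t) (mphi.1 t) => [//|b y] _.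
  by case: (psi t) (mpsi.1 t).
transitivity (\int[mu]_b LSL n (fun y => LSL n (fun s => f [:: a, b & il y s]))).
  rewrite LS_swap1//.
  - move=> d T k phi mk mphi; apply: measurable_LS => // d' T' pi psi mpi mpsi.
    apply: mfa; apply: mseq_cons; first exact: measurableT_comp.
    by apply: mil => //; exact: mseq_comp mphi.
  - by move=> b y; exact: LS_ge0.
apply: eq_integral => b _; rewrite (IH (fun x => f [:: a, b & x]))//.
exact: mfun1_cst_cons mfa.
Qed.

(** [LS_recurrence] passes to the coefficients of the two polynomials and two uses of [LS_eig] to
    their roots. There [Rw] is the resultant on interlacing pairs and 0 elsewhere, and [vdm_alt]
    assembles the three products. *)
Theorem LS_interlaced n G : mfun2 n n G -> (forall P Q, 0 <= G P Q) ->
  LSL (n + n) (fun ks => (wt ks)%:E * G (pp ks).1 (pp ks).2) =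
  LSL (n + n) (fun x => ((sorted >%R (rcons x 0%R))%:R * vdm x)%:E *
     G (ecoef (alt x)) (ecoef (alt (behead x)))).
Proof.
move=> mG G0.
have h2 : (n + n)./2 = n by rewrite addnn doubleK.
have u2 : uphalf (n + n) = n by rewrite addnn uphalf_double.
rewrite LS_recurrence; rewrite ?h2 ?u2//.
pose g2 y s := (Rw (n + n) (ecoef y) (ecoef s))%:E * G (ecoef y) (ecoef s).
have g20 y s : 0 <= g2 y s by rewrite mule_ge0// lee_fin Rw_ge0.
have mg2 : mfun2 n n g2.
  move=> d T phi psi mphi mpsi; apply: emeasurable_funM; last first.
    by apply: mG; exact: mseq_ecoef.
  by apply/measurable_EFinP/measurable_Rw; rewrite ?u2 ?h2; exact: mseq_ecoef.
transitivity (LSL n (fun P => (rrooted P)%:R%:E *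
    LSL n (fun Q => (rrooted Q)%:R%:E * g2 (eig P) (eig Q)))).
  apply: eq_LS => P sP; rewrite -LS_Zl//; last 2 first.
  - move=> d T psi mpsi; apply: emeasurable_funM.
      by apply/measurable_EFinP/measurable_natbool; exact: measurable_rrooted mpsi.
    apply: mg2; last exact: mseq_eig.
    by rewrite -sP -(size_eig P); exact: mseq_cst.
  - by move=> Q; rewrite mule_ge0// lee_fin.
  apply: eq_LS => Q sQ.
  (* Inserting the indicators [rrooted] is harmless: they equal 1 wherever [Rw] is nonzero. *)
  have [R0|Rn0] := eqVneq (Rw (n + n) P Q) 0%R.
    rewrite R0 mul0e; case rP : (rrooted P); last by rewrite mul0e.
    case rQ : (rrooted Q); last by rewrite mul0e mule0.
    move: rP rQ => /andP[_ /eqP rP] /andP[_ /eqP rQ].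
    by rewrite /g2 rP rQ R0 mul0e !mule0.
  have [x [sx so PE QE]] :=
    Rw_neq0 (etrans sP (esym u2)) (etrans sQ (esym h2)) Rn0.
  have [_ sox] := sorted_rcons_gt so.
  have s1 : sorted >%R (alt x) := @subseq_sorted _ _ (@gt_transitive R) _ _ (subseq_alt x) sox.
  have s2 : sorted >%R (alt (behead x)) :=
    @subseq_sorted _ _ (@gt_transitive R) _ _ (subseq_alt_behead x) sox.
  by rewrite /g2 PE QE !rrooted_ecoef// !eig_ecoef ?sorted_gt_ge// !mul1e.
rewrite -(@LS_eig R n (fun y => LSL n (fun Q => (rrooted Q)%:R%:E * g2 y (eig Q)))); last 2 first.
- move=> d T phi mphi; apply: measurable_LS; last first.
    by move=> t s; rewrite mule_ge0// lee_fin.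
  move=> d' T' pi psi mpi mpsi; apply: emeasurable_funM.
    by apply/measurable_EFinP/measurable_natbool; exact: measurable_rrooted mpsi.
  by apply: mg2; [exact: mseq_comp mphi|exact: mseq_eig].
- by move=> y; apply: LS_ge0 => s _; rewrite mule_ge0// lee_fin.
pose F x := ((sorted >%R (rcons x 0%R))%:R * vdm x)%:E *
     G (ecoef (alt x)) (ecoef (alt (behead x))).
have sv0 y : (0 <= (sorted >%R y)%:R * vdm y)%R.
  case so : (sorted _ _); last by rewrite mul0r.
  by rewrite mul1r ltW// vdm_gt0.
have mF : mfun1 (n + n) F.
  move=> d T phi mphi; apply: emeasurable_funM; last first.
    by have [] := mseq_alt mphi; move=> ? ?; apply: mG; exact: mseq_ecoef.
  apply/measurable_EFinP/measurable_funM; last exact: measurable_vdm mphi.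
  apply: measurable_natbool; apply: (@measurable_sorted _ (n + n + true)).
  exact: (@mseq_ext _ _ true).
have F0 x : 0 <= F x.
  rewrite /F; apply: mule_ge0 => //; rewrite lee_fin.
  case so : (sorted _ _); last by rewrite mul0r.
  by rewrite mul1r ltW// vdm_gt0//; case: (sorted_rcons_gt so).
rewrite -(LS_il mF F0); apply: eq_LS => y sy.
rewrite -(@LS_eig R n (g2 y)) => [|d T psi mpsi|//]; last first.
  by apply: mg2 => //; rewrite -sy; exact: mseq_cst.
rewrite -LS_Zl//.
- apply: eq_LS => s ss.
  have c1 : (size s <= size y <= (size s).+1)%N by rewrite sy ss leqnn leqnSn.
  have [so|nso] := boolP (sorted >%R (rcons (il y s) 0%R)).
    have [_ sox] := sorted_rcons_gt so.
    rewrite /F so mul1r alt_il// alt_behead_il//.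
    have sil : size (il y s) = (n + n)%N by rewrite size_il// sy ss.
    have := Rw_res sil so; rewrite alt_il// alt_behead_il// /g2 => ->.
    have := subseq_alt (il y s); rewrite alt_il// => s1.
    have := subseq_alt_behead (il y s); rewrite alt_behead_il// => s2.
    have so1 := @subseq_sorted _ _ (@gt_transitive R) _ _ s1 sox.
    have so2 := @subseq_sorted _ _ (@gt_transitive R) _ _ s2 sox.
    rewrite so1 so2 !mul1r !muleA -!EFinM; congr (_%:E * _).
    by have := vdm_alt sox; rewrite alt_il// alt_behead_il// => ->.
  (* Lists that do not interlace have [Rw] = 0: otherwise [Rw_neq0] supplies interlacing root lists,
     and [eig_ecoef] identifies them with [y] and [s]. *)
  rewrite /F (negbTE nso) !mul0r mul0e /g2.
  case so1 : (sorted >%R y); last by rewrite mul0r mul0e.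
  case so2 : (sorted >%R s); last by rewrite mul0r mul0e mule0.
  have [->|Rn0] := eqVneq (Rw (n + n) (ecoef y) (ecoef s)) 0%R.
    by rewrite mul0e !mule0.
  have [x [sx so PE QE]] := Rw_neq0
    (etrans (size_ecoef y) (etrans sy (esym u2)))
    (etrans (size_ecoef s) (etrans ss (esym h2))) Rn0.
  have [_ sox] := sorted_rcons_gt so.
  have s1 : sorted >%R (alt x) :=
    @subseq_sorted _ _ (@gt_transitive R) _ _ (subseq_alt x) sox.
  have s2 : sorted >%R (alt (behead x)) :=
    @subseq_sorted _ _ (@gt_transitive R) _ _ (subseq_alt_behead x) sox.
  move: nso; rewrite -[y]eig_ecoef ?sorted_gt_ge// -[s]eig_ecoef ?sorted_gt_ge//.
  by rewrite PE QE !eig_ecoef ?sorted_gt_ge// il_alt so.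
- by rewrite lee_fin.
- move=> d T psi mpsi; apply: emeasurable_funM; last first.
    by apply: mg2 => //; rewrite -sy; exact: mseq_cst.
  apply/measurable_EFinP/measurable_funM; last exact: measurable_vdm mpsi.
  by apply/measurable_natbool; exact: measurable_sorted mpsi.
- by move=> s; rewrite mule_ge0// lee_fin.
Qed.

End eigen_integral.

(** * Squared norms under Lebesgue measure *)

Section radial.
Local Open Scope ereal_scope.
Context (R : realType).
Notation mu := (@lebesgue_measure R).
Notation LSL := (LS mu).
Implicit Types (f g : R -> \bar R).

Lemma eq_integral_except (a : R) f g :
  measurable_fun setT f -> measurable_fun setT g ->
  (forall x, 0 <= f x) -> (forall x, 0 <= g x) ->
  (forall x, x != a -> f x = g x) ->
  \int[mu]_x f x = \int[mu]_x g x.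
Proof.
move=> mf mg f0 g0 fg; apply: ge0_ae_eq_integral => //.
exists [set a]; split; first exact: measurable_set1.
  exact: lebesgue_measure_set1.
move=> x /= h; apply: contrapT => /eqP xa; apply: h => _.
exact: fg.
Qed.

Lemma measurable_bool_mul d (T : measurableType d) (b : T -> bool) (f : T -> \bar R) :
  measurable_fun setT b -> measurable_fun setT f ->
  measurable_fun setT (fun t => (b t)%:R%:E * f t).
Proof.
move=> mb mf; apply: emeasurable_funM => //.
by apply/measurable_EFinP; exact: measurable_natbool.
Qed.

(** Both half-lines contribute equally, and on the nonnegative one the substitution is r = a x^2. *)
Lemma integral_abs_sqr (a : R) f : (0 < a)%R ->
  measurable_fun setT f -> (forall x, 0 <= f x) ->
  \int[mu]_x (`|x|%:E * f (a * x ^+ 2)%R) =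
  a^-1%:E * \int[mu]_r ((0 < r)%R%:R%:E * f r).
Proof.
move=> a0 mf f0.
have mfa : measurable_fun setT (fun x : R => f (a * x ^+ 2)%R).
  by apply: (measurableT_comp mf); apply: measurable_funM.
have pos (x : R) : (0 <= (0 <= x)%R%:R * x)%R.
  by case: (lerP 0%R x) => x0; rewrite ?mul1r ?mul0r.
pose h (x : R) := ((0 <= x)%R%:R * x)%:E * f (a * x ^+ 2)%R.
have h0 x : 0 <= h x by rewrite /h mule_ge0// lee_fin.
have mh : measurable_fun setT h.
  apply: emeasurable_funM => //; apply/measurable_EFinP/measurable_funM => //.
  by apply: measurable_natbool; exact: measurable_fun_ler.
have mhN : measurable_fun setT (fun x : R => h (- x)%R) by exact: measurableT_comp.
transitivity (\int[mu]_x (h x + h (-1 * x + 0)%R)).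
  apply: eq_integral => x _; rewrite addr0 mulN1r /h sqrrN -ge0_muleDl ?lee_fin//.
  congr (_ * _); rewrite -EFinD; congr (_%:E).
  rewrite oppr_ge0; case: (ltrgtP x 0%R) => [x0|x0|->].
  - by rewrite ltr0_norm// mul0r mul1r add0r.
  - by rewrite gtr0_norm// mul0r mul1r addr0.
  - by rewrite normr0 oppr0 !mulr0 addr0.
rewrite ge0_integralD//; last first.
  by under eq_fun do rewrite addr0 mulN1r.
rewrite (@lebesgue_affine R (-1)%R 0%R h)// ?oppr_eq0 ?oner_neq0//.
rewrite invrN1 normrN1 mul1e.
pose p : {poly R} := (a *: 'X^2)%R.
have pE x : p.[x] = (a * x ^+ 2)%R by rewrite /p hornerZ hornerXn.
have p'E x : (p^`()).[x] = (a * (x *+ 2))%R.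
  by rewrite /p derivZ derivXn hornerZ hornerMn hornerXn expr1.
have := @lebesgue_poly_subst R p 0%R f.
have -> : p.[0%R] = 0%R by rewrite pE expr0n mulr0.
move=> /(_ _ _ _ mf f0) H.
have -> : \int[mu]_r ((0 < r)%R%:R%:E * f r) = \int[mu]_r ((0 <= r)%R%:R%:E * f r).
  apply: (@eq_integral_except 0%R).
  - by apply: measurable_bool_mul => //; exact: measurable_fun_ltr.
  - by apply: measurable_bool_mul => //; exact: measurable_fun_ler.
  - by move=> x; rewrite mule_ge0// lee_fin.
  - by move=> x; rewrite mule_ge0// lee_fin.
  - by move=> x x0; rewrite lt_def x0.
rewrite -H.
- rewrite -ge0_integralZl//.
  + have -> : \int[mu]_x h x + \int[mu]_x h x = \int[mu]_x (2%:E * h x).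
      rewrite ge0_integralZl// (_ : 2%:E = 1 + 1); last by rewrite -EFinD; congr (_%:E); rewrite -natr1.
      by rewrite ge0_muleDl// mul1e.
    apply: eq_integral => x _; rewrite pE p'E /h !muleA -!EFinM; congr (_%:E * _).
    by field; rewrite gt_eqF.
  + apply: emeasurable_funM; last by under eq_fun do rewrite pE.
    apply/measurable_EFinP/measurable_funM.
      by apply: measurable_natbool; exact: measurable_fun_ler.
    by apply: continuous_measurable_fun; exact: continuous_horner.
  + move=> x _; rewrite mule_ge0// lee_fin p'E.
    by rewrite !mulrnAr mulrn_wge0// mulrCA mulr_ge0// ltW.
  + by rewrite lee_fin invr_ge0 ltW.
- by move=> x x0; rewrite p'E mulr_ge0// ?(ltW a0)// mulrn_wge0.
- move=> x y x0 xy; rewrite !pE ltr_pM2l// ltr_pXn2r// nnegrE//.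
  exact: le_trans (ltW xy).
- move=> u u0; exists (Num.sqrt (u / a)); first exact: sqrtr_ge0.
  by rewrite pE sqr_sqrtr ?divr_ge0// ?ltW//; field; rewrite gt_eqF.
Qed.

End radial.

Section radial2.
Local Open Scope ereal_scope.
Context (R : realType).
Notation mu := (@lebesgue_measure R).
Notation LSL := (LS mu).
Implicit Types (f : R -> \bar R).

Lemma Tonelli (f : R -> R -> \bar R) :
  measurable_fun setT (fun z : measurableTypeR R * measurableTypeR R => f z.1 z.2) ->
  (forall x y, 0 <= f x y) ->
  \int[mu]_x \int[mu]_y f x y = \int[mu]_y \int[mu]_x f x y.
Proof.
move=> mf f0.
by rewrite (@fubini_tonelli _ _ _ _ R mu mu (fun z => f z.1 z.2)).
Qed.

Lemma measurable_integral d (T : measurableType d) (f : T -> R -> \bar R) :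
  measurable_fun setT (fun z : T * measurableTypeR R => f z.1 z.2) ->
  (forall x y, 0 <= f x y) ->
  measurable_fun setT (fun t => \int[mu]_y f t y).
Proof.
move=> mf f0.
by apply: (@measurable_fun_fubini_tonelli_F _ _ T (measurableTypeR R) R mu (fun z => f z.1 z.2)).
Qed.

(* Polar coordinates without angles: put y = x t, then r = x^2 (1 + t^2). *)
Lemma integral_sqrD : exists2 c : \bar R, 0 <= c &
  forall f, measurable_fun setT f -> (forall x, 0 <= f x) ->
  \int[mu]_x \int[mu]_y f (x ^+ 2 + y ^+ 2)%R =
  c * \int[mu]_r ((0 < r)%R%:R%:E * f r).
Proof.
exists (\int[mu]_t ((1 + t ^+ 2)^-1)%R%:E).
  by apply: integral_ge0 => t _; rewrite lee_fin invr_ge0 addr_ge0// sqr_ge0.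
move=> f mf f0.
have m1 : measurable_fun setT
    (fun z : measurableTypeR R * measurableTypeR R => f (z.1 ^+ 2 + z.2 ^+ 2)%R).
  apply: (measurableT_comp mf); apply: measurable_funD; apply: measurable_funX.
    exact: measurable_fst.
  exact: measurable_snd.
have m2 : measurable_fun setT (fun z : measurableTypeR R * measurableTypeR R =>
    `|z.1|%:E * f ((1 + z.2 ^+ 2) * z.1 ^+ 2)%R).
  apply: emeasurable_funM.
    by apply/measurable_EFinP; apply: measurableT_comp => //; exact: measurable_fst.
  apply: (measurableT_comp mf); apply: measurable_funM; last first.
    by apply: measurable_funX; exact: measurable_fst.
  by apply: measurable_funD => //; apply: measurable_funX; exact: measurable_snd.
have m1x x : measurable_fun setT (fun y : R => f (x ^+ 2 + y ^+ 2)%R).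
  apply: (measurableT_comp mf); apply: measurable_funD => //; exact: measurable_funX.
have m2x x : measurable_fun setT (fun t : R => f ((1 + t ^+ 2) * x ^+ 2)%R).
  apply: (measurableT_comp mf); apply: measurable_funM => //.
  by apply: measurable_funD => //; exact: measurable_funX.
transitivity (\int[mu]_x \int[mu]_t (`|x|%:E * f ((1 + t ^+ 2) * x ^+ 2)%R)).
  apply: (@eq_integral_except R 0%R).
  - exact: (@measurable_integral _ (measurableTypeR R) (fun x y => f (x ^+ 2 + y ^+ 2)%R)).
  - apply: (@measurable_integral _ (measurableTypeR R) (fun x t => `|x|%:E * f ((1 + t ^+ 2) * x ^+ 2)%R)) => //.
    by move=> x y; rewrite mule_ge0.
  - by move=> x; exact: integral_ge0.
  - by move=> x; apply: integral_ge0 => t _; rewrite mule_ge0.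
  - move=> x x0; rewrite ge0_integralZl//; last exact: m2x.
    have := @lebesgue_affine R x 0%R (fun y => f (x ^+ 2 + y ^+ 2)%R) x0 (m1x x) (fun=> f0 _).
    move=> /esym H.
    have -> : \int[mu]_t f ((1 + t ^+ 2) * x ^+ 2)%R =
        \int[mu]_t f (x ^+ 2 + (x * t + 0) ^+ 2)%R.
      by apply: eq_integral => t _; congr f; ring.
    by rewrite -H// muleA -EFinM normfV mulfV ?normr_eq0// mul1e.
transitivity (\int[mu]_t \int[mu]_x (`|x|%:E * f ((1 + t ^+ 2) * x ^+ 2)%R)).
  apply: (@Tonelli (fun x t => `|x|%:E * f ((1 + t ^+ 2) * x ^+ 2)%R)) => //.
  by move=> x y; rewrite mule_ge0.
rewrite -ge0_integralZr//.
- apply: eq_integral => t _; rewrite integral_abs_sqr//.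
  by rewrite ltr_pwDl// sqr_ge0.
- apply/measurable_EFinP.
  apply: (measurableT_comp (@measurable_invr R)).
  by apply: measurable_funD => //; exact: measurable_funX.
- by move=> t _; rewrite lee_fin invr_ge0 addr_ge0// sqr_ge0.
- by apply: integral_ge0 => r _; rewrite mule_ge0// lee_fin.
Qed.

(** The convolution of r^m with the constant 1, both on the positive half-line, is homogeneous of
    degree m+1, hence proportional to r^(m+1); the constant is its value at 1. *)
Lemma integral_power_conv m : exists2 c : \bar R, 0 <= c &
  forall f, measurable_fun setT f -> (forall x, 0 <= f x) ->
  \int[mu]_s ((0 < s)%R%:R%:E *
     \int[mu]_r (((0 < r)%R%:R * r ^+ m)%:E * f (s + r)%R)) =
  c * \int[mu]_r (((0 < r)%R%:R * r ^+ m.+1)%:E * f r).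
Proof.
pose w (u r : R) : R := ((0 < r)%R%:R * (r < u)%R%:R * r ^+ m)%R.
have w0 u r : (0 <= w u r)%R.
  rewrite /w; case: (ltrP 0%R r) => r0; last by rewrite !mul0r.
  by rewrite !mulr_ge0// exprn_ge0// ltW.
have w0' r : (0 <= (0 < r)%R%:R * r ^+ m :> R)%R.
  by case: (ltrP 0%R r) => r0; rewrite ?mul0r// mul1r exprn_ge0// ltW.
exists (\int[mu]_r (w 1%R r)%:E).
  by apply: integral_ge0 => r _; rewrite lee_fin.
move=> f mf f0.
have mlt d (T : measurableType d) (g h : T -> R) :
    measurable_fun setT g -> measurable_fun setT h ->
    measurable_fun setT (fun t => (g t < h t)%R%:R : R).
  by move=> mg mh; apply: measurable_natbool; exact: measurable_fun_ltr.
have mw : measurable_fun setT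
    (fun z : measurableTypeR R * measurableTypeR R => w z.1 z.2).
  apply: measurable_funM.
    by apply: measurable_funM; apply: mlt => //; first [exact: measurable_snd|exact: measurable_fst].
  by apply: measurable_funX; exact: measurable_snd.
have mw1 u : measurable_fun setT (w u).
  apply: measurable_funM; last exact: measurable_funX.
  by apply: measurable_funM; exact: mlt.
have wint u : (0 < u)%R ->
    \int[mu]_r (w u r)%:E = (u ^+ m.+1)%:E * \int[mu]_r (w 1%R r)%:E.
  move=> u0.
  have mwu : measurable_fun setT (fun r => (w u r)%:E) by apply/measurable_EFinP.
  have w0u y : 0 <= (w u y)%:E by rewrite lee_fin.
  have H := @lebesgue_affine R u 0%R _ (lt0r_neq0 u0) mwu w0u.
  have E : \int[mu]_r (w u r)%:E = u%:E * \int[mu]_x (w u (u * x + 0)%R)%:E.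
    by rewrite H muleA -EFinM gtr0_norm ?invr_gt0// mulfV ?gt_eqF// mul1e.
  rewrite E exprS EFinM -muleA; congr (_ * _).
  rewrite -ge0_integralZl; last 4 first.
  - exact: measurableT.
  - apply/measurable_EFinP; exact: mw1.
  - by move=> r _; rewrite lee_fin.
  - by rewrite lee_fin exprn_ge0// ltW.
  apply: eq_integral => r _; rewrite addr0 -EFinM; congr (_%:E).
  rewrite /w pmulr_rgt0// exprMn -{2}[u]mulr1 ltr_pM2l//; ring.
transitivity (\int[mu]_s \int[mu]_r (((0 < r)%R%:R * r ^+ m)%:E *
    ((0 < s)%R%:R%:E * f (s + r)%R))).
  apply: eq_integral => s _; rewrite -ge0_integralZl; last 4 first.
  - exact: measurableT.
  - apply: emeasurable_funM.
      apply/measurable_EFinP; apply: measurable_funM; first exact: mlt.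
      exact: measurable_funX.
    by apply: (measurableT_comp mf); exact: measurable_funD.
  - by move=> r _; rewrite mule_ge0// lee_fin.
  - by rewrite lee_fin.
  by apply: eq_integral => r _; rewrite muleCA.
rewrite Tonelli; last 2 first.
- apply: emeasurable_funM.
    apply/measurable_EFinP; apply: measurable_funM.
      by apply: mlt => //; exact: measurable_snd.
    by apply: measurable_funX; exact: measurable_snd.
  apply: emeasurable_funM.
    by apply/measurable_EFinP; apply: mlt => //; exact: measurable_fst.
  apply: (measurableT_comp mf); apply: measurable_funD.
    exact: measurable_fst.
  exact: measurable_snd.
- by move=> s r; rewrite !mule_ge0// lee_fin.
transitivity (\int[mu]_r \int[mu]_u ((w u r)%:E * f u)).
  apply: eq_integral => r _.
  rewrite ge0_integralZl; last 4 first.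
  - exact: measurableT.
  - apply: emeasurable_funM; first by apply/measurable_EFinP; exact: mlt.
    by apply: (measurableT_comp mf); exact: measurable_funD.
  - by move=> s _; rewrite mule_ge0// lee_fin.
  - by rewrite lee_fin.
  have mru : measurable_fun setT (fun u => (r < u)%R%:R%:E * f u).
    by apply: emeasurable_funM => //; apply/measurable_EFinP; exact: mlt.
  have ru0 u : 0 <= (r < u)%R%:R%:E * f u by rewrite mule_ge0// lee_fin.
  have H := @lebesgue_shift R r _ mru ru0.
  transitivity (((0 < r)%R%:R * r ^+ m)%:E * \int[mu]_u ((r < u)%R%:R%:E * f u)).
    by rewrite -H; congr (_ * _); apply: eq_integral => s _; rewrite ltrDr.
  rewrite -ge0_integralZl; last 4 first.
  - exact: measurableT.
  - exact: mru.
  - by move=> u _.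
  - by rewrite lee_fin.
  apply: eq_integral => u _; rewrite muleA -EFinM /w; congr (_%:E * _); ring.
rewrite Tonelli; last 2 first.
- apply: emeasurable_funM.
    apply/measurable_EFinP.
    apply: measurable_funM.
      by apply: measurable_funM; apply: mlt => //; first [exact: measurable_fst|exact: measurable_snd].
    by apply: measurable_funX; exact: measurable_fst.
  exact: (measurableT_comp mf measurable_snd).
- by move=> r u; rewrite mule_ge0// lee_fin.
rewrite -ge0_integralZl; last 4 first.
- exact: measurableT.
- apply: emeasurable_funM => //; apply/measurable_EFinP/measurable_funM.
    exact: mlt.
  exact: measurable_funX.
- move=> r _; rewrite mule_ge0// lee_fin.
  by case: (ltrP 0%R r) => r0; rewrite ?mul0r// mul1r exprn_ge0// ltW.
- by apply: integral_ge0 => r _; rewrite lee_fin.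
apply: eq_integral => u _; rewrite ge0_integralZr; last 4 first.
- exact: measurableT.
- apply/measurable_EFinP; exact: mw1.
- by move=> r _; rewrite lee_fin.
- by [].
rewrite muleA; congr (_ * _).
have [u0|u0] := ltrP 0%R u; first by rewrite (wint _ u0) mul1r muleC.
rewrite mul0r mule0; apply: integral0_eq => r _; rewrite /w.
by case: (ltrP 0%R r) => r0; rewrite ?mul0r// ltNge (le_trans u0 (ltW r0)) mulr0 mul0r.
Qed.

End radial2.

Section int_lebesgue.
Local Open Scope ereal_scope.
Context (R : realType) (I : eqType).
Notation mu := (@lebesgue_measure R).
Notation IntL := (@Int R I mu).
Implicit Types (v : I -> R) (s : seq I) (f : (I -> R) -> \bar R).

(** Induction by pairs of coordinates: the squared norm of a pair has constant density
    ([integral_sqrD]), and a further pair raises the power by one ([integral_power_conv]). *)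
Lemma Int_radial m : exists2 c : \bar R, 0 <= c &
  forall (f : R -> \bar R) s v, measurable_fun setT f -> (forall x, 0 <= f x) ->
    uniq s -> size s = (m.+1).*2 ->
    IntL s (fun v => f (\sum_(i <- s) v i ^+ 2)%R) v =
    c * \int[mu]_r (((0 < r)%R%:R * r ^+ m)%:E * f r).
Proof.
have [c c0 hc] := integral_sqrD R.
elim: m => [|m [d d0 IH]].
  exists c => // f [|i [|j []]]//= v mf f0; rewrite inE andbT => ij _.
  transitivity (\int[mu]_x \int[mu]_y f (x ^+ 2 + y ^+ 2)%R).
    apply: eq_integral => x _; apply: eq_integral => y _.
    by rewrite !big_cons big_nil addr0 upd_eq upd_neq// upd_eq.
  by rewrite (hc f mf f0); congr (_ * _); apply: eq_integral => r _; rewrite mulr1.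
have [e e0 he] := integral_power_conv R m.
exists (d * (c * e)); first by rewrite !mule_ge0.
move=> f [|i [|j s]]//= v mf f0.
rewrite inE negb_or => /andP[/andP[ij nis] /andP[njs us]] [ss].
have mpow : measurable_fun setT (fun r : R => (0 < r)%R%:R * r ^+ m)%R.
  apply: measurable_funM; last exact: measurable_funX.
  by apply: measurable_natbool; exact: measurable_fun_ltr.
have pow0 (r : R) : (0 <= (0 < r)%R%:R * r ^+ m)%R.
  by case: (ltrP 0%R r) => r0; rewrite ?mul0r// mul1r exprn_ge0// ltW.
pose g a := \int[mu]_r (((0 < r)%R%:R * r ^+ m)%:E * f (a + r)%R).
have g0 a : 0 <= g a by apply: integral_ge0 => r _; rewrite mule_ge0// lee_fin.
have mg : measurable_fun setT g.
  apply: (@measurable_integral _ _ (measurableTypeR R)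
    (fun a r => ((0 < r)%R%:R * r ^+ m)%:E * f (a + r)%R)).
    apply: emeasurable_funM.
      by apply/measurable_EFinP; exact: (measurableT_comp mpow measurable_snd).
    apply: (measurableT_comp mf); apply: measurable_funD.
      exact: measurable_fst.
    exact: measurable_snd.
  by move=> a r; rewrite mule_ge0// lee_fin.
transitivity (\int[mu]_x \int[mu]_y (d * g (x ^+ 2 + y ^+ 2)%R)).
  apply: eq_integral => x _; apply: eq_integral => y _.
  rewrite -(IH (fun r => f (x ^+ 2 + y ^+ 2 + r)%R) s (upd (upd v i x) j y))//; last first.
    by apply: (measurableT_comp mf); exact: measurable_funD.
  apply: eq_Int => v' v'E; rewrite !big_cons addrA.
  by rewrite !v'E// upd_eq upd_neq// upd_eq.
have mg2 x : measurable_fun setT (fun y : R => g (x ^+ 2 + y ^+ 2)%R).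
  by apply: (measurableT_comp mg); apply: measurable_funD => //; exact: measurable_funX.
transitivity (d * \int[mu]_x \int[mu]_y g (x ^+ 2 + y ^+ 2)%R).
  rewrite -ge0_integralZl; last 4 first.
  - exact: measurableT.
  - apply: (@measurable_integral _ _ (measurableTypeR R) (fun x y => g (x ^+ 2 + y ^+ 2)%R)) => //.
    apply: (measurableT_comp mg); apply: measurable_funD; apply: measurable_funX.
      exact: measurable_fst.
    exact: measurable_snd.
  - by move=> x _; exact: integral_ge0.
  - exact: d0.
  by apply: eq_integral => x _; rewrite ge0_integralZl//; exact: mg2.
by rewrite (hc g mg g0) (he f mf f0) !muleA.
Qed.

(** * Invariance of Lebesgue integrals under rotations *)

Definition rot (c s : R) i j v : I -> R :=
  upd (upd v i (c * v i - s * v j)%R) j (s * v i + c * v j)%R.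

Lemma mfun_rot d (U : measurableType d) (c s : R) i j (f : (I -> R) -> U) :
  mfun f -> mfun (fun v => f (rot c s i j v)).
Proof.
move=> mf d' T phi mphi; apply: mf => k; rewrite /rot /upd.
case: (k == j).
  by apply: measurable_funD; apply: measurable_funM.
case: (k == i); last exact: mphi.
by apply: measurable_funB; apply: measurable_funM.
Qed.

(** For nonzero s, replace y by u = c x - s y at fixed x, then x by the second coordinate at fixed
    u: the factors |1/s| and |s| cancel. For s = 0 the rotation is a sign. *)
Lemma integral_rot (c s : R) (g : R -> R -> \bar R) : (c ^+ 2 + s ^+ 2 = 1)%R ->
  measurable_fun setT (fun z : measurableTypeR R * measurableTypeR R => g z.1 z.2) ->
  (forall x y, 0 <= g x y) ->
  \int[mu]_x \int[mu]_y g (c * x - s * y)%R (s * x + c * y)%R =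
  \int[mu]_x \int[mu]_y g x y.
Proof.
move=> cs mg g0.
have mgg d (T : measurableType d) (a b : T -> R) : measurable_fun setT a ->
    measurable_fun setT b -> measurable_fun setT (fun t => g (a t) (b t)).
  move=> ma mb.
  have mab : measurable_fun setT (fun t => (a t, b t) : measurableTypeR R * measurableTypeR R).
    exact: measurable_fun_pair.
  exact: (measurableT_comp mg mab).
have [s0|s0] := eqVneq s 0%R.
  have c1 : (`|c^-1| = 1)%R.
    have /eqP : (c ^+ 2 = 1)%R by rewrite -cs s0 expr0n addr0.
    by rewrite sqrf_eq1 => /orP[] /eqP ->; rewrite ?invr1 ?invrN1 ?normrN1 ?normr1.
  have c0 : (c != 0)%R by rewrite -normr_eq0 -invr_eq0 -normfV c1 oner_neq0.
  transitivity (\int[mu]_x \int[mu]_y g (c * x + 0)%R y).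
    apply: eq_integral => x _.
    have := @lebesgue_affine R c 0%R (g (c * x + 0)%R) c0.
    rewrite c1 mul1e => <-//; last exact: mgg.
    by apply: eq_integral => y _; rewrite s0 !mul0r subr0 add0r !addr0.
  have := @lebesgue_affine R c 0%R (fun x => \int[mu]_y g x y) c0.
  rewrite c1 mul1e => ->//.
    exact: (@measurable_integral _ _ (measurableTypeR R) g).
  by move=> x; exact: integral_ge0.
have sN0 : (- s != 0)%R by rewrite oppr_eq0.
have sV0 : (s^-1 != 0)%R by rewrite invr_eq0.
transitivity (\int[mu]_x \int[mu]_u (`|s^-1|%:E * g u (s^-1 * x + - (c * u / s))%R)).
  apply: eq_integral => x _.
  rewrite ge0_integralZl; last 4 first.
  - exact: measurableT.
  - apply: mgg => //; apply: measurable_funD => //; apply: measurable_funN.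
    by apply: measurable_funM => //; exact: measurable_funM.
  - by [].
  - by rewrite lee_fin.
  have := @lebesgue_affine R (- s)%R (c * x)%R
    (fun u => g u (s^-1 * x + - (c * u / s))%R) sN0.
  rewrite invrN normrN => <-//.
    apply: eq_integral => y _; congr g; first by ring.
    have -> : (s * x + c * y = (s ^+ 2 * x + c * (s * y)) / s)%R by field.
    have -> : (s ^+ 2 = 1 - c ^+ 2)%R by rewrite -cs; ring.
    by field.
  apply: mgg => //; apply: measurable_funD => //; apply: measurable_funN.
  by apply: measurable_funM => //; exact: measurable_funM.
rewrite (@Tonelli R (fun x u => `|s^-1|%:E * g u (s^-1 * x + - (c * u / s))%R)); last 2 first.
- apply: emeasurable_funM => //; apply: mgg; first exact: measurable_snd.
  apply: measurable_funD.
    by apply: measurable_funM => //; exact: measurable_fst.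
  apply: measurable_funN; apply: measurable_funM => //.
  by apply: measurable_funM => //; exact: measurable_snd.
- by move=> x y; rewrite mule_ge0.
apply: eq_integral => u _.
rewrite ge0_integralZl; last 4 first.
- exact: measurableT.
- by apply: mgg => //; apply: measurable_funD => //; exact: measurable_funM.
- by [].
- by rewrite lee_fin.
rewrite (@lebesgue_affine R s^-1%R (- (c * u / s))%R (g u) sV0)//; last exact: mgg.
by rewrite muleA -EFinM invrK -normrM mulVf// normr1 mul1e.
Qed.

Lemma Int_rot (c s : R) i j l f v : (c ^+ 2 + s ^+ 2 = 1)%R -> mfun f ->
  (forall v, 0 <= f v) -> uniq l -> i \in l -> j \in l -> i != j ->
  IntL l (fun v => f (rot c s i j v)) v = IntL l f v.
Proof.
move=> cs mf f0 ul il jl ij.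
have pl : perm_eq l (rem j (rem i l) ++ [:: i; j]).
  apply: (perm_trans (perm_to_rem il)).
  rewrite perm_sym perm_catC /= perm_cons perm_sym; apply: perm_to_rem.
  by rewrite (mem_rem_uniq i ul) inE eq_sym ij.
rewrite [RHS](@Int_perm R I mu l _ f v ul pl)//.
rewrite (@Int_perm R I mu l _ (fun v => f (rot c s i j v)) v ul pl)//; last exact: mfun_rot.
rewrite !Int_cat; apply: eq_Int => v' _ /=.
have := @integral_rot c s (fun x y => f (upd (upd v' i x) j y)) cs.
move=> H; rewrite -H; last 2 first.
- exact: mfun_upd2.
- by move=> x y; exact: f0.
apply: eq_integral => x _; apply: eq_integral => y _; congr f.
apply/funext => k; rewrite /rot /upd (negbTE ij) !eqxx.
by case: (k == j) => //; case: (k == i).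
Qed.


(* Simultaneous plane rotations: sg pairs the coordinates selected by m. *)
Definition rho (m : pred I) (sg : I -> I) (ep : I -> R) (c s : R) v : I -> R :=
  fun i => if m i then (c * v i + ep i * (s * v (sg i)))%R else v i.

Definition pairing (m : pred I) (sg : I -> I) (ep : I -> R) : Prop :=
  forall i, m i -> [/\ m (sg i), sg (sg i) = i, sg i != i,
    ep (sg i) = (- ep i)%R & ep i = 1%R \/ ep i = (-1)%R].

Lemma mfun_rho d (U : measurableType d) m sg ep (c s : R) (f : (I -> R) -> U) :
  mfun f -> mfun (fun v => f (rho m sg ep c s v)).
Proof.
move=> mf d' T phi mphi; apply: mf => k; rewrite /rho.
case: (m k); last exact: mphi.
by apply: measurable_funD; repeat apply: measurable_funM => //.
Qed.

(** The rotated pairs are disjoint, so they are removed from the mask one at a time by [Int_rot];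
    the member of sign -1 serves as first coordinate. *)
Lemma Int_rho m sg ep (c s : R) l f v : (c ^+ 2 + s ^+ 2 = 1)%R ->
  pairing m sg ep -> (forall i, m i -> i \in l) ->
  mfun f -> (forall v, 0 <= f v) -> uniq l ->
  IntL l (fun v => f (rho m sg ep c s v)) v = IntL l f v.
Proof.
move=> cs + + mf f0 ul.
have [n] := ubnP (count m l); elim: n => [//|n IH] in m f mf f0 *.
move=> cm mP ml.
have [/hasP[i0 i0l mi0]|/hasPn nm] := boolP (has m l); last first.
  apply: eq_Int => v' _; congr f; apply/funext => k; rewrite /rho.
  by case: ifP => // mk; have := nm _ (ml _ mk); rewrite mk.
have [i [mi il epi]] : exists i, [/\ m i, i \in l & ep i = (-1)%R].
  have [ms ss si es [e1|e1]] := mP _ mi0; last by exists i0.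
  by exists (sg i0); split=> //; [exact: ml|rewrite es e1].
have [ms ss si es _] := mP _ mi.
pose m' := [pred k | [&& m k, k != i & k != sg i]].
have -> : (fun v => f (rho m sg ep c s v)) =
    (fun v => (fun v => f (rot c s i (sg i) v)) (rho m' sg ep c s v)).
  apply/funext => v'; congr f; apply/funext => k; rewrite /rot /upd {1 3 6}/rho /=.
  have [->|ki] := eqVneq k (sg i).
    by rewrite ms /rho /= eqxx eqxx !andbF ss es epi opprK mul1r addrC.
  have [->|ki'] := eqVneq k i.
    by rewrite mi /rho /= !eqxx !andbF epi mulN1r.
  by rewrite /rho /= ?andbT.
rewrite (IH m' (fun v => f (rot c s i (sg i) v))).
- by apply: Int_rot => //; [exact: ml|rewrite eq_sym].
- exact: mfun_rot.
- by [].
- move: cm; rewrite ltnS; apply: leq_trans; rewrite -!size_filter.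
  have -> : [seq x <- l | m' x] = [seq x <- [seq x <- l | m x] | (x != i) && (x != sg i)].
    by rewrite -filter_predI; apply: eq_filter => x /=; rewrite andbC.
  rewrite size_filter -(count_predC [pred x | (x != i) && (x != sg i)] [seq x <- l | m x]).
  rewrite -addn1 leq_add2l -has_count; apply/hasP; exists i; last by rewrite /= eqxx.
  by rewrite mem_filter mi.
- move=> k /= /and3P[mk ki ksi]; have [h1 h2 h3 h4 h5] := mP _ mk; split=> //.
  rewrite h1 /=; apply/andP; split; first by apply: contraNneq ksi => <-; rewrite h2.
  by apply: contraNneq ki => e; rewrite -h2 e ss.
- by move=> k /= /and3P[mk _ _]; exact: ml.
Qed.

(* A rotation of coordinates that are not integrated commutes with Int. *)
Lemma Int_rho_out m sg ep (c s : R) l f v : pairing m sg ep ->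
  (forall i, m i -> i \notin l) ->
  IntL l f (rho m sg ep c s v) = IntL l (fun v => f (rho m sg ep c s v)) v.
Proof.
move=> mP; elim: l v => [//|i l IH] v ml /=.
apply: eq_integral => x _; rewrite -IH; last first.
  by move=> k /ml; rewrite inE negb_or => /andP[].
congr (IntL _ _ _); apply/funext => k; rewrite /rho /upd.
have [->|ki] := eqVneq k i.
  by case: ifP => // /ml; rewrite mem_head.
case: ifP => // mk; have [ms _ _ _ _] := mP _ mk.
by have [e|//] := eqVneq (sg k) i; have := ml _ ms; rewrite e mem_head.
Qed.

End int_lebesgue.

(** * Names of matrix entries and elementary unitary moves *)

Section tridiagonal.
Local Open Scope ereal_scope.
Context (R : realType).
Notation mu := (@lebesgue_measure R).

(* inl (false, (a, b)) and inl (true, (a, b)), a < b, name the real and imaginary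
   parts of an antisymmetric matrix; inr p is the p-th squared off-diagonal
   entry of its tridiagonal form. *)
Notation nam := ((bool * (nat * nat)) + nat)%type.
Notation env := (nam -> R).
Notation IntL := (@Int R nam mu).
Implicit Types (v w : env) (F : env -> \bar R) (D : pred nat).

Definition nm (be : bool) (a b : nat) : nam := inl (be, (a, b)).

Definition row p m : seq nam :=
  [seq nm be p b | be <- [:: false; true], b <- iota p.+1 m].

Fixpoint rows m p : seq nam :=
  if m is m'.+1 then row p m ++ rows m' p.+1 else [::].

Lemma rowsS m p : rows m.+1 p = row p m.+1 ++ rows m p.+1.
Proof. by []. Qed.

Lemma mem_row p m be a b : (nm be a b \in row p m) = (a == p) && (p < b <= p + m)%N.
Proof.
apply/allpairsP/idP => [[[be' b'] [/= _]]|/andP[/eqP -> h]].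
  by rewrite mem_iota => h [_ -> ->]; rewrite eqxx /=; lia.
exists (be, b); split=> //=; first by case: be.
by rewrite mem_iota; lia.
Qed.

Lemma mem_row_inr p m k : ((inr k : nam) \in row p m) = false.
Proof. by apply/negP => /allpairsP[[be b] [_ _]]. Qed.

Lemma mem_rows m p be a b :
  (nm be a b \in rows m p) = (p <= a)%N && (a < b <= p + m)%N.
Proof.
elim: m p => [|m IH] p; first by rewrite in_nil; lia.
by rewrite rowsS mem_cat mem_row IH; case: eqP => [->|]; lia.
Qed.

Lemma mem_rows_inr m p k : ((inr k : nam) \in rows m p) = false.
Proof. by elim: m p => [//|m IH] p; rewrite rowsS mem_cat mem_row_inr IH. Qed.

Lemma uniq_row p m : uniq (row p m).
Proof.
by apply: allpairs_uniq => //; [exact: iota_uniq|move=> [? ?] [? ?] _ _ [-> ->]].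
Qed.

Lemma uniq_rows m p : uniq (rows m p).
Proof.
elim: m p => [//|m IH] p; rewrite rowsS cat_uniq uniq_row IH andbT /=.
apply/hasPn => -[[be [a b]]|k]; last by rewrite mem_row_inr.
by rewrite -/(nm be a b) mem_rows mem_row; lia.
Qed.

Lemma size_row p m : size (row p m) = m.*2.
Proof. by rewrite size_allpairs size_iota /= mul2n. Qed.

Variable N : nat.

Definition inj (j a : nat) : bool := (a == j) || (a == j.+1).

Definition swp (j a : nat) : nat :=
  if a == j then j.+1 else if a == j.+1 then j else a.

(* t = false: multiplication of row and column j by a unit complex number;
   t = true: real plane rotation of the rows and columns j, j+1. *)
Definition mask (t : bool) j D : pred nam := fun i =>
  if i is inl (be, (a, b)) then
    [&& D a, (a < b <= N)%N & if t then inj j a (+) inj j b else (a == j) || (b == j)]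
  else false.

Definition sgm (t : bool) j (i : nam) : nam :=
  if i is inl (be, (a, b)) then
    if t then nm be (swp j a) (swp j b) else nm (~~ be) a b
  else i.

Definition eps (t : bool) j (i : nam) : R :=
  if i is inl (be, (a, b)) then
    if t then (if (a == j) || (b == j) then -1 else 1)%R
    else (if be then 1 else -1)%R
  else 1%R.

(** A phase pairs the real and imaginary parts of an entry; a rotation pairs entries that differ by
    exchanging j and j+1 in exactly one index, which preserves a < b. *)
Lemma pairing_mask (t : bool) j D : (j + t <= N)%N ->
  (t -> D j = D j.+1) -> pairing (mask t j D) (sgm t j) (eps t j).
Proof.
move=> jN Dj [[be [a b]]|//]; case: t jN Dj => /= jN Dj.
- move/and3P => [Da ab]; rewrite /inj /swp => ex.
  have {}Dj := Dj isT.
  have Dswp : D (if a == j then j.+1 else if a == j.+1 then j else a).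
    by case: eqP Dj Da => [->|_ Dj Da]; [move=> <-|case: eqP Da => [->|//]; rewrite Dj].
  split.
  + by rewrite Dswp /=; move: ab ex; do !case: eqP; lia.
  + congr (nm _ _ _); first by do !case: eqP; lia.
    by do !case: eqP; lia.
  + apply/eqP => -[]; move: ab ex; do !case: eqP; lia.
  + move: ab ex; do !case: eqP => ?; rewrite ?opprK//; lia.
  + by case: ifP => _; [right|left].
- move=> h; split=> //; rewrite ?negbK//.
  + by apply/eqP => -[]; case: be.
  + by case: be; rewrite ?opprK.
  + by case: be; [left|right].
Qed.

End tridiagonal.

(** * Reduction to tridiagonal form *)

Section reduction.
Local Open Scope ereal_scope.
Context (R : realType).
Notation mu := (@lebesgue_measure R).
Notation nam := ((bool * (nat * nat)) + nat)%type.
Notation env := (nam -> R).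
Notation IntL := (@Int R nam mu).
Implicit Types (v w : env) (F f g : env -> \bar R) (D : pred nat).

Lemma nm_eq (be be' : bool) (a a' b b' : nat) :
  (nm be a b == nm be' a' b') = [&& be == be', a == a' & b == b'].
Proof.
by apply/eqP/idP => [[-> -> ->]|/and3P[/eqP-> /eqP-> /eqP->]]; rewrite ?eqxx.
Qed.

Lemma Int_rel (Rel : env -> env -> Prop) s f g v w :
  (forall v w i x, i \in s -> Rel v w -> Rel (upd v i x) (upd w i x)) ->
  (forall v w, Rel v w -> f v = g w) -> Rel v w -> IntL s f v = IntL s g w.
Proof.
elim: s v w => [|i s IH] v w hR fg vw /=; first exact: fg.
apply: eq_integral => x _; apply: IH => //; last by apply: hR => //; exact: mem_head.
by move=> v' w' k y ks; apply: hR; rewrite inE ks orbT.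
Qed.

Variable N : nat.

(** The state in the middle of the reduction: rows before [p] are finished, and their only nonzero
    entry is read off the squared norm stored at [inr a]. *)
Definition trirows p v : env := fun i =>
  if i is inl (be, (a, b)) then
    if (a < p)%N then (if ~~ be && (b == a.+1) then Num.sqrt (v (inr a)) else 0%R)
    else v i
  else v i.

Definition col p q (r : R) v : env := fun i =>
  if i is inl (be, (a, b)) then
    if (a == p) && (q <= b <= N)%N then (if (b == q) && ~~ be then r else 0%R)
    else v i
  else v i.

Definition all_rows : pred nat := predT.

(** Index 0 is excluded from the moves, because it carries the vector, which must not be mixed with
    X. *)
Definition rho_inv F : Prop := forall (t : bool) j (c s : R) v,
  (c ^+ 2 + s ^+ 2 = 1)%R -> (0 < j)%N -> (j + t <= N)%N ->
  F (rho (mask N t j all_rows) (sgm t j) (@eps R t j) c s v) = F v.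

Definition mat_only F : Prop := forall v w,
  (forall be a b, (a < b <= N)%N -> v (nm be a b) = w (nm be a b)) -> F v = F w.

Section step.
Variable F : env -> \bar R.
Hypotheses (Finv : rho_inv F) (Fdep : mat_only F) (mF : mfun F).
Hypothesis F0 : forall v, 0 <= F v.

Lemma mfun_trirows p : mfun (fun v => F (trirows p v)).
Proof.
move=> d T phi mphi; apply: mF => -[[be [a b]]|k] /=; last exact: mphi.
case: (a < p)%N; last exact: mphi.
case: (_ && _); last exact: measurable_cst.
by apply: measurableT_comp => //; apply: continuous_measurable_fun; exact: sqrt_continuous.
Qed.

Lemma swp_ge j a p : (p < j)%N -> (swp j a < p)%N = (a < p)%N.
Proof. by rewrite /swp; do 2?[case: eqP => ?]; lia. Qed.

Lemma swp_eq j a p : (p < j)%N -> (swp j a == p) = (a == p).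
Proof.
move=> pj; rewrite /swp; case: (eqVneq a j) => [->|_]; first by lia.
by case: (eqVneq a j.+1) => [->|_]; lia.
Qed.

(** A finished row a < p has its only nonzero entry in column a+1 <= p < j, so the move does not
    affect it, and the restricted move acts like the full one under which [F] is invariant. *)
Lemma trirows_rho p (t : bool) j (c s : R) v : (c ^+ 2 + s ^+ 2 = 1)%R ->
  (p < j)%N -> (j + t <= N)%N ->
  F (trirows p (rho (mask N t j (leq p)) (sgm t j) (@eps R t j) c s v)) =
  F (trirows p v).
Proof.
move=> cs pj jN; rewrite -[RHS](Finv _ cs (leq_ltn_trans (leq0n p) pj) jN).
congr F; apply/funext => -[[be [a b]]|k] //.
rewrite [in RHS]/rho; case: ifP => h; last first.
  rewrite /trirows /=; case: ifP => // _; rewrite /rho ifF//.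
  by apply: contraFF h => /= /andP[_].
have [ap|pa] := ltnP a p.
  move: h => /= /andP[ab h]; rewrite ap; case: t h jN => /= h jN.
  - have aj : (a == j) = false by lia.
    have aj1 : (a == j.+1) = false by lia.
    rewrite swp_ge// ap; move: h; rewrite /inj aj aj1 /= => h.
    have -> : (b == a.+1) = false by lia.
    have -> : (swp j b == (swp j a).+1) = false.
      by rewrite /swp aj aj1; case/orP: h => /eqP ->; do 2?case: ifP => ?; lia.
    by rewrite !andbF !mulr0 addr0.
  - have -> : (b == a.+1) = false by lia.
    by rewrite ap !andbF !mulr0 addr0.
rewrite /trirows /= ltnNge pa /= /rho /= pa /=.
move: h => /= h; rewrite h; case: t h jN => /= h jN.
  by rewrite swp_ge// ltnNge pa.
by rewrite ltnNge pa.
Qed.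

Definition Phi p m v : \bar R := IntL (rows m p.+1) (fun v => F (trirows p v)) v.

Lemma rho_rho (t : bool) j p (c s : R) v : (p < j)%N ->
  rho (mask N t j (leq p.+1)) (sgm t j) (@eps R t j) c s
    (rho (mask N t j (pred1 p)) (sgm t j) (@eps R t j) c s v) =
  rho (mask N t j (leq p)) (sgm t j) (@eps R t j) c s v.
Proof.
move=> pj; apply/funext => -[[be [a b]]|k] //.
rewrite /rho /=.
have [->|ap] := eqVneq a p.
  by rewrite ltnn leqnn /=; case: ifP.
have -> : (p < a)%N = (p <= a)%N by rewrite ltn_neqAle eq_sym ap.
rewrite andFb; case: ifP => // h.
case: t h => /= h; last by rewrite (negbTE ap).
by rewrite (swp_eq _ pj) (negbTE ap).
Qed.

(** The integral over the later rows absorbs the same move on those rows; combined with the move on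
    row [p], it is a move that [trirows_rho] discards. *)
Lemma Phi_rho p m (t : bool) j (c s : R) v : (p + m.+1 = N)%N ->
  (c ^+ 2 + s ^+ 2 = 1)%R -> (p < j)%N -> (j + t <= N)%N ->
  Phi p m (rho (mask N t j (pred1 p)) (sgm t j) (@eps R t j) c s v) = Phi p m v.
Proof.
move=> pm cs pj jN; rewrite /Phi.
have P1 : pairing (mask N t j (leq p.+1)) (sgm t j) (@eps R t j).
  by apply: pairing_mask => // _; lia.
have P2 : pairing (mask N t j (pred1 p)) (sgm t j) (@eps R t j).
  by apply: pairing_mask => // _ /=; lia.
rewrite -[LHS](@Int_rho R _ _ _ _ c s _ _ _ cs P1); last 4 first.
- move=> [[be [a b]]|//] /= /and3P[pa /andP[ab bN] _].
  by rewrite -/(nm be a b) mem_rows; lia.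
- exact: mfun_trirows.
- by move=> w; exact: F0.
- exact: uniq_rows.
rewrite (@Int_rho_out R _ _ _ _ c s _ (fun v => F (trirows p
   (rho (mask N t j (leq p.+1)) (sgm t j) (@eps R t j) c s v))) v P2); last first.
  move=> [[be [a b]]|//] /= /andP[/eqP -> _].
  by rewrite -/(nm be p b) mem_rows ltnn.
congr (IntL _ _ _); apply/funext => w; rewrite rho_rho//.
exact: trirows_rho.
Qed.

Definition sq2 p b v : R := (v (nm false p b) ^+ 2 + v (nm true p b) ^+ 2)%R.

Lemma rotation_exists (a b : R) : exists c s : R,
  [/\ c ^+ 2 + s ^+ 2 = 1, c * a - s * b = Num.sqrt (a ^+ 2 + b ^+ 2) &
      s * a + c * b = 0]%R.
Proof.
have s0 : (0 <= a ^+ 2 + b ^+ 2)%R by rewrite addr_ge0// sqr_ge0.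
set r := Num.sqrt _; have rr : (r ^+ 2 = a ^+ 2 + b ^+ 2)%R by rewrite sqr_sqrtr.
have [r0|r0] := eqVneq r 0%R.
  move: rr; rewrite r0 expr0n /= => /esym/eqP.
  rewrite paddr_eq0 ?sqr_ge0// !sqrf_eq0 => /andP[/eqP -> /eqP ->].
  by exists 1%R, 0%R; split; ring.
exists (a / r)%R, (- (b / r))%R; split.
- have -> : ((a / r) ^+ 2 + (- (b / r)) ^+ 2 = (a ^+ 2 + b ^+ 2) / r ^+ 2)%R by field.
  by rewrite -rr divff// sqrf_eq0.
- have -> : (a / r * a - - (b / r) * b = (a ^+ 2 + b ^+ 2) / r)%R by field.
  by rewrite -rr expr2 mulfK.
- by field.
Qed.

Lemma Phi_phase p m b v : (p + m.+1 = N)%N -> (p < b <= N)%N ->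
  Phi p m (fun i => if i == nm false p b then Num.sqrt (sq2 p b v)
                    else if i == nm true p b then 0%R else v i) = Phi p m v.
Proof.
move=> pm pb.
have [c [s [cs h1 h2]]] := rotation_exists (v (nm false p b)) (v (nm true p b)).
rewrite -(@Phi_rho p m false b c s v pm cs); [|lia|lia].
congr (Phi _ _ _); apply/funext => -[[be [a b']]|k] //.
rewrite -/(nm be a b') !nm_eq /rho /=.
have [->|ap] := eqVneq a p; last by rewrite !andbF.
have [->|b'b] := eqVneq b' b; last first.
  rewrite !andbF orbF; have -> : (p == b) = false by lia.
  by rewrite andbF.
have -> /= : (p < b <= N)%N && ((p == b) || true) = true by rewrite pb orbT.
case: be => /=; first by rewrite mul1r addrC h2.
by rewrite mulN1r h1.
Qed.

Lemma Phi_givens p m b r v : (p + m.+1 = N)%N -> (p < b)%N -> (b < N)%N ->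
  v (nm true p b) = 0%R ->
  Phi p m (col p b (Num.sqrt (v (nm false p b) ^+ 2 + r ^+ 2)%R) v) =
  Phi p m (col p b.+1 r v).
Proof.
move=> pm pb bN vt0; set w := col p b.+1 r v.
have [c [s [cs h1 h2]]] := rotation_exists (v (nm false p b)) r.
rewrite -(@Phi_rho p m true b c s w pm cs); [|lia|lia].
congr (Phi _ _ _); apply/funext => -[[be [a b']]|k] //.
rewrite /rho /= /nm /w /= /inj.
have [->|ap] := eqVneq a p; last by [].
have -> : swp b p = p by rewrite /swp; do !case: eqP => ?; lia.
rewrite eqxx /=.
have [pb0 pb1] : (p == b) = false /\ (p == b.+1) = false by split; lia.
rewrite pb0 pb1 /=.
have swpl : swp b b = b.+1 by rewrite /swp eqxx.
have swpr : swp b b.+1 = b by rewrite /swp eqxx gtn_eqF.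
have [->|b'b] := eqVneq b' b.
  rewrite swpl leqnn ltnn (ltnW bN) bN pb eqxx /=.
  by rewrite ltnSn /=; case: be => /=; [rewrite vt0; ring|rewrite mulN1r h1].
have [->|b'b1] := eqVneq b' b.+1.
  rewrite swpr leqnn ?leqnSn ?bN ltnn (leq_trans pb (leqnSn b)) /=.
  by case: be => /=; [rewrite vt0; ring|rewrite mul1r addrC h2].
rewrite andbF; have -> : (b <= b')%N = (b < b')%N by rewrite ltn_neqAle eq_sym b'b.
by [].
Qed.

End step.
End reduction.

Section reduction_thm.
Local Open Scope ereal_scope.
Context (R : realType).
Notation mu := (@lebesgue_measure R).
Notation nam := ((bool * (nat * nat)) + nat)%type.
Notation env := (nam -> R).
Notation IntL := (@Int R nam mu).
Implicit Types (v w : env) (F f g : env -> \bar R).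
Variable N : nat.

Section step.
Variable F : env -> \bar R.
Hypotheses (Finv : rho_inv N F) (Fdep : mat_only N F) (mF : mfun F).
Hypothesis F0 : forall v, 0 <= F v.

(** Descending induction on the column: a phase makes entry [q] real and nonnegative, then a Givens
    rotation folds into it the norm accumulated from the later entries. *)
Lemma Phi_col p m q k v : (p + m.+1 = N)%N -> (p < q)%N -> (q + k = N)%N ->
  Phi F p m v =
  Phi F p m (col N p q (Num.sqrt (\sum_(q <= b < N.+1) sq2 p b v)%R) v).
Proof.
move=> pm; elim: k q => [|k IH] q pq qN.
  rewrite addn0 in qN; rewrite qN big_nat1.
  rewrite -(@Phi_phase _ N F Finv mF F0 p m N v pm); last by lia.
  congr (Phi _ _ _ _); apply/funext => -[[be [a b]]|k] //.
  rewrite -/(nm be a b) !nm_eq /=; case: (eqVneq a p) => [->|]; last by rewrite !andbF.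
  rewrite -eqn_leq eq_sym; case: (eqVneq b N) => [->|]; last by rewrite !andbF.
  by rewrite ?eqxx; case: be.
rewrite (IH q.+1); [|lia|lia].
set r := Num.sqrt _; set w := col _ _ _ _ _.
pose v' : env := fun i => if i == nm false p q then Num.sqrt (sq2 p q v)
                    else if i == nm true p q then 0%R else v i.
rewrite -(@Phi_phase _ N F Finv mF F0 p m q w pm); last by lia.
have nq : (q < q)%N = false by rewrite ltnn.
have sw : sq2 p q w = sq2 p q v by rewrite /sq2 /w /= eqxx nq.
rewrite sw.
transitivity (Phi F p m (col N p q.+1 r v')).
  congr (Phi _ _ _ _); apply/funext => -[[be [a b]]|l] //.
  rewrite /w /v' /= -/(nm be a b) !nm_eq.
  case: (eqVneq a p) => [->|]; last by rewrite !andbF.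
  case: (eqVneq b q) => [->|]; last by rewrite !andbF.
  by rewrite nq /=.
rewrite -(@Phi_givens _ N F Finv mF F0 p m q r v' pm pq); last 2 first.
- by lia.
- by rewrite /v' !nm_eq /= !eqxx.
have -> : v' (nm false p q) = Num.sqrt (sq2 p q v) by rewrite /v' eqxx.
have s0 b : (0 <= sq2 p b v)%R by rewrite addr_ge0// sqr_ge0.
rewrite /r !sqr_sqrtr//; last by apply: sumr_ge0.
rewrite -big_ltn; last by lia.
congr (Phi _ _ _ _); apply/funext => -[[be [a b]]|l] //.
rewrite /v' /= -/(nm be a b) !nm_eq.
case: (eqVneq a p) => [->|]; last by rewrite !andbF.
case: (eqVneq b q) => [->|]; last by rewrite !andbF.
by have -> : (q <= q <= N)%N by lia.
Qed.

Lemma sum_row p m v : (p + m.+1 = N)%N ->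
  (\sum_(i <- row p m.+1) v i ^+ 2 = \sum_(p.+1 <= b < N.+1) sq2 p b v)%R.
Proof.
move=> pm; rewrite /row big_allpairs_dep big_cons big_seq1 /sq2 big_split.
by rewrite /index_iota; have -> : (N.+1 - p.+1 = m.+1)%N by lia.
Qed.

Lemma upd_nm v (be be' : bool) (a a' b b' : nat) x :
  upd v (nm be' a' b') x (nm be a b) =
  if [&& be == be', a == a' & b == b'] then x else v (nm be a b).
Proof. by rewrite /upd nm_eq. Qed.

(** For q = p+1 the concentrated row is the one that [trirows] builds from the squared norm stored
    at [inr p]; so row [p] matters only through its norm. *)
Lemma Phi_tri p m v : (p + m.+1 = N)%N ->
  Phi F p m v = IntL (rows m p.+1) (fun v => F (trirows p.+1 v))
    (upd v (inr p) (\sum_(i <- row p m.+1) v i ^+ 2)%R).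
Proof.
move=> pm; rewrite (sum_row _ pm) (@Phi_col p m p.+1 m v pm); [|lia|lia].
set S := (\sum_(_ <= _ < _) _)%R.
apply: (@Int_rel R (fun a b => forall be x y, (x < y <= N)%N ->
  trirows p a (nm be x y) = trirows p.+1 b (nm be x y))).
- move=> a b [[be' [a' b']]|k]; last by rewrite mem_rows_inr.
  rewrite -/(nm be' a' b') mem_rows => z /andP[pa' _] ab be x y xy.
  have := ab be x y xy; rewrite /trirows /=.
  case: (ltnP x p) => xp.
    by rewrite (ltn_trans xp (ltnSn p)).
  case: (ltnP x p.+1) => xp1; last by rewrite -/(nm be x y) !upd_nm; case: ifP.
  by rewrite -/(nm be x y) upd_nm (_ : (x == a') = false) ?andbF//; lia.
- by move=> a b ab; apply: Fdep => be x y xy; exact: ab.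
- move=> be x y xy; rewrite /trirows /=.
  case: (ltnP x p) => xp.
    rewrite (ltn_trans xp (ltnSn p)) /upd.
    by have -> : ((inr x : nam) == inr p) = false by apply/eqP => -[]; lia.
  case: (ltnP x p.+1) => xp1.
    have -> : x = p by lia.
    rewrite eqxx /upd eqxx.
    have -> : (p < y <= N)%N by lia.
    by rewrite andbC.
  by have -> : (x == p) = false by lia.
Qed.

Lemma Int_tri_row p m v w r : (p + m.+1 = N)%N ->
  (forall i, i \notin row p m.+1 -> v i = w i) ->
  IntL (rows m p.+1) (fun v => F (trirows p.+1 v)) (upd v (inr p) r) =
  IntL (rows m p.+1) (fun v => F (trirows p.+1 v)) (upd w (inr p) r).
Proof.
move=> pm vw.
apply: (@Int_rel R (fun a b => forall i, i \notin row p m.+1 -> a i = b i)).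
- by move=> a b i x _ ab k kr; rewrite /upd; case: ifP => // _; exact: ab.
- move=> a b ab; apply: Fdep => be x y xy; rewrite /trirows /=.
  case: (ltnP x p.+1) => xp.
    by rewrite ab// mem_row_inr.
  by apply: ab; rewrite -/(nm be x y) mem_row; lia.
- by move=> i ir; rewrite /upd; case: ifP => // _; exact: vw.
Qed.

End step.

Definition hs m p : seq nam := [seq inr k | k <- iota p m].

Lemma measurable_wt n d (T : measurableType d) (phi : T -> seq R) :
  mseq n phi -> measurable_fun setT (fun t => wt (phi t)).
Proof.
elim: n phi => [|n IH] phi mphi.
  rewrite (_ : (fun _ => _) = cst 1%R); first exact: measurable_cst.
  by apply/funext => t; rewrite (size0nil (mphi.1 t)).
rewrite (_ : (fun _ => _) = (fun t => (0 < head 0 (phi t))%R%:R *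
    head 0 (phi t) ^+ n * wt (behead (phi t)))%R).
  apply: measurable_funM; last by apply: IH; exact: mseq_behead.
  apply: measurable_funM; last by apply: measurable_funX; exact: measurable_head mphi.
  apply: measurable_natbool; apply: measurable_fun_ltr => //.
  exact: measurable_head mphi.
by apply/funext => t; case: (phi t) (mphi.1 t) => [//|x s] /= [->].
Qed.

Lemma wt_ge0 (s : seq R) : (0 <= wt s)%R.
Proof.
elim: s => [|x s IH] /=; first exact: ler01.
case: (ltrP 0%R x) => x0; last by rewrite !mul0r.
by rewrite mul1r mulr_ge0// exprn_ge0// ltW.
Qed.

(** Row by row: by [Phi_tri] the integral over the later rows is radial in row [p], and [Int_radial]
    replaces the 2(m+1) real coordinates of that row by one variable of density r^m. These powers
    accumulate in [wt]. *)
Theorem tri_reduction m p : (p + m = N)%N -> exists2 c : \bar R, 0 <= c &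
  forall F v, rho_inv N F -> mat_only N F -> mfun F -> (forall v, 0 <= F v) ->
  IntL (rows m p) (fun v => F (trirows p v)) v =
  c * IntL (hs m p)
    (fun v => (wt [seq v i | i <- hs m p])%:E * F (trirows N v)) v.
Proof.
elim: m p => [|m IH] p pm.
  exists 1 => // F v _ _ _ _; rewrite /= !mul1e.
  by rewrite addn0 in pm; rewrite pm.
have [c1 c10 H1] := Int_radial R nam m.
have [c2 c20 H2] := IH p.+1 (etrans (addSnnS p m) pm).
exists (c1 * c2); first exact: mule_ge0.
move=> F v Finv Fdep mF F0.
have mG : mfun (fun v => F (trirows p.+1 v)) by exact: mfun_trirows.
have mI := @mfun_Int _ _ mu (rows m p.+1) _ mG (fun v => F0 _).
pose phi r := IntL (rows m p.+1) (fun v => F (trirows p.+1 v)) (upd v (inr p) r).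
have mphi : measurable_fun setT phi by exact: (mfun_upd1 v (inr p) mI).
have phi0 r : 0 <= phi r by exact: Int_ge0.
rewrite rowsS Int_cat.
transitivity (IntL (row p m.+1) (fun w => phi (\sum_(i <- row p m.+1) w i ^+ 2)%R) v).
  apply: eq_Int => w wE; rewrite -/(Phi F p m w) (Phi_tri Finv Fdep mF F0 _ pm).
  exact: Int_tri_row.
rewrite H1//; [|exact: uniq_row|exact: size_row].
rewrite -muleA; congr (_ * _).
have mwt q k : mfun (fun v : env => (wt [seq v i | i <- hs k q])%:E * F (trirows N v)).
  move=> d T psi mpsi; apply: emeasurable_funM; last exact: (@mfun_trirows R F mF N d T psi mpsi).
  apply/measurable_EFinP; apply: (@measurable_wt k); split=> [t|i].
    by rewrite !size_map size_iota.
  have [mi|im] := leqP k i.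
    rewrite (_ : (fun _ => _) = cst 0%R); first exact: measurable_cst.
    by apply/funext => t; rewrite nth_default// !size_map size_iota.
  rewrite (_ : (fun _ => _) = (fun t => psi (inr (q + i)%N) t)); first exact: mpsi.
  apply/funext => t; rewrite (nth_map (inr 0%N)) ?size_map ?size_iota//.
  by rewrite (nth_map 0%N) ?size_iota// nth_iota.
have W0 q k w : 0 <= (wt [seq w i | i <- hs k q])%:E * F (trirows N w).
  by rewrite mule_ge0// lee_fin wt_ge0.
have pow0 (r : R) : (0 <= (0 < r)%R%:R * r ^+ m)%R.
  by case: (ltrP 0%R r) => r0; rewrite ?mul0r// mul1r exprn_ge0// ltW.
pose G (w : env) := (wt [seq w i | i <- hs m.+1 p])%:E * F (trirows N w).
transitivity (c2 * \int[mu]_x IntL (hs m p.+1) G (upd v (inr p) x)); last by [].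
rewrite -ge0_integralZl; last 4 first.
- exact: measurableT.
- by apply: (mfun_upd1 v (inr p)); apply: mfun_Int => [|w]; [exact: mwt|exact: W0].
- by move=> x _; apply: Int_ge0 => w; exact: W0.
- exact: c20.
apply: eq_integral => r _; rewrite /phi H2//.
rewrite muleCA; congr (_ * _).
rewrite -Int_Zl//; last by rewrite lee_fin.
apply: eq_Int => w wE; rewrite /G /hs /= -/(hs m p.+1) muleA -EFinM.
have -> : w (inr p) = r.
  rewrite wE ?upd_eq//; apply/mapP => -[k]; rewrite mem_iota => + [pk].
  by rewrite pk ltnn.
by rewrite !size_map size_iota.
Qed.

End reduction_thm.

(** * Unitary congruence and the spectrum of M *)

Section two_term_rows.
Variables (C : comRingType) (N : nat) (d e : 'I_N -> C) (sg : 'I_N -> 'I_N).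

Definition twist : 'M[C]_N :=
  \matrix_(i, k) (d i *+ (k == i) + e i *+ (k == sg i)).

Lemma sum_delta p (x : C) (A : 'M[C]_(N, p)) i j :
  \sum_k (x *+ (k == i)) * A k j = x * A i j.
Proof.
rewrite (bigD1 i)//= eqxx mulr1n big1 ?addr0// => k /negbTE ki.
by rewrite ki mulr0n mul0r.
Qed.

Lemma mul_twist p (A : 'M[C]_(N, p)) i j :
  (twist *m A) i j = d i * A i j + e i * A (sg i) j.
Proof.
rewrite mxE -2!sum_delta -big_split/=; apply: eq_bigr => k _.
by rewrite mxE mulrDl.
Qed.

Lemma mul_trtwist p (A : 'M[C]_(p, N)) i j :
  (A *m twist^T) j i = d i * A j i + e i * A j (sg i).
Proof.
have -> : (A *m twist^T) j i = ((A *m twist^T)^T) i j by rewrite [RHS]mxE.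
by rewrite trmx_mul trmxK mul_twist !mxE.
Qed.

End two_term_rows.

Lemma char_poly_similar (C : comNzRingType) N (P Q A : 'M[C]_N) :
  P *m Q = 1%:M -> char_poly (P *m A *m Q) = char_poly A.
Proof.
move=> PQ; rewrite /char_poly.
have -> : char_poly_mx (P *m A *m Q) =
    map_mx (@polyC C) P *m char_poly_mx A *m map_mx (@polyC C) Q.
  rewrite /char_poly_mx !map_mxM mulmxBr mulmxBl; congr (_ - _).
  by rewrite scalar_mxC -mulmxA -map_mxM PQ map_mx1 mulmx1.
rewrite !det_mulmx mulrAC -det_mulmx -map_mxM PQ map_mx1 det1 mul1r //.
Qed.

Section antisymmetric.
Context (R : realType).
Notation C := R[i].
Notation nam := ((bool * (nat * nat)) + nat)%type.
Notation env := (nam -> R).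
Implicit Types (v : env).
Local Open Scope complex_scope.

Definition cx v a b : C := v (nm false a b) +i* v (nm true a b).

Definition ant v a b : C :=
  if (a < b)%N then cx v a b else if (b < a)%N then - cx v b a else 0.

Lemma antC v a b : ant v b a = - ant v a b.
Proof. by rewrite /ant; case: ltngtP => _; rewrite ?opprK ?oppr0. Qed.

Lemma antaa v a : ant v a a = 0.
Proof. by rewrite /ant ltnn. Qed.

(** With [ee], the entries of the unitary matrix G of a move: row [a] has [dd] on the diagonal and
    [ee] in column [swp j a]. *)
Definition dd (t : bool) j (c s : R) a : C :=
  if t then (if inj j a then c%:C else 1) else (if a == j then c +i* s else 1).

Definition ee (t : bool) j (s : R) a : C :=
  if t then (if a == j then (- s)%:C else if a == j.+1 then s%:C else 0) else 0.

Variable N : nat.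

Lemma complexP (x y : C) : complex.Re x = complex.Re y ->
  complex.Im x = complex.Im y -> x = y.
Proof. by case: x y => [a b] [a' b'] /= -> ->. Qed.

Lemma ant_lt v a b : (a < b)%N -> ant v a b = cx v a b.
Proof. by rewrite /ant => ->. Qed.

(** The entrywise form of A -> G A G^T. Antisymmetry reduces it to a < b; a rotation multiplies the
    entry (j, j+1) by c^2 + s^2 = 1, which is why that entry lies outside the mask. *)
Lemma ant_rho (t : bool) j (c s : R) v a b : (c ^+ 2 + s ^+ 2 = 1)%R ->
  (j + t <= N)%N -> (a <= N)%N -> (b <= N)%N ->
  ant (rho (mask N t j all_rows) (sgm t j) (@eps R t j) c s v) a b =
  dd t j c s a * (dd t j c s b * ant v a b + ee t j s b * ant v a (swp j b)) +
  ee t j s a * (dd t j c s b * ant v (swp j a) b + ee t j s b * ant v (swp j a) (swp j b)).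
Proof.
move=> cs jN; wlog ab : a b / (a < b)%N.
  move=> H aN bN; have [ab|ba|->] := ltngtP a b; first exact: H.
    rewrite antC H// ?(ltnW ba)// (antC v a b) (antC v (swp j a) b) (antC v (swp j b) a).
    by rewrite (antC v (swp j a) (swp j b)); ring.
  rewrite !antaa (antC v (swp j b) b); ring.
move=> aN bN; rewrite ant_lt// /cx /rho /= ab bN /=.
case: t jN => /= jN; last first.
  rewrite /dd /ee /= !mul0r !addr0 ant_lt//.
  case: (eqVneq a j) ab aN => [->|aj] ab aN; case: (eqVneq b j) ab bN => [->|bj] ab bN /=.
  - by rewrite ltnn in ab.
  - by rewrite mul1r; apply: complexP => /=; ring.
  - by rewrite mul1r; apply: complexP => /=; ring.
  - by rewrite !mul1r.
have swpj : swp j j = j.+1 by rewrite /swp eqxx.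
have swpj1 : swp j j.+1 = j by rewrite /swp eqxx gtn_eqF.

have swpo k : k != j -> k != j.+1 -> swp j k = k by rewrite /swp => /negbTE-> /negbTE->.
have inj0 : inj j j by rewrite /inj eqxx.
have inj1 : inj j j.+1 by rewrite /inj eqxx orbT.
have injo k : k != j -> k != j.+1 -> inj j k = false by rewrite /inj => /negbTE-> /negbTE->.
rewrite /dd /ee.
case: (eqVneq a j) ab aN => [->|aj] ab aN.
  rewrite swpj inj0 /=; case: (eqVneq b j) ab bN => [->|bj] ab bN.
    by rewrite ltnn in ab.
  case: (eqVneq b j.+1) ab bN bj => [->|bj1] ab bN bj.
    rewrite inj1 swpj1 !antaa ant_lt// (antC v j j.+1) ant_lt//=.
    have cs' : c%:C * c%:C + s%:C * s%:C = 1 :> C.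
      by apply: complexP => /=; rewrite -?cs; ring.
    rewrite -[LHS]mul1r -/(cx v j j.+1) -cs'; apply: complexP => /=; ring.
  have jb : (j.+1 < b)%N by rewrite ltn_neqAle eq_sym bj1.
  rewrite (injo _ bj bj1) (swpo _ bj bj1) !ant_lt//=.
  by apply: complexP => /=; ring.
case: (eqVneq a j.+1) ab aN aj => [->|aj1] ab aN aj.
  have bj : b != j by lia.
  have bj1 : b != j.+1 by lia.
  have jb : (j < b)%N by lia.
  rewrite swpj1 inj1 (injo _ bj bj1) (swpo _ bj bj1) (negbTE bj) (negbTE bj1) /=.
  by rewrite !ant_lt//; apply: complexP => /=; ring.
rewrite (injo _ aj aj1) (swpo _ aj aj1) /=.
case: (eqVneq b j) ab bN => [->|bj] ab bN.
  rewrite swpj inj0 /= !ant_lt ?(ltnW ab)//; last exact: leqW.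
  by apply: complexP => /=; ring.
case: (eqVneq b j.+1) ab bN bj => [->|bj1] ab bN bj.
  have aj' : (a < j)%N by rewrite ltn_neqAle aj -ltnS.
  rewrite swpj1 inj1 /= !ant_lt//.
  by apply: complexP => /=; ring.
rewrite (injo _ bj bj1) (swpo _ bj bj1) /= ant_lt//.
by apply: complexP => /=; ring.
Qed.

Lemma dd_ee_unitary j (c s : R) a b : (c ^+ 2 + s ^+ 2 = 1)%R ->
  dd true j c s b * conjc (dd true j c s a *+ (b == a) + ee true j s a *+ (b == swp j a)) +
  ee true j s b *
    conjc (dd true j c s a *+ (swp j b == a) + ee true j s a *+ (swp j b == swp j a)) =
  (a == b)%:R.
Proof.
move=> cs; rewrite /dd /ee /inj /swp.
have n1 : (j.+1 == j) = false by rewrite gtn_eqF.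
have n2 : (j == j.+1) = false by rewrite ltn_eqF.
have nn (k l : nat) : k != l -> (l == k) = false by move=> kl; rewrite eq_sym (negbTE kl).
have cs' x : x = c ^+ 2 + s ^+ 2 -> x = 1 by move=> ->.
case: (eqVneq a j) => [ea|aj]; last case: (eqVneq a j.+1) => [ea|aj1];
  (case: (eqVneq b j) => [eb|bj]; last case: (eqVneq b j.+1) => [eb|bj1]);
  rewrite ?ea ?eb;
  repeat match goal with H : is_true (_ != _) |- _ =>
    move: (negbTE H) (nn _ _ H) => {H} ? ? end;
  repeat match goal with H : (_ == _) = false |- _ => rewrite ?H; move: H => _ end;
  rewrite ?eqxx /= ?mulr0n ?mulr1n
    ?addr0 ?add0r ?mul0r ?rmorph0 ?rmorph1 ?mulr0 ?add0r;
  try by apply: complexP => /=; rewrite -?cs; ring.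
by rewrite mul0rn !addr0 mul1r rmorph_nat eq_sym.
Qed.

Definition Bm v : 'M[C]_N := \matrix_(i, k) ant v i.+1 k.+1.
Definition rv v : 'rV[C]_N := \row_k ant v 0 k.+1.
Definition Mm (b : R) v : 'M[C]_N :=
  adjmx (Bm v) *m Bm v + b%:C *: (adjmx (rv v) *m rv v).

Lemma adjmxM m n p (A : 'M[C]_(m, n)) (B : 'M[C]_(n, p)) :
  adjmx (A *m B) = adjmx B *m adjmx A.
Proof. by rewrite /adjmx trmx_mul map_mxM. Qed.

Lemma adjmxK m n (A : 'M[C]_(m, n)) : adjmx (adjmx A) = A.
Proof. by apply/matrixP => i k; rewrite !mxE conjcK. Qed.

(** Since G fixes index 0, the block becomes G B G^T and the row becomes r G^T, so M is conjugated
    by the unitary matrix G^T. *)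
Lemma char_poly_rho b (t : bool) j (c s : R) v : (c ^+ 2 + s ^+ 2 = 1)%R ->
  (0 < j)%N -> (j + t <= N)%N ->
  char_poly (Mm b (rho (mask N t j all_rows) (sgm t j) (@eps R t j) c s v)) =
  char_poly (Mm b v).
Proof.
move=> cs j0 jN; set w := rho _ _ _ _ _ _.
pose d (i : 'I_N) := dd t j c s i.+1.
pose e (i : 'I_N) := ee t j s i.+1.
(* The exchange of j and j+1 preserves 1, ..., N because 0 < j and j + t <= N, so the default of
   [insubd] is never taken. *)
pose sg (i : 'I_N) : 'I_N := insubd i (if t then (swp j i.+1).-1 else i).
have sgE (i : 'I_N) : t -> (sg i).+1 = swp j i.+1.
  move=> tt; rewrite /sg tt val_insubd /swp; move: (ltn_ord i) jN; rewrite tt.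
  by case: eqP; [|case: eqP]; case: ifP; lia.
have esg (i : 'I_N) (X : nat -> C) : e i * X (sg i).+1 = e i * X (swp j i.+1).
  by case: (boolP t) => tt; [rewrite sgE|rewrite /e /ee (negbTE tt) !mul0r].
pose G := twist d e sg.
have BE : Bm w = G *m Bm v *m G^T.
  apply/matrixP => i k; rewrite mul_trtwist !mul_twist !mxE.
  rewrite ant_rho ?ltn_ord// -/(d _) -/(d _) -/(e _) -/(e _).
  have /= X1 := esg i (fun a => ant v a k.+1).
  have /= X2 := esg k (fun a => ant v i.+1 a).
  have /= X3 := esg i (fun a => e k * ant v a (sg k).+1).
  have /= X4 := congr1 ( *%R (e i)) (esg k (fun a => ant v (swp j i.+1) a)).
  transitivity (d i * d k * ant v i.+1 k.+1 + d i * (e k * ant v i.+1 (swp j k.+1))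
    + d k * (e i * ant v (swp j i.+1) k.+1)
    + e i * (e k * ant v (swp j i.+1) (swp j k.+1))); first by ring.
  by rewrite -X1 -X2 -X4 -X3; ring.
have rE : rv w = rv v *m G^T.
  apply/matrixP => i k; rewrite mul_trtwist !mxE ant_rho ?ltn_ord//.
  rewrite -/(d _) -/(e _) -(esg k (fun a => ant v 0 a)).
  have -> : dd t j c s 0 = 1.
    rewrite /dd /inj; case: ifP => _; first by rewrite ltn_eqF ?(ltnW j0).
    by rewrite ltn_eqF.
  have -> : ee t j s 0 = 0.
    by rewrite /ee; case: ifP => // _; rewrite !ltn_eqF ?ltnS ?(ltnW j0).
  by rewrite mul0r addr0 mul1r.
have GG : adjmx G^T *m G^T = 1%:M.
  apply/matrixP => i k; rewrite mul_trtwist !mxE.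
  have sgv (l m : 'I_N) : (l == m) = (l.+1 == m.+1) by rewrite eqSS.
  case: (boolP t) => tt; last first.
    have e0 l : e l = 0 by rewrite /e /ee (negbTE tt).
    rewrite !e0 mul0r addr0 mul0rn addr0 eq_sym; case: eqVneq => [->|_]; last first.
      by rewrite mulr0n rmorph0 mulr0.
    rewrite mulr1n /d /dd (negbTE tt); case: ifP => _; last by rewrite rmorph1 mulr1.
    by apply: complexP => /=; rewrite -?cs; ring.
  rewrite /d /e tt !sgv !sgE//.
  exact: dd_ee_unitary.
have -> : Mm b w = adjmx G^T *m Mm b v *m G^T.
  rewrite /Mm BE rE !adjmxM mulmxDr mulmxDl -scalemxAr -scalemxAl !mulmxA.
  suff aG : adjmx G *m G = 1%:M by rewrite -(mulmxA _ (adjmx G)) aG mulmx1.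
  apply: mulmx1C; have := congr1 trmx GG.
  rewrite trmx_mul trmxK trmx1 => <-; congr (_ *m _).
  by apply/matrixP => i k; rewrite !mxE.
exact: (char_poly_similar _ GG).
Qed.

End antisymmetric.

(** The change of a square is opposite to the change at its partner, so the total change S satisfies
    S = -S. *)
Lemma sum_rho (R : realType) (I : eqType) (m : pred I) sg (ep : I -> R) (c s : R) l v :
  c ^+ 2 + s ^+ 2 = 1 -> pairing m sg ep -> (forall i, m i -> i \in l) -> uniq l ->
  \sum_(i <- l) rho m sg ep c s v i ^+ 2 = \sum_(i <- l) v i ^+ 2.
Proof.
move=> cs mP ml ul; apply/eqP; rewrite -subr_eq0 -sumrB; apply/eqP.
rewrite (bigID m)/= [X in _ + X]big1 ?addr0 => [|i /negbTE mi]; last first.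
  by rewrite /rho mi subrr.
set D := BIG_F; set S := LHS.
have DN i : m i -> D (sg i) = - D i.
  move=> mi; have [ms ss _ es ei] := mP _ mi.
  rewrite /D /rho ms mi ss es.
  have e2 : ep i ^+ 2 = 1 by case: ei => ->; ring.
  have c2 : c ^+ 2 = 1 - s ^+ 2 by rewrite -cs; ring.
  transitivity (c ^+ 2 * v (sg i) ^+ 2 - 2 * c * ep i * s * v i * v (sg i) +
    ep i ^+ 2 * s ^+ 2 * v i ^+ 2 - v (sg i) ^+ 2); first by ring.
  transitivity (- (c ^+ 2 * v i ^+ 2 + 2 * c * ep i * s * v i * v (sg i) +
    ep i ^+ 2 * s ^+ 2 * v (sg i) ^+ 2 - v i ^+ 2)); last by ring.
  by rewrite e2 c2; ring.
have SN : S = - S.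
  rewrite /S -sumrN -big_filter -[RHS]big_filter.
  have -> : \sum_(i <- [seq i <- l | m i]) D i =
      \sum_(i <- [seq sg i | i <- [seq i <- l | m i]]) D i.
    apply: perm_big; apply: uniq_perm.
    - exact: filter_uniq.
    - rewrite map_inj_in_uniq ?filter_uniq// => i k; rewrite !mem_filter.
      move=> /andP[/mP[_ si _ _ _] _] /andP[/mP[_ sk _ _ _] _] e.
      by rewrite -si e sk.
    - move=> i; rewrite mem_filter; apply/andP/mapP => [[mi il]|[k + ->]].
        have [ms ss _ _ _] := mP _ mi.
        by exists (sg i); rewrite ?ss// mem_filter ms ml.
      by rewrite mem_filter => /andP[/mP[ms _ _ _ _] _]; rewrite ms ml.
  rewrite big_map big_seq [RHS]big_seq; apply: eq_bigr => i.
  by rewrite mem_filter => /andP[mi _]; exact: DN.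
by move: SN; lra.
Qed.

(** * Characteristic polynomials of the tridiagonal form *)

Section tridiagonal_det.
Context (R : realType).
Implicit Types x : nat -> R.

Lemma det_tridiagonal (C : comNzRingType) N (A : 'M[C]_N.+2) :
  (forall j : 'I_N.+2, (1 < j)%N -> A ord0 j = 0) ->
  (forall i : 'I_N.+2, (1 < i)%N -> A i ord0 = 0) ->
  \det A = A ord0 ord0 * \det (row' ord0 (col' ord0 A)) -
    A ord0 (lift ord0 ord0) * A (lift ord0 ord0) ord0 *
      \det (row' ord0 (col' ord0 (row' ord0 (col' ord0 A)))).
Proof.
move=> A0 A1; rewrite (expand_det_row _ ord0) !big_ord_recl big1 => [|j _]; last first.
  by rewrite A0 ?mul0r.
rewrite addr0 /cofactor !addn0 expr0 mul1r; congr (_ + _).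
rewrite /= expr1 mulN1r mulrN -mulrA; congr (- (_ * _)).
rewrite (expand_det_col _ ord0) big_ord_recl big1 => [|i _]; last first.
  rewrite !mxE; rewrite [A _ _](_ : _ = 0) ?mul0r//.
  by rewrite -[RHS](A1 (lift ord0 (lift ord0 i)))//; congr (A _ _); apply: val_inj.
rewrite addr0 /cofactor expr0 mul1r !mxE. congr (_ * _).
  by congr (A _ _); apply: val_inj.
by congr determinant; apply/matrixP => i k; rewrite !mxE; congr (A _ _); apply: val_inj.
Qed.

Definition Tm N x : 'M[R]_N :=
  \matrix_(i, k) ((x i) *+ (k == i.+1 :> nat) - (x k) *+ (i == k.+1 :> nat)).

Definition sh x : nat -> R := fun i => x i.+1.

Lemma Tm_minor N x : row' ord0 (col' ord0 (Tm N.+1 x)) = Tm N (sh x).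
Proof. by apply/matrixP => i k; rewrite !mxE. Qed.

Definition DD N x : {poly R} := \det ('X%:M + map_mx polyC (Tm N x)).

Lemma DD0 x : DD 0 x = 1. Proof. exact: det_mx00. Qed.

Lemma DD1 x : DD 1 x = 'X.
Proof. by rewrite /DD det_mx11 !mxE/= !mulr0n subr0 addr0. Qed.

Lemma DD_rec N x : DD N.+2 x = 'X * DD N.+1 (sh x) + (x 0%N ^+ 2)%:P * DD N (sh (sh x)).
Proof.
have min N' x' : row' ord0 (col' ord0 ('X%:M + map_mx polyC (Tm N'.+1 x'))) =
    'X%:M + map_mx polyC (Tm N' (sh x')).
  by apply/matrixP => i k; rewrite !mxE.
rewrite /DD det_tridiagonal.
- rewrite !min !mxE/= !mulr0n !mulr1n !subr0 addr0 !add0r polyCN.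
  by rewrite rmorphXn /=; ring.
- by move=> [[|[|j]] hj]// _; rewrite !mxE/= !mulr0n subr0 addr0.
- by move=> [[|[|j]] hj]// _; rewrite !mxE/= !mulr0n subr0 addr0.
Qed.

Definition dE (C : nzRingType) N (c : C) : 'M[C]_N :=
  \matrix_(i, k) (c *+ ((i == 0%N :> nat) && (k == 0%N :> nat))).

(** The tridiagonal model of M. The corner [c] is b h_0 at the outset and a squared off-diagonal
    entry inside the recursion. *)
Definition QQ N (c : R) x : {poly R} := char_poly ((Tm N x)^T *m Tm N x + dE N c).

Lemma char_poly_corner N (A : 'M[R]_N.+1) c :
  char_poly (A + dE N.+1 c) = char_poly A - c *: char_poly (row' ord0 (col' ord0 A)).
Proof.
rewrite /char_poly (expand_det_row _ ord0) [in RHS](expand_det_row _ ord0).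
have cof1 k : cofactor (char_poly_mx (A + dE N.+1 c)) ord0 k =
    cofactor (char_poly_mx A) ord0 k.
  rewrite /cofactor; congr (_ * determinant _); apply/matrixP => i l; rewrite !mxE.
  by rewrite /= addr0.
rewrite big_ord_recl [in RHS]big_ord_recl [RHS]addrAC.
have rest k : char_poly_mx (A + dE N.+1 c) ord0 (lift ord0 k) *
    cofactor (char_poly_mx (A + dE N.+1 c)) ord0 (lift ord0 k) =
    char_poly_mx A ord0 (lift ord0 k) * cofactor (char_poly_mx A) ord0 (lift ord0 k).
  by rewrite cof1; congr (_ * _); rewrite !mxE /= mulr0n addr0.
rewrite (eq_bigr _ (fun k _ => rest k)).
congr (_ + _); rewrite cof1.
have -> : cofactor (char_poly_mx A) ord0 ord0 = \det (char_poly_mx (row' ord0 (col' ord0 A))).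
  by rewrite /cofactor expr0 mul1r row'_col'_char_poly_mx.
rewrite -mul_polyC -mulrBl; congr (_ * _).
by rewrite !mxE /= mulr1n polyCD; ring.
Qed.

(** Deleting the first row and column of T^T T leaves the same product for the shifted matrix, plus
    a corner x_0^2 contributed by the first row of T. *)
Lemma QQ_rec N c x :
  QQ N.+1 c x = QQ N.+1 0 x - c *: QQ N (x 0%N ^+ 2) (sh x).
Proof.
have dE0 : dE N.+1 (0 : R) = 0 by apply/matrixP => i k; rewrite !mxE mul0rn.
rewrite /QQ char_poly_corner dE0 addr0; congr (_ - _ *: char_poly _).
apply/matrixP => i k; rewrite !mxE big_ord_recl !mxE addrC; congr (_ + _).
  rewrite /= /bump /= !add1n !eqSS !mulr0n !subr0.
  by case: eqP; case: eqP => _ _; rewrite ?mulr1n ?mulr0n ?mul0r ?mulr0.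
by apply: eq_bigr => l _; rewrite !mxE.
Qed.

(** Antisymmetry gives T^T T = -T^2, and -X^2 + T^2 = -(X - T)(X + T); the two factors are
    transposes of each other. *)
Lemma QQ0 N x : QQ N 0 x \Po (- 'X^2) = (-1) ^+ N * DD N x ^+ 2.
Proof.
have dE0 : dE N (0 : R) = 0 by apply/matrixP => i k; rewrite !mxE mul0rn.
rewrite /QQ dE0 addr0 /char_poly -det_map_mx.
set T := map_mx polyC (Tm N x).
have Tt : T^T = - T.
  by apply/matrixP => i k; rewrite !mxE -polyCN opprB.
have -> : map_mx (comp_poly (- 'X^2)) (char_poly_mx ((Tm N x)^T *m Tm N x)) =
    (-1) *: (('X%:M - T) *m ('X%:M + T)).
  rewrite mulmxDr !mulmxBl (scalar_mxC 'X T) addrA subrK -scalar_mxM.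
  rewrite scaleN1r opprB -[T *m T]opprK -mulNmx -Tt.
  have -> : T^T *m T = map_mx polyC ((Tm N x)^T *m Tm N x).
    by rewrite map_mxM map_trmx.
  apply/matrixP => i k; rewrite !mxE comp_polyB comp_polyC raddfMn /=.
  by rewrite comp_polyX mulNrn expr2 addrC.
rewrite detZ det_mulmx; congr (_ * _); rewrite expr2; congr (_ * _).
by rewrite -det_tr -Tt linearD /= tr_scalar_mx trmxK.
Qed.

Lemma size_pp (ks : seq R) :
  size (pp ks).1 = uphalf (size ks) /\ size (pp ks).2 = (size ks)./2.
Proof.
elim: ks => [//|k ks [IH1 IH2]] /=; split=> //.
have E : size (ext (~~ odd (size ks)) (pp ks).1) = (size (pp ks).2).+1.
  rewrite size_ext IH1 IH2 uphalf_half.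
  by case: odd; rewrite ?addn0 ?addn1 ?add0n ?add1n.
by rewrite size_affs ?IH2// size_behead E IH2.
Qed.

Lemma pol_pp k (ks : seq R) : pol (pp (k :: ks)).1 =
  pol (pp ks).1 * 'X^(~~ odd (size ks)) - k *: pol (pp ks).2.
Proof.
have [s1 s2] := size_pp ks.
rewrite [(pp _).1]/= pol_stepT ?pol_ext// size_ext s1 s2 uphalf_half.
by case: odd; rewrite ?addn0 ?addn1 ?add0n ?add1n.
Qed.

(** det(X + T) has the parity of its order. With that parity split off and X replaced by -X^2, the
    recurrence of [pp] becomes [DD_rec]. *)
Lemma DD_pp x (h : seq R) : (forall i, (i < size h)%N -> nth 0 h i = x i ^+ 2) ->
  DD (size h).+1 x =
    (-1) ^+ (size h).+1./2 * 'X^(odd (size h).+1) * (pol (pp h).1 \Po (- 'X^2)) /\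
  DD (size h) (sh x) =
    (-1) ^+ (size h)./2 * 'X^(odd (size h)) * (pol (pp h).2 \Po (- 'X^2)).
Proof.
elim: h x => [|k h IH] x hx.
  by rewrite DD1 DD0 /= pol_nil rmorph1 !expr0 !mulr1 expr1 !mul1r.
have [|IH1 IH2] := IH (sh x); first by move=> i ih; exact: (hx i.+1).
split; last by rewrite IH1.
rewrite DD_rec IH1 IH2 -(hx 0%N)// pol_pp.
rewrite comp_polyB comp_polyM comp_polyZ /= !uphalf_half rmorphXn /= comp_polyX -mul_polyC.
case: odd => /=; rewrite ?expr0 ?expr1 ?add0n ?add1n ?exprS; ring.
Qed.

Lemma QQ0_pp x (h : seq R) : (forall i, (i < size h)%N -> nth 0 h i = x i ^+ 2) ->
  QQ (size h).+1 0 x = pol (pp h).1 ^+ 2 * 'X^(~~ odd (size h)).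
Proof.
move=> hx; apply/eqP; rewrite -subr_eq0 -(@comp_poly_eq0 _ _ (- 'X^2)) ?size_polyN ?size_polyXn//.
rewrite comp_polyB subr_eq0 QQ0 (DD_pp hx).1 comp_polyM !rmorphXn /= comp_polyX.
rewrite -signr_odd !exprMn sqrr_sign mul1r /=.
by case: odd => /=; rewrite ?expr0 ?expr1; apply/eqP; ring.
Qed.

(** By [QQ_rec], [QQ0_pp] and induction the polynomial is X^e Q^2 - c Q Q' with (Q, Q') the pair of
    [h]. The common factor Q splits off, and X^e Q - c Q' is one further recurrence step. *)
Lemma QQ_pp c x (h : seq R) : (forall i, (i < size h)%N -> nth 0 h i = x i ^+ 2) ->
  QQ (size h).+1 c x = pol (pp (c :: h)).1 * pol (pp (c :: h)).2.
Proof.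
elim: h c x => [|k h IH] c x hx; rewrite QQ_rec QQ0_pp// (pol_pp c) [(pp (c :: _)).2]/=
  mulrBl -scalerAl; (congr (_ - _ *: _); first by ring).
  by rewrite /QQ /char_poly det_mx00 /= !pol_nil mulr1.
have hx' i : (i < size h)%N -> nth 0 h i = sh x i ^+ 2 by move=> ih; exact: (hx i.+1).
by rewrite -(hx 0%N)// [nth _ _ _]/= IH// mulrC.
Qed.
End tridiagonal_det.

Section tridiagonal_char_poly.
Context (R : realType).
Notation C := R[i].
Notation nam := ((bool * (nat * nat)) + nat)%type.
Notation env := (nam -> R).
Local Notation toC := (real_complex R).

Lemma adjmx_real m n (A : 'M[R]_(m, n)) : adjmx (map_mx toC A) = map_mx toC A^T.
Proof. by apply/matrixP => i k; rewrite !mxE /= oppr0. Qed.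

Lemma ant_trirows N (v : env) a b : (a <= N)%N -> (b <= N)%N ->
  ant (trirows N v) a b =
  toC (Num.sqrt (v (inr a)) *+ (b == a.+1) - Num.sqrt (v (inr b)) *+ (a == b.+1)).
Proof.
move=> aN bN; rewrite /ant /cx /=; case: ltngtP => ab.
- rewrite (leq_trans ab bN) (_ : (a == b.+1) = false) ?subr0; last by lia.
  by case: eqP => _; apply: complexP => /=; rewrite ?mulr1n ?mulr0n ?oppr0.
- rewrite (leq_trans ab aN) (_ : (b == a.+1) = false) ?sub0r; last by lia.
  by case: eqP => _; apply: complexP => /=; rewrite ?mulr1n ?mulr0n ?oppr0.
- by rewrite ab ltn_eqF// subr0 mulr0n rmorph0.
Qed.

(** In tridiagonal form the row r is sqrt(h_0) e_0, so the rank-one term of M is the corner b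
    h_0. *)
Lemma char_poly_tri (b : R) N (v : env) : (forall a, (a <= N)%N -> 0 <= v (inr a)) ->
  let ks := b * v (inr 0%N) :: [seq v (inr a) | a <- iota 1 N] in
  char_poly (Mm N.+1 b (trirows N.+1 v)) =
  map_poly toC (pol (pp ks).1 * pol (pp ks).2).
Proof.
move=> v0 ks; pose x i := Num.sqrt (v (inr i.+1)).
have sz : size [seq v (inr a) | a <- iota 1 N] = N by rewrite size_map size_iota.
rewrite -(@QQ_pp _ _ x) ?sz; last first.
  move=> i iN; rewrite (nth_map 0%N) ?size_iota// nth_iota// sqr_sqrtr ?v0//.
rewrite /QQ map_char_poly; congr char_poly.
rewrite /Mm.
have -> : Bm N.+1 (trirows N.+1 v) = map_mx toC (Tm N.+1 x).
  apply/matrixP => i k; rewrite !mxE ant_trirows ?ltn_ord// !eqSS.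
rewrite adjmx_real map_mxD map_mxM; congr (_ + _).
apply/matrixP => i k; rewrite !mxE big_ord1 !mxE !ant_trirows ?ltn_ord//.
rewrite !mulr0n !subr0 !eqSS.
have s2 := sqr_sqrtr (v0 0%N (leq0n N)).
move: (Num.sqrt _) s2 => r <-.
by do 2 case: eqP => _ /=; rewrite ?mulr1n ?mulr0n; apply: complexP => /=; ring.
Qed.

End tridiagonal_char_poly.

(** * Measurability of spectral events *)

Section complex_measurability.
Context (R : realType) d (T : measurableType d).
Notation C := R[i].
Local Notation toC := (real_complex R).

Definition cm (f : T -> C) : Prop :=
  measurable_fun setT (fun t => complex.Re (f t)) /\
  measurable_fun setT (fun t => complex.Im (f t)).

Lemma cm_cst c : cm (fun=> c).
Proof. by split; exact: measurable_cst. Qed.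

Lemma cm_pair (x y : T -> R) : measurable_fun setT x -> measurable_fun setT y ->
  cm (fun t => Complex (x t) (y t)).
Proof. by []. Qed.

Lemma cmD f g : cm f -> cm g -> cm (fun t => f t + g t).
Proof.
move=> [f1 f2] [g1 g2]; split.
- by under eq_fun do rewrite raddfD; exact: measurable_funD.
- by under eq_fun do rewrite raddfD; exact: measurable_funD.
Qed.

Lemma cmN f : cm f -> cm (fun t => - f t).
Proof.
move=> [f1 f2]; split.
- by under eq_fun do rewrite raddfN; exact: measurableT_comp.
- by under eq_fun do rewrite raddfN; exact: measurableT_comp.
Qed.

Lemma cm_conj f : cm f -> cm (fun t => conjc (f t)).
Proof.
move=> [f1 f2]; split.
- by rewrite (_ : (fun _ => _) = (fun t => complex.Re (f t)))//; apply/funext => t; case: (f t).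
- rewrite (_ : (fun _ => _) = (fun t => - complex.Im (f t))); first exact: measurableT_comp.
  by apply/funext => t; case: (f t).
Qed.

Lemma cmM f g : cm f -> cm g -> cm (fun t => f t * g t).
Proof.
move=> [f1 f2] [g1 g2]; split.
- rewrite (_ : (fun _ => _) = (fun t => complex.Re (f t) * complex.Re (g t) -
      complex.Im (f t) * complex.Im (g t))).
    by apply: measurable_funB; exact: measurable_funM.
  by apply/funext => t; case: (f t) (g t) => [? ?] [? ?].
- rewrite (_ : (fun _ => _) = (fun t => complex.Re (f t) * complex.Im (g t) +
      complex.Im (f t) * complex.Re (g t))).
    by apply: measurable_funD; exact: measurable_funM.
  by apply/funext => t; case: (f t) (g t) => [? ?] [? ?].
Qed.

Lemma cm_sum I (r : seq I) (f : I -> T -> C) : (forall i, cm (f i)) ->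
  cm (fun t => \sum_(i <- r) f i t).
Proof.
move=> mf; elim: r => [|i r IH].
  by under eq_fun do rewrite big_nil; exact: cm_cst.
by under eq_fun do rewrite big_cons; exact: cmD.
Qed.

Definition pm (p : T -> {poly C}) : Prop := forall i, cm (fun t => (p t)`_i).

Lemma pm_cst p : pm (fun=> p).
Proof. by move=> i; exact: cm_cst. Qed.

Lemma pmD p q : pm p -> pm q -> pm (fun t => p t + q t).
Proof. by move=> mp mq i; under eq_fun do rewrite coefD; exact: cmD. Qed.

Lemma pmN p : pm p -> pm (fun t => - p t).
Proof. by move=> mp i; under eq_fun do rewrite coefN; exact: cmN. Qed.

Lemma pmC f : cm f -> pm (fun t => (f t)%:P).
Proof.
move=> mf i; under eq_fun do rewrite coefC.
by case: (i == 0%N) => //; exact: cm_cst.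
Qed.

Lemma pmM p q : pm p -> pm q -> pm (fun t => p t * q t).
Proof.
move=> mp mq i; under eq_fun do rewrite coefM.
by apply: cm_sum => j; exact: cmM.
Qed.

Lemma pm_sum I (r : seq I) (p : I -> T -> {poly C}) : (forall i, pm (p i)) ->
  pm (fun t => \sum_(i <- r) p i t).
Proof.
move=> mp; elim: r => [|i r IH].
  by under eq_fun do rewrite big_nil; exact: pm_cst.
by under eq_fun do rewrite big_cons; exact: pmD.
Qed.

Lemma pm_prod I (r : seq I) (p : I -> T -> {poly C}) : (forall i, pm (p i)) ->
  pm (fun t => \prod_(i <- r) p i t).
Proof.
move=> mp; elim: r => [|i r IH].
  by under eq_fun do rewrite big_nil; exact: pm_cst.
by under eq_fun do rewrite big_cons; exact: pmM.
Qed.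

Lemma pm_char_poly m (M : T -> 'M[C]_m) : (forall i k, cm (fun t => M t i k)) ->
  pm (fun t => char_poly (M t)).
Proof.
move=> mM; rewrite /char_poly /determinant; apply: pm_sum => s.
apply: pmM; first exact: pm_cst.
apply: pm_prod => i; under eq_fun do rewrite !mxE.
by apply: pmD; [exact: pm_cst|apply: pmN; exact: pmC].
Qed.

End complex_measurability.

Lemma mfun_Mm (R : realType) (N : nat) (b : R) i k d (T : measurableType d)
    (phi : _ -> T -> R) : (forall l, measurable_fun setT (phi l)) ->
  cm (fun t => Mm N b (fun l => phi l t) i k).
Proof.
move=> mphi.
have mant a a' : cm (fun t => ant (fun l => phi l t) a a').
  rewrite /ant; case: (a < a')%N; first exact: cm_pair.
  by case: (a' < a)%N; [apply: cmN; exact: cm_pair|exact: cm_cst].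
rewrite /Mm; under eq_fun do rewrite !mxE.
apply: cmD; last first.
  apply: cmM; first exact: cm_cst.
  apply: cm_sum => l; under eq_fun do rewrite !mxE.
  by apply: cmM => //; exact: cm_conj.
apply: cm_sum => l; under eq_fun do rewrite !mxE.
by apply: cmM => //; exact: cm_conj.
Qed.

Section spectrum.
Context (R : realType).
Notation C := R[i].
Local Notation toC := (real_complex R).
Variable m : nat.
Implicit Types (B : set (m.-tuple R)) (x : m.-tuple R) (c : seq R).

Definition spec B (p : {poly C}) : Prop := exists x, B x /\
  ((forall i j : 'I_m, (i <= j)%N -> tnth x j <= tnth x i) /\
   p = \prod_(i < m) ('X - ((tnth x i)%:C)%C%:P)).

(** For real coefficients the quantifier over spectra is replaced by the measurable map [eig], which
    leaves a measurable condition. *)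
Definition rspec B c : bool :=
  (ecoef (eig c) == c) && `[< exists2 x, B x & tval x = eig c >].

Lemma sorted_tnth x : (forall i j : 'I_m, (i <= j)%N -> tnth x j <= tnth x i) <->
  sorted >=%R x.
Proof.
split=> [h|so i j ij].
  apply/(sortedP 0) => i; rewrite size_tuple => im.
  have im' := ltnW im.
  by have := h (Ordinal im') (Ordinal im) (leqnSn i); rewrite !(tnth_nth 0).
rewrite !(tnth_nth 0); apply: (@sorted_leq_nth _ >=%R) => //.
- by move=> ? ? ? h1 h2; exact: le_trans h2 h1.
- exact: lexx.
- by rewrite inE size_tuple.
- by rewrite inE size_tuple.
Qed.

(** Sorting [eig c] does not change the polynomial, and [eig] recovers a sorted list from its
    polynomial. *)
Lemma sorted_eig c : ecoef (eig c) = c -> sorted >=%R (eig c).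
Proof.
move=> ec; set y := sort >=%R (eig c).
have so : sorted >=%R y by apply: sort_sorted => a b; exact: le_total.
have <- : y = eig c; last exact: so.
rewrite -[LHS]eig_ecoef//; congr eig; rewrite -[RHS]ec /ecoef.
by congr cof; apply: perm_big; rewrite perm_sort.
Qed.

Lemma prod_tnth x : \prod_(i < m) ('X - ((tnth x i)%:C)%C%:P) =
  map_poly toC (pol (ecoef x)).
Proof.
rewrite pol_ecoef rmorph_prod big_tuple; apply: eq_bigr => i _.
by rewrite rmorphB /= map_polyX map_polyC.
Qed.

Lemma spec_real B c : spec B (map_poly toC (pol c)) <-> size c = m /\ rspec B c.
Proof.
split=> [[x [Bx [/sorted_tnth so]]]|[sc /andP[/eqP ec /asboolP[x Bx xE]]]].
  rewrite prod_tnth => /(map_poly_inj toC)/(can_inj (@polK R)) ->.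
  rewrite size_ecoef size_tuple; split=> //.
  by rewrite /rspec eig_ecoef// eqxx; apply/asboolP; exists x.
exists x; split=> //; split; first by apply/sorted_tnth; rewrite xE sorted_eig.
by rewrite prod_tnth xE ec.
Qed.

(** Listed downwards from degree m-1 to match [pol]; [imcoef] is listed upwards, since only its
    vanishing matters. *)
Definition recoef (p : {poly C}) : seq R := [seq complex.Re p`_(m - i.+1) | i <- iota 0 m].
Definition imcoef (p : {poly C}) : seq R := [seq complex.Im p`_i | i <- iota 0 m].

Lemma imcoef_eq0 p : p \is monic -> size p = m.+1 -> imcoef p = nseq m 0 ->
  p = map_poly toC (pol (recoef p)).
Proof.
move=> /monicP mp sp e0; apply/polyP => i; rewrite coef_map polyseq_pol.
have sr : size (1 :: recoef p) = m.+1 by rewrite /= size_map size_iota.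
have [im|mi] := ltnP i m.+1; last first.
  by rewrite !nth_default ?rmorph0 ?size_rev ?sr ?sp.
rewrite nth_rev sr// subSS.
have [->|im'] := eqVneq i m.
  by rewrite subnn /= rmorph1 -mp /lead_coef sp.
have {im'}im : (i < m)%N by rewrite ltn_neqAle im' -ltnS.
have -> : (m - i = (m - i.+1).+1)%N by lia.
rewrite /= (nth_map 0%N) ?size_iota; last by lia.
rewrite nth_iota; last by lia.
have -> : (m - (0 + (m - i.+1)).+1 = i)%N by lia.
apply: complexP => //=.
have := congr1 (fun s => nth 0 s i) e0.
by rewrite (nth_map 0%N) ?size_iota// nth_iota// nth_nseq im.
Qed.

Lemma spec_char_poly B p : p \is monic -> size p = m.+1 ->
  `[< spec B p >] = (imcoef p == nseq m 0) && rspec B (recoef p).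
Proof.
move=> mp sp; have sr : size (recoef p) = m by rewrite size_map size_iota.
apply/asboolP/andP => [H|[/eqP i0 H]].
  have i0 : imcoef p = nseq m 0.
    have [x [_ [_ ->]]] := H; rewrite prod_tnth.
    apply: (@eq_from_nth _ 0); rewrite size_map size_iota ?size_nseq// => i im.
    by rewrite (nth_map 0%N) ?size_iota// nth_nseq im coef_map.
  rewrite i0 eqxx; split=> //.
  by have /spec_real[] : spec B (map_poly toC (pol (recoef p))) by rewrite -(imcoef_eq0 mp sp i0).
by rewrite [X in spec B X](imcoef_eq0 mp sp i0); apply/spec_real.
Qed.

Section measurability.
Context d (T : measurableType d).

Lemma measurable_rspec B (phi : T -> seq R) : measurable B -> mseq m phi ->
  measurable_fun setT (fun t => rspec B (phi t)).
Proof.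
move=> mB mphi; apply: measurable_and.
  by apply: (@measurable_eqseq _ m) => //; apply: mseq_ecoef; exact: mseq_eig.
have me := mseq_eig mphi.
pose psi t : m.-tuple R := Tuple (introT eqP (me.1 t)).
have mpsi : measurable_fun setT psi.
  apply/measurable_fun_tnthP => i; rewrite (_ : _ \o _ = fun t => nth 0 (eig (phi t)) i).
    exact: me.2.
  by apply/funext => t /=; rewrite (tnth_nth 0).
rewrite (_ : (fun _ => _) = (fun t => psi t \in B)).
  apply: (@measurable_fun_bool _ _ _ _ true); rewrite setTI.
  rewrite (_ : _ @^-1` _ = psi @^-1` B); last first.
    by apply/seteqP; split=> t /=; [move/set_mem|move/mem_set].
  by rewrite -[X in measurable X]setTI; exact: mpsi.
apply/funext => t; apply/asboolP/idP => [[x Bx xE]|/set_mem Bp].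
  by apply/mem_set; rewrite (_ : psi t = x)//; apply: val_inj; rewrite /= xE.
by exists (psi t).
Qed.

Lemma measurable_spec B (p : T -> {poly C}) : measurable B -> pm p ->
  (forall t, p t \is monic) -> (forall t, size (p t) = m.+1) ->
  measurable_fun setT (fun t => `[< spec B (p t) >]).
Proof.
move=> mB mp monp sp.
rewrite (_ : (fun _ => _) = (fun t => (imcoef (p t) == nseq m 0) && rspec B (recoef (p t)))); last first.
  by apply/funext => t; rewrite spec_char_poly.
apply: measurable_and.
  apply: (@measurable_eqseq _ m).
    split=> [t|i]; first by rewrite size_map size_iota.
    have [mi|im] := leqP m i.
      rewrite (_ : (fun _ => _) = cst 0); first exact: measurable_cst.
      by apply/funext => t; rewrite nth_default// size_map size_iota.
    rewrite (_ : (fun _ => _) = (fun t => complex.Im (p t)`_i)); first exact: (mp i).2.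
    by apply/funext => t; rewrite (nth_map 0%N) ?size_iota// nth_iota.
  by have := @mseq_cst R _ T (nseq m 0); rewrite size_nseq.
apply: measurable_rspec => //; split=> [t|i]; first by rewrite size_map size_iota.
have [mi|im] := leqP m i.
  rewrite (_ : (fun _ => _) = cst 0); first exact: measurable_cst.
  by apply/funext => t; rewrite nth_default// size_map size_iota.
rewrite (_ : (fun _ => _) = (fun t => complex.Re (p t)`_(m - i.+1))); first exact: (mp _).1.
by apply/funext => t; rewrite (nth_map 0%N) ?size_iota// nth_iota.
Qed.

End measurability.
End spectrum.

(** * The law of the spectrum under the Gaussian weight *)

Section Int_LS.
Local Open Scope ereal_scope.
Context (R : realType) (I : eqType).
Variable mu : {sigma_finite_measure set (measurableTypeR R) -> \bar R}.

Lemma Int_LS (s : seq I) (f : seq R -> \bar R) (u : I -> R) : uniq s ->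
  Int mu s (fun u => f [seq u i | i <- s]) u = LS mu (size s) f.
Proof.
elim: s f u => [//|i s IH] f u /= /andP[nis us].
apply: eq_integral => x _; rewrite -(IH (fun t => f (x :: t)) (upd u i x))//.
by apply: eq_Int => w wE /=; rewrite wE// upd_eq.
Qed.

End Int_LS.

Section spectral_law.
Local Open Scope ereal_scope.
Context (R : realType).
Notation C := R[i].
Notation mu := (@lebesgue_measure R).
Notation nam := ((bool * (nat * nat)) + nat)%type.
Notation env := (nam -> R).
Notation IntL := (@Int R nam mu).
Notation LSL := (@LS R mu).
Local Notation toC := (real_complex R).
Implicit Types (v w : env).

(** Test functions of the characteristic polynomial. Measurability is required only along monic
    families of fixed degree, which is what [measurable_spec] provides. *)
Definition test N (J : {poly C} -> R) : Prop := (forall p, 0 <= J p)%R /\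
  forall d (T : measurableType d) (p : T -> {poly C}), pm p ->
    (forall t, p t \is monic) -> (forall t, size (p t) = N.+1) ->
    measurable_fun setT (fun t => J (p t)).

Definition gauss N v : R := expR (- \sum_(i <- rows N 0) v i ^+ 2).

Definition spF N b J v : \bar R := (J (char_poly (Mm N b v)) * gauss N v)%:E.

Lemma mask_rows N t j i : mask N t j all_rows i -> i \in rows N 0.
Proof.
case: i => [[be [a c]]|//] /= /andP[ac _].
by rewrite -/(nm be a c) mem_rows.
Qed.

Lemma rho_inv_spF N b J : rho_inv N (spF N b J).
Proof.
move=> t j c s v cs j0 jN.
have P : pairing (mask N t j all_rows) (sgm t j) (@eps R t j) by exact: pairing_mask.
have := sum_rho v cs P (@mask_rows N t j) (uniq_rows N 0).
have := char_poly_rho b v cs j0 jN.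
move: (rho _ _ _ _ _ _) => w E1 E2.
by rewrite /spF /gauss E2; exact: (congr1 (fun p => (J p * _)%:E) E1).
Qed.

Lemma eq_Mm N b v w :
  (forall be a c, (a < c <= N)%N -> v (nm be a c) = w (nm be a c)) -> Mm N b v = Mm N b w.
Proof.
move=> vw; have aE a c : (a <= N)%N -> (c <= N)%N -> ant v a c = ant w a c.
  by move=> aN cN; rewrite /ant /cx; case: ltngtP => // ac; rewrite !vw ?ac.
have BE : Bm N v = Bm N w by apply/matrixP => i k; rewrite !mxE aE.
have rE : rv N v = rv N w by apply/matrixP => i k; rewrite !mxE aE.
by rewrite /Mm BE rE.
Qed.

Lemma mat_only_spF N b J : mat_only N (spF N b J).
Proof.
move=> v w vw; rewrite /spF (eq_Mm b vw) /gauss.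
have -> : (\sum_(i <- rows N 0) v i ^+ 2 = \sum_(i <- rows N 0) w i ^+ 2)%R; last by [].
apply: eq_big_seq => -[[be [a c]]|k].
  by rewrite -/(nm be a c) mem_rows => ac; rewrite vw//; lia.
by rewrite mem_rows_inr.
Qed.

Lemma mfun_gauss N : mfun (gauss N).
Proof.
move=> d T phi mphi; apply: measurableT_comp => //; apply: measurableT_comp => //.
by apply: measurable_sum => i; apply: measurable_funX; exact: mphi.
Qed.

Lemma spF_ge0 N b J v : test N J -> 0 <= spF N b J v.
Proof. by move=> [J0 _]; rewrite lee_fin mulr_ge0 ?expR_ge0. Qed.

Lemma mfun_spF N b J : test N J -> mfun (spF N b J).
Proof.
move=> [J0 mJ] d T phi mphi; apply/measurable_EFinP; apply: measurable_funM.
  apply: mJ => [|t|t].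
  - by apply: pm_char_poly => i k; exact: mfun_Mm.
  - exact: char_poly_monic.
  - exact: size_char_poly.
exact: mfun_gauss.
Qed.

Lemma gauss_trirows N v : (forall a, (a < N)%N -> 0 <= v (inr a))%R ->
  gauss N (trirows N v) = expR (- \sum_(a <- iota 0 N) v (inr a))%R.
Proof.
move=> v0; congr (expR (- _))%R.
have : forall p m, (p + m = N)%N ->
  (\sum_(i <- rows m p) trirows N v i ^+ 2 = \sum_(a <- iota p m) v (inr a))%R.
  move=> p m; elim: m p => [|m IH] p pm; first by rewrite !big_nil.
  have pN : (p < N)%N by lia.
  have S : (\sum_(i <- row p m.+1) trirows N v i ^+ 2 = v (inr p))%R.
    rewrite big_allpairs_dep big_cons big_seq1 -[iota _ _]/(p.+1 :: iota p.+2 m).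
    rewrite !big_cons !big_seq !big1 => [|j _|j].
    - by rewrite /= pN eqxx sqr_sqrtr ?v0// expr0n !addr0.
    - by rewrite /= pN expr0n.
    - by rewrite mem_iota /= pN => jp; rewrite gtn_eqF ?expr0n//; lia.
  by rewrite rowsS big_cat S (IH p.+1 _) ?addSnnS// -[iota p _]/(p :: iota p.+1 m) big_cons.
by move=> /(_ 0%N N (add0n N)).
Qed.

Lemma wt_neq0 (ks : seq R) : wt ks != 0%R -> all (fun k => 0 < k)%R ks.
Proof.
elim: ks => [//|k ks IH] /=; rewrite !mulf_eq0 !negb_or -andbA => /and3P[k0 _ /IH ->].
by case: ltrP k0; rewrite ?eqxx.
Qed.

(** Each step lowers the coefficient next to the leading one by k. So the sum of the roots is the
    sum of the k, the trace identity behind the exponential factor. *)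
Lemma head_pp (ks : seq R) : (head 0 (pp ks).1 = - \sum_(k <- ks) k)%R.
Proof.
elim: ks => [|k ks IH]; first by rewrite big_nil oppr0.
rewrite big_cons opprD addrC -IH /=; congr (_ - _)%R.
case: (pp ks).1 => [|a l]; first by case: (~~ _).
by case: (~~ _).
Qed.

Lemma pp2E k (ks : seq R) : (pp (k :: ks)).2 = (pp ks).1.
Proof. by []. Qed.

(** The heads of P and Q are -s1 and -s2 for the sums of roots. As s1 - s2 = b h_0 and s2 = h_1 +
    h_2 + ..., the exponent is minus the sum of all h_p. *)
Definition Gk (b : R) J (P Q : seq R) : \bar R :=
  (J (map_poly toC (pol P * pol Q)) * expR (head 0 Q - (head 0 Q - head 0 P) / b))%:E.

Lemma Gk_ge0 N b J P Q : test N J -> 0 <= Gk b J P Q.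
Proof. by move=> [J0 _]; rewrite lee_fin mulr_ge0 ?expR_ge0. Qed.

Lemma mfun2_Gk m k b J : test (m + k) J -> mfun2 m k (Gk b J).
Proof.
move=> [_ mJ] d T phi psi mphi mpsi; apply/measurable_EFinP; apply: measurable_funM.
  apply: mJ => [i|t|t].
  - have E t : (map_poly toC (pol (phi t) * pol (psi t)))`_i =
        toC (\sum_(j < i.+1) (pol (phi t))`_j * (pol (psi t))`_(i - j))%R.
      by rewrite coef_map coefM.
    split; under eq_fun do rewrite E /=; last exact: measurable_cst.
    apply: measurable_sum => j; apply: measurable_funM.
      exact: measurable_coef_pol mphi.
    exact: measurable_coef_pol mpsi.
  - by rewrite map_monic monicMl ?pol_monic.
  - rewrite size_map_poly size_monicM ?pol_monic ?monic_neq0 ?pol_monic//.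
    by rewrite !size_pol mphi.1 mpsi.1 addSn addnS.
apply: measurableT_comp => //; have mh := measurable_head mpsi.
apply: measurable_funB => //; apply: measurable_funM => //.
by apply: measurable_funB => //; exact: measurable_head mphi.
Qed.

(** The substitution k_0 = b h_0: one factor 1/b comes from dh_0 and [N] more from the weight
    h_0^N. *)
Lemma tri_integral N (b : R) J v : (0 < b)%R -> test N.+1 J ->
  IntL (hs N.+1 0) (fun v => (wt [seq v i | i <- hs N.+1 0])%:E * spF N.+1 b J (trirows N.+1 v)) v =
  (b ^- N.+1)%:E * LSL N.+1 (fun ks => (wt ks)%:E * Gk b J (pp ks).1 (pp ks).2).
Proof.
move=> b0 tJ.
pose f ks := (wt ks)%:E * (J (map_poly toC (pol (pp (b * head 0 ks :: behead ks)).1 *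
   pol (pp (b * head 0 ks :: behead ks)).2)) * expR (- \sum_(k <- ks) k))%:E.
transitivity (LSL N.+1 f).
  rewrite -[X in LSL X _](_ : size (hs N.+1 0) = _); last by rewrite size_map size_iota.
  rewrite -(Int_LS mu f v); last first.
    by rewrite map_inj_uniq ?iota_uniq// => i j [].
  apply: eq_Int => w _; rewrite /f.
  have [->|/wt_neq0/allP pos] := eqVneq (wt [seq w i | i <- hs N.+1 0]) 0%R.
    by rewrite !mul0e.
  have w0 a : (a < N.+1)%N -> (0 <= w (inr a))%R.
    move=> aN; apply/ltW/pos; apply/mapP; exists (inr a) => //.
    by rewrite map_f// mem_iota.
  congr (_ * _); rewrite /spF gauss_trirows// char_poly_tri//; congr (_ * _)%:E.
    by rewrite /hs -map_comp.
  by rewrite /hs -map_comp big_map.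
pose h ks := (wt ks)%:E * Gk b J (pp ks).1 (pp ks).2.
have h0 ks : 0 <= h ks.
  by apply: mule_ge0; [rewrite lee_fin wt_ge0|exact: Gk_ge0 tJ].
have mh : mfun1 N.+1 h.
  move=> d T phi mphi; apply: emeasurable_funM.
    by apply/measurable_EFinP; exact: measurable_wt mphi.
  have [m1 m2] := mseq_pp mphi.
  have tJ' : test (uphalf N.+1 + N.+1./2) J.
    by rewrite uphalf_half -addnA addnn odd_double_half.
  exact: (mfun2_Gk b tJ' m1 m2).
have bn0 : (0 <= b ^- N)%R by rewrite invr_ge0 exprn_ge0// ltW.
transitivity (\int[mu]_x LSL N (fun t => (b ^- N)%:E * h ((b * x + 0)%R :: t))).
  apply: eq_integral => x _; apply: eq_LS => t st.
  have W y : (wt (y :: t) = (0 < y)%R%:R * y ^+ N * wt t)%R by rewrite /= st.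
  rewrite /f /h /Gk addr0 !pp2E !head_pp !W pmulr_rgt0// !big_cons.
  rewrite -[head 0%R (x :: t)]/x -[behead (x :: t)]/t.
  rewrite -!EFinM !mulrA; congr (_%:E).
  have bN : (b ^+ N != 0)%R by rewrite expf_neq0// gt_eqF.
  have -> : (- (x + \sum_(j <- t) j) =
     - \sum_(k <- t) k - (- \sum_(k <- t) k - - (b * x + \sum_(j <- t) j)) / b)%R.
    by field; rewrite gt_eqF.
  by rewrite exprMn; congr (_ * _)%R; field.
have mc : mfun1 N.+1 (fun ks => (b ^- N)%:E * h ks).
  move=> d T phi mphi; apply: emeasurable_funM; last exact: mh.
  exact: measurable_cst.
have c0 ks : 0 <= (b ^- N)%:E * h ks by rewrite mule_ge0// lee_fin.
rewrite (@lebesgue_affine R b 0 (fun x => LSL N (fun t => (b ^- N)%:E * h (x :: t)))); last 3 first.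
- by rewrite gt_eqF.
- exact: (@measurable_LS_cons R mu N _ mc c0).
- by move=> y; apply: LS_ge0.
rewrite -[X in _ * X]/(LSL N.+1 (fun ks => (b ^- N)%:E * h ks)) (LS_Zl mu _ mh h0)//.
rewrite muleA -EFinM ger0_norm ?invr_ge0 ?ltW//.
by rewrite exprS invfM.
Qed.

End spectral_law.

Section spectral_density.
Local Open Scope ereal_scope.
Context (R : realType).
Notation C := R[i].
Notation mu := (@lebesgue_measure R).
Notation nam := ((bool * (nat * nat)) + nat)%type.
Notation env := (nam -> R).
Notation IntL := (@Int R nam mu).
Notation LSL := (@LS R mu).
Local Notation toC := (real_complex R).

Definition sden (b : R) (x : seq R) : R :=
  let s1 := (\sum_(a <- alt x) a)%R in let s2 := (\sum_(a <- alt (behead x)) a)%R in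
  ((sorted >%R (rcons x 0%R))%:R * vdm x * expR (- s2 - (s1 - s2) / b))%R.

Theorem spectral_law n (b : R) : (0 < b)%R -> (0 < n)%N -> exists2 c : \bar R, 0 <= c &
  forall J v, test (n + n) J -> IntL (rows (n + n) 0) (spF (n + n) b J) v =
    c * LSL (n + n) (fun x => (sden b x * J (map_poly toC (pol (ecoef x))))%:E).
Proof.
move=> b0 n0; have [c c0 H] := @tri_reduction R (n + n) (n + n) 0 (add0n _).
exists (c * (b ^- (n + n))%:E).
  by rewrite mule_ge0// lee_fin invr_ge0 exprn_ge0// ltW.
move=> J v tJ.
have T0 w : trirows 0 w = w by apply/funext => -[[be [a k]]|k].
transitivity (IntL (rows (n + n) 0) (fun w => spF (n + n) b J (trirows 0 w)) v).
  by congr (IntL _ _ _); apply/funext => w; rewrite T0.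
rewrite H; last 4 first.
- exact: rho_inv_spF.
- exact: mat_only_spF.
- exact: mfun_spF.
- by move=> w; exact: spF_ge0 tJ.
rewrite -muleA; congr (c * _).
have NE : (n + n = (n + n).-1.+1)%N by rewrite prednK// addn_gt0 n0.
have tJ' : test (n + n).-1.+1 J by rewrite -NE.
have := tri_integral v b0 tJ'; rewrite -NE => ->; congr (_ * _).
rewrite (@LS_interlaced R n (Gk b J)) => [|//|P Q]; last 2 first.
- exact: mfun2_Gk.
- exact: Gk_ge0 tJ.
apply: eq_LS => x sx; rewrite /Gk -EFinM /sden !head_ecoef; congr (_%:E).
rewrite [RHS]mulrAC -!mulrA; congr (_ * (_ * _))%R.
have -> : (pol (ecoef (alt x)) * pol (ecoef (alt (behead x))) = pol (ecoef x))%R.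
  by rewrite !pol_ecoef -big_cat; apply: perm_big; exact: perm_alt.
congr (_ * expR _)%R; field.
by rewrite gt_eqF.
Qed.

End spectral_density.

(** * Gaussian measure against Lebesgue measure *)

Section normal_integral.
Local Open Scope ereal_scope.
Context (R : realType) (sigma : R).
Notation mu := (@lebesgue_measure R).
Notation nu := (normal_prob (0 : R) sigma).
Notation pdf := (normal_pdf (0 : R) sigma).

Lemma integral_normal_probE (f : R -> \bar R) : measurable_fun setT f ->
  (forall x, 0 <= f x) -> \int[nu]_x f x = \int[mu]_x ((pdf x)%:E * f x).
Proof.
move=> mf f0.
rewrite (@ge0_integral_transfer _ _ (measurableTypeR R) (measurableTypeR R) R mu nu idfun pdf)//.
- exact: measurable_id.
- exact: measurable_normal_pdf.
- by move=> x; exact: normal_pdf_ge0.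
move=> A mA; transitivity (\int[mu]_(x in A) (pdf x)%:E); first by [].
rewrite [LHS]integral_mkcond; apply: eq_integral => x _.
by rewrite /= patchE indicE; case: (x \in A); rewrite ?mulr1 ?mulr0.
Qed.

Lemma iter_int_Int (m : {sigma_finite_measure set (measurableTypeR R) -> \bar R}) (I : finType)
    (f : #|I|.-tuple (measurableTypeR R) -> \bar R) (g : (I -> R) -> \bar R) u0 :
  (forall w, f w = g (fun i => tnth w (enum_rank i))) ->
  iter_int m #|I| f = Int m (enum I) g u0.
Proof.
move=> fg.
pose h (s : seq R) := g (fun i => nth 0%R s (enum_rank i)).
rewrite (@iter_intE R m #|I| f h); last first.
  move=> w; rewrite fg /h; congr g; apply/funext => i; exact: tnth_nth.
rewrite cardE -(Int_LS m h u0 (enum_uniq I)).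
apply: eq_Int => u _; rewrite /h; congr g; apply/funext => i.
by rewrite (nth_map i) -?cardE ?ltn_ord// nth_enum_rank.
Qed.

Lemma Int_map (m : {sigma_finite_measure set (measurableTypeR R) -> \bar R})
    (I I' : eqType) (k : I -> I') (s : seq I) (g : (I -> R) -> \bar R) (v : I' -> R) :
  injective k ->
  Int m [seq k i | i <- s] (fun v => g (v \o k)) v = Int m s g (v \o k).
Proof.
move=> kI; elim: s v => [//|i s IH] v /=; apply: eq_integral => x _; rewrite IH.
congr (Int _ _ _ _); apply/funext => j; rewrite /upd /=.
by rewrite (inj_eq kI).
Qed.

Variable I : eqType.
Implicit Types (v : I -> R) (f : (I -> R) -> \bar R) (s : seq I).

(** [nu] has mass 1, so coordinates that [f] ignores integrate out. *)
Lemma Int_nu_cst s f v : (forall i v x, i \in s -> f (upd v i x) = f v) ->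
  Int nu s f v = f v.
Proof.
elim: s v => [//|i s IH] v fs /=.
transitivity (\int[nu]_x cst (f v) x).
  apply: eq_integral => x _; rewrite IH => [|j w y js]; last by apply: fs; rewrite inE js orbT.
  by apply: fs; exact: mem_head.
rewrite integral_cst// -[RHS]mule1; congr (_ * _).
exact: (@probability_setT _ _ _ nu).
Qed.

Lemma Int_nu_density s f v : uniq s -> mfun f -> (forall v, 0 <= f v) ->
  Int nu s f v = Int mu s (fun v => (\prod_(i <- s) pdf (v i))%:E * f v) v.
Proof.
move=> us mf f0; elim: s us v => [|i s IH] us v /=; first by rewrite big_nil mul1e.
move: us => /andP[nis us].
have m1 : mfun (fun v => (\prod_(j <- s) pdf (v j))%:E * f v).
  move=> d T phi mphi; apply: emeasurable_funM; last exact: mf.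
  apply/measurable_EFinP; apply: measurable_prod => j _.
  by apply: measurableT_comp => //; exact: measurable_normal_pdf.
have p0 w : 0 <= (\prod_(j <- s) pdf (w j))%:E * f w.
  by rewrite mule_ge0// lee_fin prodr_ge0// => j _; exact: normal_pdf_ge0.
rewrite integral_normal_probE; last 2 first.
- by apply: (mfun_upd1 v i); apply: mfun_Int.
- by move=> x; exact: Int_ge0.
apply: eq_integral => x _; rewrite IH// -Int_Zl//; last by rewrite lee_fin normal_pdf_ge0.
apply: eq_Int => w wE; rewrite big_cons muleA -EFinM.
by rewrite wE// upd_eq.
Qed.

Definition flip (D : pred I) v : I -> R := fun i => if D i then (- v i)%R else v i.

Lemma mfun_flip D f : mfun f -> mfun (fun v => f (flip D v)).
Proof.
move=> mf d T phi mphi; apply: mf => i; rewrite /flip.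
by case: (D i); [exact: measurableT_comp|exact: mphi].
Qed.

Lemma Int_flip D s f v : mfun f -> (forall v, 0 <= f v) ->
  Int mu s (fun v => f (flip D v)) v = Int mu s f (flip D v).
Proof.
move=> mf f0; elim: s v => [//|i s IH] v /=.
have fu w x : flip D (upd w i x) = upd (flip D w) i (if D i then - x else x)%R.
  by apply/funext => j; rewrite /flip /upd; case: eqVneq => [->|].
transitivity (\int[mu]_x Int mu s f (upd (flip D v) i (if D i then - x else x)%R)).
  by apply: eq_integral => x _; rewrite IH fu.
case: (D i) => //.
transitivity (\int[mu]_x Int mu s f (upd (flip D v) i (-1 * x + 0)%R)).
  by apply: eq_integral => x _; rewrite mulN1r addr0.
rewrite (@lebesgue_affine R (-1) 0 (fun x => Int mu s f (upd (flip D v) i x))); last 3 first.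
- by rewrite oppr_eq0 oner_neq0.
- by apply: (mfun_upd1 (flip D v) i); apply: mfun_Int.
- by move=> y; exact: Int_ge0.
by rewrite invrN1 normrN1 mul1e.
Qed.

End normal_integral.

(** * From the random matrix to named coordinates *)

Section ensemble.
Local Open Scope ereal_scope.
Context (R : realType) (n : nat).
Notation C := R[i].
Notation mu := (@lebesgue_measure R).
Notation nu := (normal_prob (0 : R) (Num.sqrt (2^-1 : R))).
Notation nam := ((bool * (nat * nat)) + nat)%type.
Notation env := (nam -> R).
Notation IntL := (@Int R nam mu).
Notation N := (2 * n)%N.

(** The bordering: the vector becomes row 0, and the indices of the array Y move up by 1. *)
Definition kap (i : Ipar n) : nam :=
  match i with
  | inl (be, (j, k)) => nm be j.+1 k.+1
  | inr (be, j) => nm be 0 j.+1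
  end.

Lemma kap_inj : injective kap.
Proof.
move=> [[be [j k]]|[be j]] [[be' [j' k']]|[be' j']] //= [].
  by move=> -> /val_inj -> /val_inj ->.
by move=> -> /val_inj ->.
Qed.

Definition kext (u : Ipar n -> R) : env := fun i =>
  if [pick j | kap j == i] is Some j then u j else 0%R.

Lemma kextE u j : kext u (kap j) = u j.
Proof.
rewrite /kext; case: pickP => [k /eqP/kap_inj ->//|/(_ j)].
by rewrite eqxx.
Qed.

Lemma rows_kap i : i \in rows N 0 -> exists j, i = kap j.
Proof.
case: i => [[be [a c]]|k]; last by rewrite mem_rows_inr.
rewrite -/(nm be a c) mem_rows; case: c => [|c]; first by lia.
move=> /andP[_ /andP[ac cN]].
case: a ac => [|a] ac; first by exists (inr (be, Ordinal cN)).
have aN : (a < N)%N by exact: leq_trans (ac : (a < c)%N) (ltnW cN).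
by exists (inl (be, (Ordinal aN, Ordinal cN))).
Qed.

(* The vector enters Mm as a row, through its complex conjugate. *)
Definition conj0 : pred nam := fun i => if i is inl (true, (0%N, _)) then true else false.

Lemma Mmat_kext b w : Mmat b w =
  Mm N b (flip conj0 (kext (fun i => tnth w (enum_rank i)))).
Proof.
set v := kext _.
have vE i : v (kap i) = Defs.coord w i by rewrite /v kextE.
have XE : Xmat w = Bm N (flip conj0 v).
  apply/matrixP => i k; rewrite !mxE /ant /cx /flip /= !ltnS.
  by rewrite -!vE.
have xE : xvec w = adjmx (rv N (flip conj0 v)).
  apply/matrixP => i k; rewrite !mxE /cx /flip /= opprK.
  by rewrite -!vE.
by rewrite /Mmat /Mm XE xE adjmxK.
Qed.

(** Variance 1/2 makes the exponent of each factor exactly -v^2, as in [gauss]. *)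
Lemma prod_pdf (v : env) s :
  (\prod_(i <- s) normal_pdf 0 (Num.sqrt 2^-1) (v i) =
   normal_peak (Num.sqrt 2^-1) ^+ size s * expR (- \sum_(i <- s) v i ^+ 2))%R.
Proof.
have s2 : (Num.sqrt (2^-1 : R) ^+ 2 = 2^-1)%R by rewrite sqr_sqrtr// invr_ge0.
have s0 : Num.sqrt (2^-1 : R) != 0%R by rewrite gt_eqF// sqrtr_gt0 invr_gt0.
elim: s => [|i s IH]; first by rewrite !big_nil oppr0 expR0 mulr1.
rewrite !big_cons IH normal_pdfE//= /normal_fun s2 subr0 opprD expRD.
rewrite (_ : (- v i ^+ 2 / (2^-1 *+ 2) = - v i ^+ 2)%R); last by field.
by rewrite mulrACA -exprS.
Qed.

Theorem iter_int_normal : exists2 c : \bar R, 0 <= c & forall (b : R) J v,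
  test N J ->
  iter_int nu #|Ipar n| (fun w => (J (char_poly (Mmat b w)))%:E) =
  c * IntL (rows N 0) (spF N b J) v.
Proof.
exists ((normal_peak (Num.sqrt (2^-1 : R)) ^+ size (rows N 0))%:E).
  by rewrite lee_fin exprn_ge0// normal_peak_ge0.
move=> b J v' tJ.
pose v : env := flip conj0 v'.
have v'E : v' = flip conj0 v.
  by apply/funext => i; rewrite /v /flip; case: (conj0 i); rewrite ?opprK.
pose G (v : env) := (J (char_poly (Mm N b (flip conj0 v))))%:E.
have G0 w : 0 <= G w by rewrite lee_fin; case: tJ.
have mG : mfun G.
  apply: (mfun_flip conj0 (f := fun v => (J (char_poly (Mm N b v)))%:E)).
  move=> d T phi mphi; apply/measurable_EFinP; apply: tJ.2 => [|t|t].
  - by apply: pm_char_poly => i k; exact: mfun_Mm.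
  - exact: char_poly_monic.
  - exact: size_char_poly.
have Gdep w w' : (forall i, i \in rows N 0 -> w i = w' i) -> G w = G w'.
  move=> ww; rewrite /G (@eq_Mm R N b _ (flip conj0 w'))// => be a c ac.
  by rewrite /flip ww// mem_rows; lia.
rewrite (@iter_int_Int R nu _ _ (fun u => G (kext u)) (v \o kap)); last first.
  by move=> w; rewrite Mmat_kext.
rewrite -(Int_map nu _ (fun u => G (kext u)) v kap_inj).
set L := [seq kap i | i <- _].
have uL : uniq L by rewrite map_inj_uniq ?enum_uniq//; exact: kap_inj.
transitivity (Int nu L G v).
  apply: eq_Int => w _; apply: Gdep => i /rows_kap[j ->].
  by rewrite kextE.
(* The names of the entries Y_{jk} with k <= j, on which the matrix does not depend. *)
pose junk := [seq i <- L | i \notin rows N 0].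
rewrite (@Int_perm _ _ nu L (rows N 0 ++ junk))//; last first.
  apply: uniq_perm => //.
    rewrite cat_uniq uniq_rows filter_uniq// andbT /=.
    by apply/hasPn => i; rewrite mem_filter => /andP[].
  move=> i; rewrite mem_cat mem_filter; case: (boolP (i \in rows N 0)) => //= ir.
  by have [j ->] := rows_kap ir; rewrite map_f// mem_enum.
rewrite Int_cat.
transitivity (Int nu (rows N 0) G v).
  apply: eq_Int => w _; apply: Int_nu_cst => i w' x; rewrite mem_filter => /andP[ir _].
  by apply: Gdep => j jr; rewrite upd_neq//; apply: contraNneq ir => <-.
rewrite Int_nu_density ?uniq_rows//.
transitivity (IntL (rows N 0) (fun w =>
    (normal_peak (Num.sqrt (2^-1 : R)) ^+ size (rows N 0))%:E *
    spF N b J (flip conj0 w)) v).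
  apply: eq_Int => w _; rewrite prod_pdf /G /spF -!EFinM; congr (_%:E).
  rewrite -mulrA; congr (_ * _)%R; rewrite mulrC; congr (_ * _)%R.
  rewrite /gauss; congr (expR (- _))%R; apply: eq_bigr => i _.
  by rewrite /flip; case: (conj0 i); rewrite ?sqrrN.
rewrite Int_Zl; last 3 first.
- by rewrite lee_fin exprn_ge0// normal_peak_ge0.
- by apply: mfun_flip; exact: mfun_spF.
- by move=> w; exact: spF_ge0 tJ.
by rewrite Int_flip -?v'E//; [exact: mfun_spF|move=> w; exact: spF_ge0 tJ].
Qed.

End ensemble.

(** * The density of the statement *)

Section density.
Local Open Scope ereal_scope.
Context (R : realType).
Notation mu := (@lebesgue_measure R).
Notation LSL := (@LS R mu).
Implicit Types (s : seq R).

(** With A = 1 - 2/b, the exponent of [dens] is -(s1 + s2)/2 + A (s1 - s2)/2 = -s2 - (s1 - s2)/b. *)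
Definition wden (b : R) s : R :=
  let s1 := (\sum_(a <- alt s) a)%R in let s2 := (\sum_(a <- alt (behead s)) a)%R in
  (vdm s * expR (- s2 - (s1 - s2) / b))%R.

Definition reg s : bool := sorted >%R s && (0 <= last 0 s)%R.

Lemma sorted_rcons0 s (x : R) :
  sorted >%R (rcons (rcons s x) 0%R) = sorted >%R (rcons s x) && (0 < x)%R.
Proof. by case: s => [|a s] /=; rewrite ?andbT// rcons_path last_rcons. Qed.

Lemma measurable_wden n b d (T : measurableType d) (phi : T -> seq R) :
  mseq (n + n) phi -> measurable_fun setT (fun t => wden b (phi t)).
Proof.
move=> mphi; apply: measurable_funM; first exact: measurable_vdm mphi.
have [m1 m2] := mseq_alt mphi.
have h d' (T' : measurableType d') (psi : T' -> seq R) k : mseq k psi ->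
    measurable_fun setT (fun t => \sum_(a <- psi t) a)%R.
  move=> mpsi; rewrite (_ : (fun _ => _) = (fun t => - head 0 (ecoef (psi t)))%R).
    by apply: measurableT_comp => //; apply: measurable_head; exact: mseq_ecoef mpsi.
  by apply/funext => t; rewrite head_ecoef opprK.
have [h1 h2] := (h _ _ _ _ m1, h _ _ _ _ m2).
apply: measurableT_comp => //; apply: measurable_funB; first exact: measurableT_comp.
by apply: measurable_funM => //; exact: measurable_funB.
Qed.

(** [sden] wants the smallest root positive, [reg] only nonnegative; in the innermost integral they
    differ at the single point 0. *)
Lemma LS_boundary n b (h : seq R -> R) : (0 < n)%N ->
  (forall d (T : measurableType d) (phi : T -> seq R), mseq (n + n) phi ->
    measurable_fun setT (fun t => h (phi t))) -> (forall s, 0 <= h s)%R ->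
  LSL (n + n) (fun s => (sden b s * h s)%:E) =
  LSL (n + n) (fun s => ((reg s)%:R * wden b s * h s)%:E).
Proof.
move=> n0 mh h0; have NE : (n + n = (n + n).-1.+1)%N by rewrite prednK// addn_gt0 n0.
rewrite NE !LS_rcons; apply: eq_LS => s ss.
have ms d (T : measurableType d) (x : T -> R) : measurable_fun setT x ->
    mseq (n + n) (fun t => rcons s (x t)).
  move=> mx; rewrite NE -ss; elim: (s) => [|a l IH].
    by apply: mseq_cons => //; exact: mseq_nil.
  by apply: mseq_cons => //; exact: measurable_cst.
have w0 s' : sorted >%R s' -> (0 <= wden b s')%R.
  by move=> so; rewrite mulr_ge0 ?expR_ge0// ltW// vdm_gt0.
have mwh : measurable_fun setT (fun x : measurableTypeR R => wden b (rcons s x) * h (rcons s x))%R.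
  have mr := ms _ _ _ (@measurable_id _ (measurableTypeR R) setT).
  by apply: measurable_funM; [exact: measurable_wden mr|exact: mh].
have mso : measurable_fun setT (fun x : measurableTypeR R => sorted >%R (rcons s x)).
  have mr := ms _ _ _ (@measurable_id _ (measurableTypeR R) setT).
  exact: measurable_sorted mr.
have sE x : sden b (rcons s x) = ((sorted >%R (rcons s x) && (0 < x)%R)%:R * wden b (rcons s x))%R.
  by rewrite /sden sorted_rcons0 /wden mulrA.
apply: (@eq_integral_except R 0%R).
- apply/measurable_EFinP; rewrite (_ : (fun _ => _) = (fun x =>
    (sorted >%R (rcons s x) && (0 < x))%:R * (wden b (rcons s x) * h (rcons s x))))%R; last first.
    by apply/funext => x; rewrite sE mulrA.
  apply: measurable_funM => //; apply: measurable_natbool; apply: measurable_and => //.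
  exact: measurable_fun_ltr.
- apply/measurable_EFinP; rewrite (_ : (fun _ => _) = (fun x =>
    (sorted >%R (rcons s x) && (0 <= x))%:R * (wden b (rcons s x) * h (rcons s x))))%R; last first.
    by apply/funext => x; rewrite /reg last_rcons mulrA.
  apply: measurable_funM => //; apply: measurable_natbool; apply: measurable_and => //.
  exact: measurable_fun_ler.
- move=> x; rewrite lee_fin mulr_ge0// sE.
  by case so: (sorted _ _) => /=; rewrite ?mul0r// mulr_ge0// w0.
- move=> x; rewrite lee_fin mulr_ge0// /reg.
  by case so: (sorted _ _) => /=; rewrite ?mul0r// mulr_ge0// w0.
- by move=> x x0; rewrite sE /reg last_rcons lt_neqAle eq_sym x0.
Qed.

Lemma prod_vdm s :
  (\prod_(j < size s) \prod_(k < size s | (j < k)%N) (nth 0 s j - nth 0 s k) = vdm s)%R.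
Proof.
elim: s => [|a s IH]; first by rewrite big_ord0.
rewrite [vdm _]/= -IH [size _]/= big_ord_recl; congr (_ * _)%R.
  rewrite [RHS](big_nth 0%R) [RHS]big_mkord [LHS]big_mkcond big_ord_recl /= mul1r.
  by apply: eq_bigr.
apply: eq_bigr => j _; rewrite [LHS]big_mkcond big_ord_recl /= mul1r [RHS]big_mkcond.
by apply: eq_bigr.
Qed.

Lemma sum_alt_diff n s : size s = (2 * n)%N ->
  (\sum_(j < n) (nth 0 s (2 * j) - nth 0 s (2 * j).+1) =
   \sum_(a <- alt s) a - \sum_(a <- alt (behead s)) a)%R.
Proof.
elim: n s => [|n IH] s; first by move/size0nil->; rewrite big_ord0 !big_nil subr0.
case: s => [|a [|b s]]; rewrite ?mulnS//= => -[ss].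
rewrite big_ord_recl -/(alt (b :: s)) alt_cons !big_cons.
rewrite (eq_bigr (fun j : 'I_n => nth 0 s (2 * j) - nth 0 s (2 * j).+1))%R; last first.
  by move=> j _; rewrite lift0 mulnS.
by rewrite IH//= ; ring.
Qed.

Lemma dens_wden n b (x : (2 * n).-tuple R) : dens b x = wden b x.
Proof.
rewrite /dens /wden /=; move: (tval x) (size_tuple x) => {x} s ss.
rewrite -!expR_sum mulrC -[in LHS]ss prod_vdm; congr (_ * _)%R.
rewrite ss -expRD; congr expR.
rewrite -mulr_suml sumrN -mulr_suml -mulr_sumr (sum_alt_diff ss).
have -> : (\sum_(j < 2 * n) nth 0 s j = \sum_(a <- alt s) a + \sum_(a <- alt (behead s)) a)%R.
  rewrite -big_cat (perm_big _ (perm_alt s)) /= (big_nth 0%R) big_mkord.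
  by rewrite ss.
by move: (b^-1)%R => c; field.
Qed.

Lemma regionP n (x : (2 * n).-tuple R) : (0 < n)%N -> region x <-> reg x.
Proof.
move=> n0; rewrite /region /reg -nth_last size_tuple; split.
  move=> [h1 h2]; apply/andP; split=> //; apply/(sortedP 0%R) => i.
  by rewrite size_tuple; exact: h1.
move=> /andP[/(sortedP 0%R) h1 h2]; split=> // j jn.
by apply: h1; rewrite size_tuple.
Qed.

End density.

(** * Normalization and conclusion *)

Lemma iter_int_prob1 (R : realType) (sigma : R) k :
  iter_int (normal_prob (0 : R) sigma) k (fun=> 1%E) = 1%E.
Proof.
elim: k => [//|k IH] /=.
transitivity (\int[normal_prob (0 : R) sigma]_x (cst 1%E : R -> \bar R) x)%E.
  by apply: eq_integral => x _; exact: IH.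
rewrite integral_cst// mul1e; exact: (@probability_setT _ _ _ (normal_prob (0 : R) sigma)).
Qed.

Theorem theorem14 (R : realType) (n : nat) (b : R) :
  (1 <= n)%N -> 0 < b ->
  exists C : R, 0 < C /\
    forall B : set ((2 * n).-tuple R), measurable B ->
      iter_int (normal_prob (0 : R) (Num.sqrt (2^-1 : R))) (#|Ipar n|)
        (fun w => ((\1_[set w | exists x, B x /\ sorted_spectrum (Mmat b w) x] w : R))%:E)
      = iter_int (@lebesgue_measure R) (2 * n)
          (fun x => ((\1_(B `&` @region R n) x : R) * dens b x / C)%:E).
Proof.
move=> n0 b0; have NE : (2 * n = n + n)%N by rewrite mul2n addnn.
have [c1 c10 H1] := iter_int_normal R n.
have [c2 c20 H2] := spectral_law b0 n0.
pose toC := real_complex R.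
pose jr (J : {poly R[i]} -> R) s := J (map_poly toC (pol (ecoef s))).
have mjr J : test (n + n) J -> forall d (T : measurableType d) (phi : T -> seq R),
    mseq (n + n) phi -> measurable_fun setT (fun t => jr J (phi t)).
  move=> [_ mJ] d T phi mphi; apply: mJ => [i|t|t].
  - have mc := measurable_coef_pol i (mseq_ecoef mphi).
    by split; under eq_fun do rewrite coef_map /=; [exact: mc|exact: measurable_cst].
  - by rewrite map_monic pol_monic.
  - by rewrite size_map_poly size_pol size_ecoef mphi.1.
pose LSL := LS (@lebesgue_measure R).
have law J : test (n + n) J ->
    iter_int (normal_prob (0 : R) (Num.sqrt (2^-1 : R))) #|Ipar n|
      (fun w => (J (char_poly (Mmat b w)))%:E) =
    ((c1 * c2) * LSL (n + n)%N (fun s => ((reg s)%:R * wden b s * jr J s)%:E))%E.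
  move=> tJ; have tJ' : test (2 * n) J by rewrite NE.
  rewrite (H1 b J (fun=> 0) tJ') NE H2// muleA; congr (_ * _)%E.
  by apply: LS_boundary => // [|s]; [exact: mjr|case: tJ].
have rw0 s : 0 <= (reg s)%:R * wden b s.
  case rs : (reg s); last by rewrite mul0r.
  by move: rs => /andP[so _]; rewrite mul1r mulr_ge0 ?expR_ge0// ltW// vdm_gt0.
(* The constant test function compares total masses: 1 = c1 c2 D. This forces c1 c2, a priori in
   [0, +oo], to be finite and positive, and its inverse is the constant C. *)
have t1 : test (n + n) (fun=> 1 : R) by split=> // d T p _ _ _; exact: measurable_cst.
have := law _ t1; rewrite iter_int_prob1.
set D := LSL _ _ => E1.
have D0 : (0 <= D)%E by apply: LS_ge0 => s _; rewrite lee_fin mulr1.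
have [k k0 cE] : exists2 k : R, 0 < k & (c1 * c2 = k%:E)%E.
  have : (0 <= c1 * c2)%E by exact: mule_ge0.
  move: (c1 * c2)%E E1 => [k| |] E1 // k0.
    exists k => //; rewrite lt_neqAle -lee_fin k0 andbT; apply/eqP => k1.
    by move: E1; rewrite -k1 mul0e => /eqP; rewrite eqe oner_eq0.
  (* An infinite constant times D is 0 if D = 0 (the convention for oo * 0) and oo otherwise, never
     1. *)
  case: (eqVneq D 0%E) E1 => [->|Dn0]; first by rewrite mule0 => /eqP; rewrite eqe oner_eq0.
  by rewrite gt0_mulye// lt_neqAle eq_sym Dn0.
exists k^-1; rewrite invr_gt0; split=> // B mB.
pose J (p : {poly R[i]}) : R := `[< spec B p >]%:R.
have tJ : test (n + n) J.
  rewrite -NE; split=> [p|d T p mp monp sp]; first by [].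
  by apply: measurable_natbool; exact: measurable_spec.
(* Holds by conversion: [sorted_spectrum] is a condition on the characteristic polynomial, the one
   in [spec]. *)
transitivity (iter_int (normal_prob (0 : R) (Num.sqrt (2^-1 : R))) #|Ipar n|
      (fun w => (J (char_poly (Mmat b w)))%:E)); first by [].
rewrite law// cE.
(* [LS] integrates over lists, so the integrand on tuples is extended by 0 to lists of other
   lengths, which never occur. *)
pose g (s : seq R) : \bar R := if insub s is Some t then
  ((\1_(B `&` @region R n) (t : (2 * n).-tuple R) : R) * dens b t / k^-1)%:E else 0%E.
rewrite (@iter_intE R _ _ _ g); last by move=> t; rewrite /g valK.
rewrite NE -LS_Zl; last 3 first.
- by rewrite lee_fin ltW.
- move=> d T phi mphi; apply/measurable_EFinP; apply: measurable_funM; last exact: mjr.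
  apply: measurable_funM; last exact: measurable_wden mphi.
  apply: measurable_natbool; apply: measurable_and; first exact: measurable_sorted mphi.
  apply: measurable_fun_ler; first exact: measurable_cst.
  by under eq_fun do rewrite -nth_last mphi.1; exact: mphi.2.
- by move=> s; rewrite lee_fin mulr_ge0//; case: tJ.
apply: eq_LS => s ss.
have ss' : size s == (2 * n)%N by rewrite ss NE.
rewrite /g insubT -EFinM; congr (_%:E).
rewrite invrK dens_wden indicE mulrC; congr (_ * _).
rewrite [LHS]mulrAC; congr (_ * _); rewrite -natrM mulnb; congr (nat_of_bool _)%:R.
pose t : (2 * n).-tuple R := Tuple ss'.
have -> : Sub s ss' = t by apply: val_inj; rewrite SubK.
have sortE : reg s -> eig (ecoef s) = s.
  by move=> /andP[so _]; rewrite eig_ecoef// sorted_gt_ge.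
apply/idP/idP => [/andP[rs /asboolP/spec_real[_ /andP[_ /asboolP[x Bx]]]]|/set_mem[Bt rt]].
  rewrite sortE// => xE; have <- : x = t by apply: val_inj.
  by apply/mem_set; split=> //; apply/regionP => //; rewrite xE.
have rs : reg s by move/regionP: rt; apply.
rewrite rs; apply/asboolP/spec_real; rewrite size_ecoef (eqP ss'); split=> //.
by rewrite /rspec sortE// eqxx; apply/asboolP; exists t.
Qed.
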